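(* Let $\alpha^\pm=(\alpha_1^\pm\ge\alpha_2^\pm\ge\cdots\ge0)$, $\beta^\pm=(\beta_1^\pm\ge\beta_2^\pm\ge\cdots\ge0)$ be sequences of reals with $\sum_i(\alpha_i^\pm+\beta_i^\pm)<\infty$ and let $\gamma^\pm\ge0$. Suppose that $\lambda(N)$, a sequence of signatures with $\lambda(N)$ of size $N$, is such that, as $N\to\infty$, for every $i$ $$\frac{p_i^+}{N}\to\alpha_i^+,\qquad\frac{q_i^+}{N}\to\beta_i^+,\qquad\frac{p_i^-}{N}\to\alpha_i^-,\qquad\frac{q_i^-}{N}\to\beta_i^-,$$ and $$\frac{\sum_{i=1}^{d^+}(p_i^++q_i^+)}N\to\sum_{i=1}^\infty(\alpha_i^++\beta_i^+)+\gamma^+,\qquad\frac{\sum_{i=1}^{d^-}(p_i^-+q_i^-)}N\to\sum_{i=1}^\infty(\alpha_i^-+\beta_i^-)+\gamma^-.$$ Then for any $k$ $$\lim_{N\to\infty}S_{\lambda(N)}(x_1,\dots,x_k;N,1)=\prod_{\ell=1}^k\Phi_\infty\left(\alpha,\beta,\gamma;\frac{x_\ell}{x_\ell-1}\right),$$ where $$\Phi_\infty\left(\alpha,\beta,\gamma;\frac x{x-1}\right)=\exp\bigl(\gamma^+(x-1)+\gamma^-(x^{-1}-1)\bigr)\prod_{i=1}^\infty\frac{1+\beta_i^+(x-1)}{1-\alpha_i^+(x-1)}\cdot\frac{1+(1-\beta_i^-)(x-1)}{1+(1+\alpha_i^-)(x-1)}.$$ The convergence is uniform over the set $1-\varepsilon<|x_\ell|<1+\varepsilon$,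 $\ell=1,\dots,k$, for certain $\varepsilon>0$.
   Context: A signature of size $N$ is an $N$-tuple of integers $\lambda_1\ge\cdots\ge\lambda_N$. The Schur function is the symmetric Laurent polynomial $s_\lambda(u_1,\dots,u_N)=\det[u_i^{\lambda_j+N-j}]_{i,j=1}^N/\prod_{i<j}(u_i-u_j)$ and $S_\lambda(x_1,\dots,x_k;N,1)=s_\lambda(x_1,\dots,x_k,1^{N-k})/s_\lambda(1^N)$, where $1^m$ stands for $m$ arguments equal to $1$. For a Young diagram $\mu$ with row lengths $\mu_i$, column lengths $\mu_i'$ and main diagonal of length $d$, the modified Frobenius coordinates are $p_i=\mu_i-i+1/2$, $q_i=\mu_i'-i+1/2$, $i=1,\dots,d$. To a signature $\lambda$ one associates two Young diagrams: $\lambda^+$, whose row lengths are the positive $\lambda_i$'s, and $\lambda^-$, whose row lengths are minus the negative $\lambda_i$'s. Their modified Frobenius coordinates are $p_i^+,q_i^+$ ($i=1,\dots,d^+$) and $p_i^-,q_i^-$ ($i=1,\dots,d^-$), with coordinates of index larger than $d^\pm$ taken to be $0$; above they are computed for $\lambda=\lambda(N)$. *)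

(* Defs.v *)
From HB Require Import structures.
From mathcomp Require Import all_boot all_order all_algebra.
From mathcomp Require Import all_classical all_reals all_analysis.
From mathcomp Require Import complex.

Set Implicit Arguments.
Unset Strict Implicit.
Unset Printing Implicit Defensive.

Import Order.TTheory GRing.Theory Num.Theory.
Import numFieldNormedType.Exports.
Local Open Scope classical_set_scope.
Local Open Scope ring_scope.
Local Open Scope complex_scope.

(* The complex numbers over R. This alias gives them the topology which       *)
(* MathComp-Analysis attaches to every [numClosedFieldType], whereas the bare *)
(* type [R[i]] carries no topology. Moduli and the order are [Cplx R]-valued, *)
(* and x < y holds only if y - x is real.                                     *)
Definition Cplx (R : realType) : numClosedFieldType := R[i].

Definition of_real (R : realType) (r : R) : Cplx R := r%:C.

Definition cexp (R : realType) (z : Cplx R) : Cplx R :=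
  of_real (expR (complex.Re z)) *
  ((cos (complex.Im z) +i* sin (complex.Im z)) : Cplx R).

Definition signature (N : nat) := {l : N.-tuple int | sorted >=%R l}.

Section SchurFunctions.
Context {C : numFieldType}.

(* Laurent polynomials are identified with the functions they define. A point *)
(* with a zero coordinate is evaluated with the convention 0^-1 = 0; combining *)
(* equal exponents does not change the value there, so the function is still  *)
(* determined by the formal Laurent polynomial, hence by its values at the    *)
(* points with nonzero coordinates.                                           *)
Definition is_laurent (n : nat) (f : 'rV[C]_n -> C) :=
  exists s : seq (C * 'rV[int]_n),
    forall u, f u = \sum_(t <- s) t.1 * \prod_(i < n) u 0 i ^ t.2 0 i.

(* With rows and columns numbered from 0, the exponent lambda_j + N - j of    *)
(* the alternant becomes lambda_j + N - (j + 1).                              *)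
Definition is_schur (N : nat) (l : signature N) (s : 'rV[C]_N -> C) :=
  is_laurent s /\
  forall u : 'rV[C]_N, (forall i, u 0 i != 0) -> injective (u 0) ->
    s u = \det (\matrix_(i < N, j < N) u 0 i ^ (tnth (val l) j + N%:Z - j.+1%:Z))
          / \prod_(i < N) \prod_(j < N | (i < j)%N) (u 0 i - u 0 j).

(* The alternant is divisible by the Vandermonde product in the ring of       *)
(* Laurent polynomials, so exactly one function satisfies [is_schur l].       *)
Definition schur (N : nat) (l : signature N) : 'rV[C]_N -> C :=
  xget (fun=> 0) [set s | is_schur l s].

(* (x_1, ..., x_k, 1^(N-k)); when N < k the superfluous x_i are dropped,      *)
(* which is irrelevant for limits in N.                                       *)
Definition pad_ones (k N : nat) (x : 'rV[C]_k) : 'rV[C]_N :=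
  \row_(i < N) if insub (val i) is Some j then x 0 j else 1.

Definition normalized_schur (k N : nat) (l : signature N) (x : 'rV[C]_k) : C :=
  schur l (pad_ones N x) / schur l (const_mx 1).

End SchurFunctions.

(* Young diagrams are given by their nonincreasing sequence of row lengths.   *)
Definition pos_diagram (N : nat) (l : signature N) : seq nat :=
  [seq `|z|%N | z : int <- val l & 0 < z].
Definition neg_diagram (N : nat) (l : signature N) : seq nat :=
  rev [seq `|z|%N | z : int <- val l & z < 0].

(* Rows, columns and Frobenius coordinates are numbered from 0, so that index *)
(* i below corresponds to the index i + 1 of the usual notation.              *)
Definition row_length (mu : seq nat) (i : nat) : nat := nth 0%N mu i.
Definition col_length (mu : seq nat) (j : nat) : nat :=
  count (fun r => (j < r)%N) mu.
Definition diag_length (mu : seq nat) : nat :=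
  count (fun i => (i < row_length mu i)%N) (iota 0 (size mu)).

Definition frob_p (R : realType) (mu : seq nat) (i : nat) : R :=
  if (i < diag_length mu)%N then (row_length mu i)%:R - i.+1%:R + 1 / 2 else 0.
Definition frob_q (R : realType) (mu : seq nat) (i : nat) : R :=
  if (i < diag_length mu)%N then (col_length mu i)%:R - i.+1%:R + 1 / 2 else 0.
Definition frob_sum (R : realType) (mu : seq nat) : R :=
  \sum_(0 <= i < diag_length mu) (frob_p R mu i + frob_q R mu i).

(* Phi_infinity (alpha, beta, gamma; x / (x - 1)), as a function of x.        *)
Definition Phi_infty (R : realType) (alphap betap alpham betam : nat -> R)
    (gammap gammam : R) (x : Cplx R) : Cplx R :=
  cexp (of_real gammap * (x - 1) + of_real gammam * (x^-1 - 1)) *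
  limn (fun n => \prod_(0 <= i < n)
    ((1 + of_real (betap i) * (x - 1)) / (1 - of_real (alphap i) * (x - 1)) *
     ((1 + (1 - of_real (betam i)) * (x - 1)) /
      (1 + (1 + of_real (alpham i)) * (x - 1))))).

(* Main.v *)
(* One variable. Let S_N (x) = S_lambda (x; N, 1). Its Taylor coefficients    *)
(* at x = 1 are divided differences of binomial coefficients at the points    *)
(* lambda_i + N - i, and up to o(1) they are the coefficients of              *)
(* G_N (x) = H (N / (x - 1)), H (u) = prod_i (u + i) / (u + i - lambda_i).    *)
(* Reading the boxes of the two diagrams by principal hooks turns G_N into a  *)
(* product over Frobenius coordinates which converges to Phi_infinity. Both   *)
(* S_N and G_N have bounded Taylor expansions, on discs of a fixed radius, at *)
(* every point of the unit circle: G_N by the product formula, and S_N since  *)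
(* it is an average of powers of x over Gelfand-Tsetlin patterns which is     *)
(* bounded on the positive reals near 1. Hence the convergence of S_N - G_N   *)
(* to 0 near 1 propagates to an annulus.                                      *)
(*                                                                            *)
(* Several variables. A determinantal identity expresses S_N (x_1, ..., x_k)  *)
(* through derivatives of S_N (x_1), ..., S_N (x_k) and gives convergence to  *)
(* the product of the one-variable limits when the x_i are distinct and       *)
(* different from 1. As averages of monomials whose exponents have bounded    *)
(* exponential moments, the S_N are equi-Lipschitz on an annulus, so that the *)
(* convergence extends to all points and is uniform.                          *)

Require Import Defs.
From HB Require Import structures.
From mathcomp Require Import all_boot all_order all_algebra.
From mathcomp Require Import all_classical all_reals all_analysis.
From mathcomp Require Import complex perm.
From mathcomp Require Import ring lra zify.

Set Implicit Arguments.
Unset Strict Implicit.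
Unset Printing Implicit Defensive.

Import Order.TTheory GRing.Theory Num.Theory.
Import numFieldNormedType.Exports.
Local Open Scope classical_set_scope.
Local Open Scope ring_scope.

(** * Alternants and Gelfand-Tsetlin patterns *)

Section Determinants.
Context {C : fieldType}.

(** Two descriptions of the normalized Schur function S_N carry the proof. Summed over
    Gelfand-Tsetlin patterns ([alternant_gt], [schur_gt]) it is an average of monomials, which makes
    sense at coinciding arguments and is easy to estimate. As a determinant ([normalized_gt_det]) it
    is built from divided differences of m^b x^m at the shifted parts L_j, that is, from the powers
    (x d/dx)^b applied to (x - 1)^(N-1) S_N(x), where S_N(x) is the one-variable function.

    One variable. Expand the product of (u + N - i) / (u + N - L_i), i = 0, ..., N - 1, in partial
    fractions in u. With u = N / (x - 1), its Taylor coefficients at x = 1 are moments of the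
    resulting weights at the points L_j - N, while those of S_N are the factorial moments of the
    same weights ([schur_coef_fmoment]). As the moments grow at most geometrically with ratio N / r,
    both coefficients of a fixed order agree up to o(1) ([schur_coef_approx]). Principal hooks
    rewrite the product over Frobenius coordinates ([frobenius_product], [frob_fun_near1]). There,
    finitely many factors converge one by one, and the others are so close to 1 that their product
    behaves like the exponential of a sum; the part of that sum which no single coordinate accounts
    for is gamma ([half_product_cvg]).

    From a neighbourhood of 1 to an annulus. The hook product G_N has Taylor expansions of fixed
    radius and bounded norm at every point of the unit circle ([taylor_factor_pos],
    [taylor_factor_neg]). At 1 these bounds pass to S_N ([taylor_schur]), in particular to its
    values at rho and 1/rho for some rho > 1. Since S_N is an average of powers, this bounds
    exponential moments of the exponents ([gt_avg_pow_le]), hence Taylor norms of S_N all along the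
    circle ([taylor_normalized_gt]). An argument of Vitali type ([taylor_coef_cvg0], [taylor_cvg0])
    then carries S_N - G_N -> 0 from disc to disc around the circle ([schur_one_variable_limit]).

    Several variables. In the determinant the leading contribution comes from derivatives falling on
    (x - 1)^(N-1), each of which yields a factor of order N. What remains in the limit is a
    Vandermonde determinant in x_i / (x_i - 1), which cancels the denominator ([divdiff_expansion],
    [normalized_gt_cvg]); this requires distinct points different from 1. The exponential moments
    also make all S_N Lipschitz with a common constant ([normalized_gt_lipschitz]), and finite nets
    of admissible points turn pointwise into uniform convergence ([uniform_of_lipschitz]). *)

Lemma det_last_row1 n (a : nat -> nat -> C) : (forall j, a n j = 1) ->
  \det (\matrix_(i < n.+1, j < n.+1) a i j) =
  \det (\matrix_(i < n, j < n) (a i j - a i j.+1)).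
Proof.
move=> a1; set A := (X in \det X = _).
(* Right multiplication by this unipotent matrix subtracts from every column but the last its right
   neighbour; the last row becomes (0, ..., 0, 1). *)
pose U : 'M[C]_n.+1 :=
  \matrix_(i, j) ((i == j)%:R - ((i : nat) == j.+1)%:R).
have detU : \det U = 1.
  rewrite det_trig; last first.
    apply/is_trig_mxP => i j ij; rewrite mxE.
    by rewrite -val_eqE /= !ltn_eqF ?subrr // ltnW.
  by apply: big1 => i _; rewrite mxE eqxx ltn_eqF // subr0.
have AU i j : (A *m U) i j = a i j - (j < n)%:R * a i j.+1.
  rewrite mxE; under eq_bigr do rewrite !mxE mulrBr; rewrite sumrB.
  congr (_ - _).
    rewrite (bigD1 j) //= eqxx mulr1 big1 ?addr0 // => k /negbTE kj.
    by rewrite kj mulr0.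
  have [jn|nj] := ltnP j n.
    have jn1 : (j.+1 < n.+1)%N by [].
    rewrite (bigD1 (Ordinal jn1)) //= eqxx mulr1 big1 ?addr0 ?mul1r //.
    by move=> k; rewrite -val_eqE /= => /negbTE ->; rewrite mulr0.
  rewrite mul0r; apply: big1 => k _.
  by rewrite (ltn_eqF (leq_trans (ltn_ord k) _)) ?mulr0.
rewrite -[LHS]mulr1 -detU -det_mulmx (expand_det_row _ ord_max).
rewrite (bigD1 ord_max) //= AU ltnn mul0r subr0 a1 mul1r big1 ?addr0.
  rewrite /cofactor -signr_odd addnn odd_double expr0 mul1r.
  congr (\det _); apply/matrixP => i j; rewrite 2!mxE AU !mxE.
  by rewrite !lift_max ltn_ord mul1r.
move=> j jm; rewrite AU !a1.
by rewrite ltn_neqAle -ltnS ltn_ord andbT (jm : j != n :> nat) mulr1 subrr mul0r.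
Qed.

Lemma det_scale n (a b : 'I_n -> C) (e : 'I_n -> 'I_n -> C) :
  \det (\matrix_(i, j) (a i * e i j * b j)) =
  (\prod_i a i) * (\prod_j b j) * \det (\matrix_(i, j) e i j).
Proof.
have -> : \matrix_(i, j) (a i * e i j * b j) =
    diag_mx (\row_i a i) *m (\matrix_(i, j) e i j) *m diag_mx (\row_j b j).
  by apply/matrixP => i j; rewrite mul_mx_diag mul_diag_mx !mxE.
rewrite !det_mulmx !det_diag mulrAC; congr (_ * _ * _).
  by apply: eq_bigr => i _; rewrite mxE.
by apply: eq_bigr => i _; rewrite mxE.
Qed.

Definition int_range (a b : int) : seq int :=
  [seq a + k%:Z | k <- iota 0 `|b - a|].

Lemma mem_int_range a b m : a <= b ->
  m \in int_range a b -> a <= m /\ m < b.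
Proof.
move=> ab /mapP[k]; rewrite mem_iota /= add0n => kab ->.
by split; lia.
Qed.

Lemma telescope_int_range (F f : int -> C) (a b : int) : a <= b ->
  (forall m, F (m + 1) - F m = f m) ->
  \sum_(m <- int_range a b) f m = F b - F a.
Proof.
move=> ab Ff; rewrite /int_range big_map.
have -> : F b = F (a + `|b - a|%:Z).
  by congr F; lia.
elim: `|b - a|%N => [|k IHk]; first by rewrite big_nil addr0 subrr.
rewrite -addn1 iotaD big_cat /= big_seq1 IHk add0n -Ff.
by have -> : a + (k + 1)%N%:Z = a + k%:Z + 1; [lia | ring].
Qed.

(* The sequences M with L`_(j+1) <= M`_j < L`_j; in terms of signatures these *)
(* are the interlacing ones.                                                  *)
Fixpoint interlacing (n : nat) (L : seq int) : seq (seq int) :=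
  if n is n'.+1 then
    [seq rcons M m | M <- interlacing n' L, m <- int_range L`_n'.+1 L`_n']
  else [:: [::]].

Lemma size_interlacing n L M : M \in interlacing n (L : seq int) -> size M = n.
Proof.
elim: n M => [|n IHn] M /=; first by rewrite inE => /eqP->.
by case/allpairsP => -[M' m] /= [/IHn <- _ ->]; rewrite size_rcons.
Qed.

Lemma interlacingP n (L : seq int) M : (forall j, (j < n)%N -> L`_j.+1 <= L`_j) ->
  M \in interlacing n L ->
  forall j, (j < n)%N -> L`_j.+1 <= M`_j /\ M`_j < L`_j.
Proof.
elim: n M => [|n IHn] M //= Ldec /allpairsP[[M' m] /= [M'L mL ->]] j.
rewrite ltnS leq_eqVlt nth_rcons (size_interlacing M'L) => /orP[/eqP->|jn].
  rewrite ltnn eqxx; apply: mem_int_range mL; exact: Ldec.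
rewrite jn; apply: IHn => // i ni; apply: Ldec; exact: leq_trans ni _.
Qed.

Lemma prod_sum_interlacing n (L : seq int) (g : nat -> int -> C) :
  \prod_(j < n) (\sum_(m <- int_range L`_j.+1 L`_j) g j m) =
  \sum_(M <- interlacing n L) \prod_(j < n) g j M`_j.
Proof.
elim: n => [|n IHn]; first by rewrite big_ord0 /= big_seq1 big_ord0.
rewrite big_ord_recr IHn /= big_allpairs_dep big_distrl /= big_seq.
rewrite [RHS]big_seq; apply: eq_bigr => M ML; rewrite big_distrr /=.
apply: eq_bigr => m _; rewrite big_ord_recr /= nth_rcons (size_interlacing ML).
rewrite ltnn eqxx; congr (_ * _); apply: eq_bigr => j _.
by rewrite nth_rcons (size_interlacing ML) ltn_ord.
Qed.

(** The determinant is multilinear in its columns, and choosing one summand in each column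
    independently amounts to choosing an interlacing sequence. *)
Lemma det_sum_columns n (L : seq int) (f : nat -> int -> C) :
  \det (\matrix_(i < n, j < n) \sum_(m <- int_range L`_j.+1 L`_j) f i m) =
  \sum_(M <- interlacing n L) \det (\matrix_(i < n, j < n) f i M`_j).
Proof.
rewrite -det_tr; under eq_bigr do rewrite -det_tr.
rewrite /determinant exchange_big /=; apply: eq_bigr => s _.
rewrite -mulr_sumr; congr (_ * _).
pose g (j : nat) m := f (if insub j : option 'I_n is Some j' then s j' : nat else 0%N) m.
transitivity (\prod_(j < n) (\sum_(m <- int_range L`_j.+1 L`_j) g j m)).
  by apply: eq_bigr => j _; rewrite !mxE /g valK.
rewrite prod_sum_interlacing; apply: eq_bigr => M _.
by apply: eq_bigr => j _; rewrite !mxE /g valK.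
Qed.

Lemma sorted_int_lt (L : seq int) i j : sorted >%R L -> (i < j < size L)%N ->
  L`_j < L`_i :> int.
Proof.
move=> sL /andP[ij jL].
apply: (sorted_ltn_nth _ 0 sL) => //; rewrite ?inE ?(ltn_trans ij) // => x y z /= yx zy.
exact: lt_trans zy yx.
Qed.

Lemma sorted_interlacing n (L : seq int) M : sorted >%R L -> size L = n.+1 ->
  M \in interlacing n L -> sorted >%R M.
Proof.
move=> sL szL ML; have szM := size_interlacing ML.
have Ldec j : (j < n)%N -> L`_j.+1 <= L`_j.
  by move=> jn; apply/ltW/sorted_int_lt => //; rewrite szL ltnSn.
apply/(sortedP 0) => i; rewrite szM => iM.
have [lM _] := interlacingP Ldec ML (ltnW iM).
have [_ Mu] := interlacingP Ldec ML iM.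
exact: lt_le_trans Mu lM.
Qed.

(** One step of the branching rule: after neighbouring columns are subtracted, each entry F(L_j) -
    F(L_(j+1)) telescopes into a sum of its discrete derivative [f] over the integers between the
    two nodes. *)
Lemma det_interlacing n (L : seq int) (F f : nat -> int -> C) :
  sorted >%R L -> size L = n.+1 ->
  (forall i m, (i < n)%N -> F i (m + 1) - F i m = f i m) ->
  (forall m, F n m = 1) ->
  \det (\matrix_(i < n.+1, j < n.+1) F i L`_j) =
  \sum_(M <- interlacing n L) \det (\matrix_(i < n, j < n) f i M`_j).
Proof.
move=> sL szL Ff Fn; rewrite -det_sum_columns.
rewrite (det_last_row1 (a := fun i j => F i L`_j)) //.
congr (\det _); apply/matrixP => i j; rewrite !mxE.
rewrite (telescope_int_range (F := F i)) //; last by move=> m; apply: Ff.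
by apply/ltW/sorted_int_lt; rewrite ?szL ?ltnSn //= ltnS.
Qed.

Definition vandermonde n (u : nat -> C) : C :=
  \prod_(i < n) \prod_(j < n | (i < j)%N) (u i - u j).

Lemma vandermondeS n u :
  vandermonde n.+1 u = vandermonde n u * \prod_(i < n) (u i - u n).
Proof.
rewrite /vandermonde big_ord_recr /= [X in _ * X]big1 ?mulr1; last first.
  by move=> j; rewrite ltnNge -ltnS ltn_ord.
rewrite -big_split; apply: eq_bigr => i _ /=.
by rewrite big_mkcond big_ord_recr /= ltn_ord -big_mkcond.
Qed.

(* The exponents of the monomials (with multiplicity) of the Schur function   *)
(* attached to L = lambda + delta, one for each Gelfand-Tsetlin pattern.      *)
Fixpoint gt_weights (n : nat) (L : seq int) : seq (seq int) :=
  if n is n'.+1 then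
    [seq rcons t (\sum_(l <- L) l - \sum_(m <- M) m - n'%:Z) |
      M <- interlacing n' L, t <- gt_weights n' M]
  else [:: [::]].

Definition gt_sum n (L : seq int) (u : nat -> C) : C :=
  \sum_(t <- gt_weights n L) \prod_(i < n) u i ^ t`_i.

Lemma size_gt_weights n L t : t \in gt_weights n (L : seq int) -> size t = n.
Proof.
elim: n L t => [|n IHn] L t /=; first by rewrite inE => /eqP->.
by case/allpairsPdep => M [t'] [_ /IHn <- ->]; rewrite size_rcons.
Qed.

Lemma gt_sumS n (L : seq int) u : gt_sum n.+1 L u =
  \sum_(M <- interlacing n L)
    u n ^ (\sum_(l <- L) l - \sum_(m <- M) m - n%:Z) * gt_sum n M u.
Proof.
rewrite /gt_sum /= big_allpairs_dep; apply: eq_bigr => M _.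
rewrite big_distrr /= big_seq [RHS]big_seq; apply: eq_bigr => t /size_gt_weights szt.
rewrite big_ord_recr /= nth_rcons szt ltnn eqxx mulrC; congr (_ * _).
by apply: eq_bigr => i _; rewrite nth_rcons szt ltn_ord.
Qed.

Lemma prod_exprz (z : C) n (L : seq int) : z != 0 -> size L = n ->
  \prod_(j < n) z ^ L`_j = z ^ (\sum_(l <- L) l).
Proof.
move=> z0 szL; rewrite (big_nth 0) szL big_mkord.
by rewrite (big_morph (fun m : int => z ^ m) (id1 := 1) (op1 := *%R)) //
  => m p; rewrite expfzDr.
Qed.

(** Dividing all variables by the last one makes the last row of the alternant constant, so
    [det_interlacing] lowers the size. The factors u_i/u_n - 1 which appear in the rows complete the
    Vandermonde product, and the leftover power of u_n is the last entry of the weight of the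
    pattern. *)
Lemma alternant_gt n (L : seq int) u : sorted >%R L -> size L = n ->
  (forall i, (i < n)%N -> u i != 0) ->
  \det (\matrix_(i < n, j < n) (u i ^ L`_j)) = vandermonde n u * gt_sum n L u.
Proof.
elim: n L => [|n IHn] L sL szL u0.
  by rewrite det_mx00 /vandermonde /gt_sum !big_ord0 /= big_seq1 big_ord0 mulr1.
have z0 : u n != 0 by apply: u0.
transitivity (u n ^ (\sum_(l <- L) l) *
    \det (\matrix_(i < n.+1, j < n.+1) ((u i / u n) ^ L`_j))).
  transitivity (\det (\matrix_(i < n.+1, j < n.+1)
    (1 * ((u i / u n) ^ L`_j) * u n ^ L`_j))).
    congr (\det _); apply/matrixP => i j; rewrite !mxE mul1r -exprzMl ?unitfE //.
      by rewrite divfK.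
    by rewrite mulf_neq0 ?invr_eq0 // u0.
  by rewrite det_scale big1 // mul1r prod_exprz.
rewrite (det_interlacing (F := fun i m => (u i / u n) ^ m)
  (f := fun i m => (u i / u n - 1) * (u i / u n) ^ m)) //; first last.
- by move=> m; rewrite divff // exp1rz.
- move=> i m ni; rewrite expfzDr ?expr1z ?mulf_neq0 ?invr_eq0 ?u0 //.
    by rewrite mulrC mulrBl mul1r.
  exact: ltn_trans ni _.
rewrite gt_sumS vandermondeS !big_distrr /= big_seq [RHS]big_seq.
apply: eq_bigr => M ML; have szM := size_interlacing ML.
have sM := sorted_interlacing sL szL ML.
rewrite mulrCA.
transitivity (u n ^ (\sum_(l <- L) l) * ((\prod_(i < n) (u i / u n - 1)) *
    u n ^ (- \sum_(m <- M) m) * \det (\matrix_(i < n, j < n) (u i ^ M`_j)))).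
  congr (_ * _); transitivity (\det (\matrix_(i < n, j < n)
    ((u i / u n - 1) * u i ^ M`_j * u n ^ (- M`_j)))).
    congr (\det _); apply/matrixP => i j; rewrite !mxE -mulrA; congr (_ * _).
    rewrite exprzMl ?unitfE ?invr_eq0 ?u0 //; last exact: ltn_trans (ltn_ord i) _.
    by rewrite exprz_inv.
  rewrite det_scale; congr (_ * _ * _).
  rewrite -[RHS]exprz_inv -(prod_exprz (n := n)) ?invr_eq0 //.
  by apply: eq_bigr => j _; rewrite exprz_inv.
rewrite (IHn _ sM szM) => [|i ni]; last by apply: u0; exact: ltn_trans ni _.
rewrite !mulrA; congr (_ * _); rewrite -!mulrA [RHS]mulrCA.
rewrite [X in _ * X = _]mulrCA !mulrA [_ * vandermonde _ _]mulrC -!mulrA.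
congr (_ * _).
have -> : \prod_(i < n) (u i - u n) = u n ^ n%:Z * \prod_(i < n) (u i / u n - 1).
  have -> : u n ^ n%:Z = \prod_(i < n) u n by rewrite prodr_const card_ord.
  rewrite -big_split; apply: eq_bigr => i _ /=.
  by rewrite mulrBr mulr1 mulrC divfK.
rewrite -addrA !expfzDr // -!invr_expz.
have un0 m : u n ^ m != 0 by rewrite expfz_neq0.
by field; rewrite !un0.
Qed.
End Determinants.

(** * Values of Schur functions *)

Section SchurValues.
Context {C : numFieldType}.

Lemma poly_eq0_horner (p : {poly C}) : (forall x, p.[x] = 0) -> p = 0.
Proof.
move=> p0; apply/eqP; apply: contraT => pn0.
have := @max_poly_roots _ p [seq k%:R | k <- iota 0 (size p)] pn0.
rewrite size_map size_iota ltnn; apply.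
  by apply/allP => _ /mapP[k _ ->]; apply/rootP.
by rewrite map_inj_uniq ?iota_uniq // => i j /eqP; rewrite eqr_nat => /eqP.
Qed.

Definition laurent_eval n (s : seq (C * 'rV[int]_n)) (u : 'rV[C]_n) : C :=
  \sum_(t <- s) t.1 * \prod_(i < n) u 0 i ^ t.2 0 i.

(* Restrict to the line u_i + (i + 1) t, on which all but finitely many       *)
(* points have distinct nonzero coordinates.                                  *)
Lemma laurent_eval_eq0 n (s : seq (C * 'rV[int]_n)) :
  (forall u : 'rV[C]_n, (forall i, u 0 i != 0) -> injective (u 0) ->
     laurent_eval s u = 0) ->
  forall u : 'rV[C]_n, (forall i, u 0 i != 0) -> laurent_eval s u = 0.
Proof.
move=> s0 u u0.
pose K : nat := (\sum_(t <- s) \sum_(i < n) `|t.2 0%R i|)%N.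
have K_ge t i : t \in s -> 0 <= t.2 0 i + K%:Z.
  move=> ts; suff : (`|t.2 0%R i| <= K)%N by lia.
  rewrite /K (big_rem t) //= (bigD1 i) //= -addnA; exact: leq_addr.
pose X (i : 'I_n) : {poly C} := 'X * i.+1%:R%:P + (u 0 i)%:P.
have XE t0 i : (X i).[t0] = t0 * i.+1%:R + u 0 i by rewrite !hornerE.
pose p : {poly C} := \sum_(t <- s) t.1 *: \prod_(i < n) X i ^+ absz (t.2 0 i + K%:Z).
pose q : {poly C} := (\prod_i X i) * \prod_i \prod_(j | j != i) (X i - X j).
have pE t0 (v : 'rV[C]_n) : (forall i, v 0 i = (X i).[t0]) ->
    (forall i, v 0 i != 0) ->
    p.[t0] = (\prod_i v 0 i) ^+ K * laurent_eval s v.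
  move=> vE v0; rewrite /p horner_sum /laurent_eval mulr_sumr big_seq.
  rewrite [RHS]big_seq; apply: eq_bigr => t ts; rewrite hornerZ mulrCA.
  congr (_ * _); rewrite horner_prod -prodrXl -big_split; apply: eq_bigr => i _ /=.
  rewrite horner_exp -vE exprnP; have := K_ge t i ts.
  by move=> tK; rewrite gez0_abs // expfzDr // mulrC.
have qn0 : q != 0.
  apply/mulf_neq0; apply/prodf_neq0 => i _.
    apply: contraNneq (u0 i) => Xi0.
    by have := XE 0 i; rewrite Xi0 horner0 mul0r add0r => <-.
  apply/prodf_neq0 => j ji; rewrite subr_eq0; apply: contraNneq ji => XX.
  have := XE 1 i; have := XE 0 i; rewrite XX !XE !mul0r !add0r !mul1r => ->.
  by move/addIr/eqP; rewrite eqr_nat eqSS.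
have /eqP : p * q = 0.
  apply: poly_eq0_horner => t0; rewrite hornerM.
  have [->|q0] := eqVneq q.[t0] 0; first by rewrite mulr0.
  pose v : 'rV[C]_n := \row_i (X i).[t0].
  move: q0; rewrite /q hornerM !horner_prod mulf_eq0 negb_or.
  case/andP => /prodf_neq0 v0 /prodf_neq0 vi.
  have v0' i : v 0 i != 0 by rewrite mxE v0.
  rewrite (pE t0 v) //; last by move=> i; rewrite mxE.
  rewrite s0 ?mulr0 ?mul0r // => i j; rewrite !mxE => vij; apply/eqP.
  apply: contraT => ij; have := vi i isT; rewrite horner_prod => /prodf_neq0.
  by move=> /(_ j); rewrite eq_sym ij hornerD hornerN vij subrr eqxx => /(_ isT).
rewrite mulf_eq0 (negbTE qn0) orbF => /eqP p0.
have XE0 i : u 0 i = (X i).[0] by rewrite XE mul0r add0r.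
have /esym/eqP := pE 0 u XE0 u0; rewrite p0 horner0 mulf_eq0 expf_eq0.
case/orP => [/andP[_ /prodf_eq0[i _]]|/eqP //].
by rewrite (negbTE (u0 i)).
Qed.

(** [is_schur] prescribes values only at points with distinct coordinates, whereas the theorem
    evaluates at repeated ones; the difference of two candidates is again a Laurent polynomial, so
    it vanishes there too. *)
Lemma is_schur_unique N (l : signature N) (s1 s2 : 'rV[C]_N -> C) (u : 'rV[C]_N) :
  is_schur l s1 -> is_schur l s2 -> (forall i, u 0 i != 0) -> s1 u = s2 u.
Proof.
move=> [[t1 t1E] s1E] [[t2 t2E] s2E] u0.
pose t := t1 ++ [seq (- x.1, x.2) | x <- t2].
have tE v : laurent_eval t v = s1 v - s2 v.
  rewrite /laurent_eval big_cat big_map /= t1E t2E -sumrN; congr (_ + _).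
  by apply: eq_bigr => i _; rewrite mulNr.
apply/eqP; rewrite -subr_eq0 -tE; apply/eqP; apply: laurent_eval_eq0 => // v v0 vi.
by rewrite tE s1E // s2E // subrr.
Qed.

Definition shifted_parts N (l : signature N) : seq int :=
  mkseq (fun j => nth 0 (val l) j + N%:Z - j.+1%:Z) N.

Lemma size_shifted_parts N (l : signature N) : size (shifted_parts l) = N.
Proof. exact: size_mkseq. Qed.

Lemma sorted_shifted_parts N (l : signature N) : sorted >%R (shifted_parts l).
Proof.
apply/(sortedP 0) => i; rewrite size_shifted_parts => iN.
rewrite !nth_mkseq ?(ltnW iN) //.
have /(sortedP 0) := valP l; rewrite size_tuple => /(_ i iN) /=; lia.
Qed.

Definition coords N (u : 'rV[C]_N) (i : nat) : C :=
  if insub i is Some j then u 0 j else 1.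

Lemma coordsE N (u : 'rV[C]_N) (i : 'I_N) : coords u i = u 0 i.
Proof. by rewrite /coords valK. Qed.

Lemma coords_ord N (u : 'rV[C]_N) i (iN : (i < N)%N) :
  coords u i = u 0 (Ordinal iN).
Proof. exact: (coordsE u (Ordinal iN)). Qed.

Lemma eq_gt_sum n L (u v : nat -> C) :
  (forall i, (i < n)%N -> u i = v i) -> gt_sum n L u = gt_sum n L v.
Proof.
by move=> uv; apply: eq_bigr => t _; apply: eq_bigr => i _; rewrite uv.
Qed.

Lemma vandermonde_neq0 n (u : nat -> C) :
  (forall i j, (i < n)%N -> (j < n)%N -> u i = u j -> i = j) ->
  vandermonde n u != 0.
Proof.
move=> ui; apply/prodf_neq0 => i _; apply/prodf_neq0 => j ij.
rewrite subr_eq0; apply: contraTneq ij => /ui uij.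
by rewrite (uij (ltn_ord i) (ltn_ord j)) ltnn.
Qed.

Lemma is_schur_gt N (l : signature N) :
  is_schur l (fun u : 'rV[C]_N => gt_sum N (shifted_parts l) (coords u)).
Proof.
split.
  exists [seq (1, \row_(i < N) t`_i) | t <- gt_weights N (shifted_parts l)].
  move=> u; rewrite big_map; apply: eq_bigr => t _; rewrite mul1r.
  by apply: eq_bigr => i _; rewrite coordsE mxE.
move=> u u0 ui.
have -> : \prod_(i < N) \prod_(j < N | (i < j)%N) (u 0 i - u 0 j) =
    vandermonde N (coords u).
  by apply: eq_bigr => i _; apply: eq_bigr => j _; rewrite !coordsE.
have vn0 : vandermonde N (coords u) != 0.
  apply: vandermonde_neq0 => i j iN jN.
  by rewrite (coords_ord u iN) (coords_ord u jN) => /ui[].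
apply: (canRL (mulfK vn0)); rewrite mulrC -alternant_gt.
- congr (\det _); apply/matrixP => i j; rewrite !mxE coordsE nth_mkseq //.
  by rewrite (tnth_nth 0).
- exact: sorted_shifted_parts.
- exact: size_shifted_parts.
- by move=> i iN; rewrite (coords_ord u iN).
Qed.

Lemma schurE N (l : signature N) (s : 'rV[C]_N -> C) (u : 'rV[C]_N) :
  is_schur l s -> (forall i, u 0 i != 0) -> schur l u = s u.
Proof.
move=> ls u0; apply: (is_schur_unique (l := l)) => //.
exact: (@xgetI _ (fun=> 0) [set s | is_schur l s] s ls).
Qed.

Lemma schur_gt N (l : signature N) (u : 'rV[C]_N) : (forall i, u 0 i != 0) ->
  schur l u = gt_sum N (shifted_parts l) (coords u).
Proof. by move=> u0; rewrite (schurE (is_schur_gt l)). Qed.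

Definition gbinom (l : int) (n : nat) : C :=
  (\prod_(i < n) (l%:~R - i%:R)) / n`!%:R.

Lemma gbinom0 l : gbinom l 0 = 1.
Proof. by rewrite /gbinom big_ord0 divr1. Qed.

Lemma fact_neq0 n : n`!%:R != 0 :> C.
Proof. by rewrite pnatr_eq0 -lt0n fact_gt0. Qed.

Lemma gbinom_pascal l n : gbinom (l + 1) n.+1 - gbinom l n.+1 = gbinom l n.
Proof.
rewrite /gbinom -mulrBl big_ord_recl /= big_ord_recr /=.
under eq_bigr => i _ do rewrite /bump add1n.
have -> : \prod_(i < n) ((l + 1)%:~R - i.+1%:R) =
    \prod_(i < n) (l%:~R - i%:R) :> C.
  by apply: eq_bigr => i _; rewrite -natr1 rmorphD /= opprD addrACA subrr addr0.
rewrite factS natrM invfM mulrA subr0; congr (_ / _).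
rewrite [in X in X - _]mulrC -mulrBr rmorphD /= opprB addrA addrAC.
have -> : l%:~R + 1%:~R - l%:~R + n%:R = n.+1%:R :> C.
  by rewrite -natr1; ring.
by rewrite mulfK // pnatr_eq0.
Qed.

(* The row of the alternant attached to the variable x_i for i < k, and the   *)
(* rows binomial(l, a), a = n - k - 1, ..., 0, into which the alternant       *)
(* degenerates when the other variables become 1.                             *)
Definition confluent_row (n k : nat) (x : nat -> C) (i : nat) (l : int) : C :=
  if (i < k)%N then x i ^ l else gbinom l (n - i.+1).

Definition pad1 (k : nat) (x : nat -> C) (i : nat) : C :=
  if (i < k)%N then x i else 1.

(** The branching rule is applied [d] times, which avoids differentiating the alternant as variables
    merge at 1. By Pascal's rule each binomial row is a discrete primitive of the next lower one,
    and the last is constant. A step turns the row of x_i into (x_i - 1) times itself, and the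
    variable removed equals 1, so it contributes no weight. *)
Lemma det_confluent (d k : nat) (L : seq int) (x : nat -> C) :
  sorted >%R L -> size L = (d + k)%N -> (forall i, (i < k)%N -> x i != 0) ->
  \det (\matrix_(i < d + k, j < d + k) confluent_row (d + k) k x i L`_j) =
  vandermonde k x * (\prod_(i < k) (x i - 1) ^+ d) *
  gt_sum (d + k) L (pad1 k x).
Proof.
elim: d L => [|d IHd] L sL szL x0.
  rewrite big1 ?mulr1; last by move=> i _; rewrite expr0.
  rewrite (eq_gt_sum _ (v := x)); last by move=> i; rewrite /pad1 => ->.
  rewrite -alternant_gt //; congr (\det _); apply/matrixP => i j; rewrite !mxE.
  by rewrite /confluent_row; case: ltnP => // /(leq_trans (ltn_ord i)); rewrite ltnn.
rewrite !addSn (det_interlacing (f := fun i m =>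
  (if (i < k)%N then x i - 1 else 1) * confluent_row (d + k) k x i m)) //; first last.
- move=> m; rewrite /confluent_row ltnNge leq_addl /= subnn gbinom0 //.
- move=> i m idk; rewrite /confluent_row; case: ifP => ik.
    by rewrite expfzDr ?x0 // expr1z mulrBl mul1r mulrC.
  by rewrite mul1r subSS -(subnSK idk) gbinom_pascal.
rewrite gt_sumS !big_distrr /= big_seq [RHS]big_seq; apply: eq_bigr => M ML.
rewrite {1}/pad1 ltnNge leq_addl /= exp1rz mul1r.
transitivity (\det (\matrix_(i < d + k, j < d + k)
    ((if (i < k)%N then x i - 1 else 1) * confluent_row (d + k) k x i M`_j * 1))).
  by congr (\det _); apply/matrixP => i j; rewrite !mxE mulr1.
rewrite det_scale [X in _ * X * _]big1 // mulr1 IHd ?(size_interlacing ML) //; last first.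
  by apply: sorted_interlacing ML.
rewrite mulrA; congr (_ * _); rewrite mulrCA; congr (_ * _).
have -> : \prod_(i < d + k) (if (i < k)%N then x i - 1 else 1) =
    \prod_(i < k) (x i - 1).
  rewrite -(big_mkord xpredT (fun i => if (i < k)%N then x i - 1 else 1)).
  rewrite (big_cat_nat (n := k)) ?leq_addl //= [X in _ * X]big_nat_cond.
  rewrite [X in _ * X]big1 ?mulr1 => [|i /andP[/andP[ki _] _]]; last by rewrite ltnNge ki.
  by rewrite big_mkord; apply: eq_bigr => i _; rewrite ltn_ord.
by rewrite -big_split; apply: eq_bigr => i _; rewrite /= exprS.
Qed.

End SchurValues.

(** * Divided differences at the shifted parts *)

Section DividedDifferences.
Context {C : numFieldType}.

Definition node (L : seq int) (j : nat) : C := (L`_j)%:~R.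

Definition node_prod n (L : seq int) (j : nat) : C :=
  \prod_(i < n | (i : nat) != j) (node L j - node L i).

Definition divdiff n (L : seq int) (f : int -> C) : C :=
  \sum_(j < n) f L`_j / node_prod n L j.

Variables (n : nat) (L : seq int).
Hypotheses (sL : sorted >%R L) (szL : size L = n).

Lemma node_inj i j : (i < n)%N -> (j < n)%N -> node L i = node L j -> i = j.
Proof.
move=> i_n j_n /intr_inj Lij; apply/eqP.
have [ij|ji|//] := ltngtP i j.
  by have := sorted_int_lt sL (i := i) (j := j); rewrite ij szL j_n Lij ltxx => /(_ isT).
by have := sorted_int_lt sL (i := j) (j := i); rewrite ji szL i_n Lij ltxx => /(_ isT).
Qed.

Lemma node_prod_neq0 j : (j < n)%N -> node_prod n L j != 0.
Proof.
move=> j_n; apply/prodf_neq0 => i ij; rewrite subr_eq0; apply: contraNneq ij.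
by move/node_inj => ->.
Qed.

Definition node_poly (j : nat) : {poly C} :=
  \prod_(i < n | (i : nat) != j) ('X - (node L i)%:P).

Lemma node_poly_monic j : node_poly j \is monic.
Proof. exact: monic_prod_XsubC. Qed.

Lemma size_node_poly j : (j < n)%N -> size (node_poly j) = n.
Proof.
move=> j_n; rewrite /node_poly -big_filter size_prod_XsubC size_filter.
rewrite -sum1_count (eq_bigl (mem (predC1 (Ordinal j_n)))) //.
by rewrite sum1_card cardC1 card_ord prednK // (leq_ltn_trans _ j_n).
Qed.

Lemma node_polyE j x : (node_poly j).[x] = \prod_(i < n | (i : nat) != j) (x - node L i).
Proof. by rewrite horner_prod; apply: eq_bigr => i _; rewrite !hornerE. Qed.

Lemma lagrange_interpolation (p : {poly C}) : (size p <= n)%N ->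
  p = \sum_(j < n) (p.[node L j] / node_prod n L j) *: node_poly j.
Proof.
move=> szp; apply/eqP; rewrite -subr_eq0; set q := p - _.
have szq : (size q <= n)%N.
  apply: leq_trans (size_polyD _ _) _; rewrite geq_max szp size_polyN.
  apply: leq_trans (size_sum _ _ _) _; apply/bigmax_leqP => j _.
  by apply: leq_trans (size_scale_leq _ _) _; rewrite size_node_poly.
apply: contraT => q0.
have := @max_poly_roots _ q [seq node L j | j <- iota 0 n] q0.
rewrite size_map size_iota ltnNge szq; apply.
  apply/allP => y /mapP[j]; rewrite mem_iota => /= j_n ->; apply/rootP.
  rewrite /q hornerD hornerN horner_sum (bigD1 (Ordinal j_n)) //= big1 ?addr0.
    by rewrite hornerZ node_polyE divfK ?node_prod_neq0 // subrr.
  move=> i ij; rewrite hornerZ node_polyE (bigD1 (Ordinal j_n)) //=.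
    by rewrite subrr mul0r mulr0.
  by rewrite eq_sym.
rewrite map_inj_in_uniq ?iota_uniq // => i j; rewrite !mem_iota /=.
exact: node_inj.
Qed.

(** The Lagrange basis polynomials [node_poly] are monic of degree n - 1, so the divided difference
    reads off the top coefficient of the interpolation formula. *)
Lemma divdiff_poly (p : {poly C}) : (size p <= n)%N ->
  divdiff n L (fun m => p.[m%:~R]) = p`_n.-1.
Proof.
move=> szp; rewrite [in RHS](lagrange_interpolation szp) coef_sum.
apply: eq_bigr => j _; rewrite coefZ -[LHS]mulr1; congr (_ * _).
by have /monicP := node_poly_monic j; rewrite lead_coefE size_node_poly.
Qed.

Definition gbinom_poly a : {poly C} :=
  (a`!%:R)^-1 *: \prod_(i < a) ('X - i%:R%:P).

Lemma gbinom_polyE a m : (gbinom_poly a).[m%:~R] = gbinom m a.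
Proof.
rewrite hornerZ horner_prod /gbinom mulrC; congr (_ * _).
by apply: eq_bigr => i _; rewrite !hornerE.
Qed.

Lemma size_gbinom_poly a : size (gbinom_poly a) = a.+1.
Proof.
by rewrite size_scale ?invr_eq0 ?fact_neq0 // size_prod_XsubC /index_enum -enumT size_enum_ord.
Qed.

Lemma lead_gbinom_poly a : lead_coef (gbinom_poly a) = (a`!%:R)^-1.
Proof. by rewrite lead_coefZ (monicP (monic_prod_XsubC _ _ _)) mulr1. Qed.

(** Below degree n - 1 the divided difference vanishes. This is what makes the matrix in
    [det_confluent_weight] block triangular and the coefficients of (x - 1)^j with j < N - 1
    disappear in [schur_taylor_sum]. *)
Lemma divdiff_pow_gbinom a b : (a + b < n)%N ->
  divdiff n L (fun m => m%:~R ^+ b * gbinom m a) =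
  if (a + b).+1 == n then (a`!%:R)^-1 else 0.
Proof.
move=> abn; pose p := 'X^b * gbinom_poly a.
have szp : size p = (a + b).+1.
  rewrite size_monicM ?monicXn ?size_polyXn ?size_gbinom_poly //=; first by lia.
  by rewrite -size_poly_eq0 size_gbinom_poly.
have -> : divdiff n L (fun m => m%:~R ^+ b * gbinom m a) =
    divdiff n L (fun m => p.[m%:~R]).
  by apply: eq_bigr => j _; rewrite hornerM hornerXn gbinom_polyE.
rewrite divdiff_poly ?szp //; case: eqP => [abE|/eqP abE].
  rewrite -abE -lead_gbinom_poly -[RHS]mul1r -(lead_coefXn _ b) -lead_coefM.
  by rewrite lead_coefE szp.
by rewrite nth_default // szp; lia.
Qed.

Definition weight_mx : 'M[C]_n :=
  \matrix_(j < n, b < n) (node L j ^+ b / node_prod n L j).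

Lemma det_weight_mx_neq0 : \det weight_mx != 0.
Proof.
have -> : \det weight_mx =
    \det (\matrix_(j < n, b < n) ((node_prod n L j)^-1 * node L j ^+ b * 1)).
  by congr (\det _); apply/matrixP => j b; rewrite !mxE mulr1 mulrC.
rewrite det_scale !mulf_neq0 //.
- by apply/prodf_neq0 => j _; rewrite invr_eq0 node_prod_neq0.
- by rewrite big1 // oner_eq0.
rewrite -det_tr.
have -> : (\matrix_(j < n, b < n) node L j ^+ b)^T =
    Vandermonde n (\row_(j < n) node L j).
  by apply/matrixP => i j; rewrite !mxE.
rewrite det_Vandermonde; apply/prodf_neq0 => i _; apply/prodf_neq0 => j ij.
rewrite !mxE subr_eq0; apply: contraTneq ij => /node_inj ->//.
by rewrite ltnn.
Qed.

End DividedDifferences.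

(** * The determinantal formula for the normalized Schur function *)

Section Reduction.
Context {C : numFieldType}.

(** Multiplication by [weight_mx] replaces the entries of column b by divided differences of m^b
    times the row function. For the binomial rows degree counting gives zeros in the lower left
    block and an upper triangular lower right block with inverse factorials on its diagonal; the
    upper left block is the k by k determinant sought. *)
Lemma det_confluent_weight (d k : nat) (L : seq int) (x : nat -> C) :
  sorted >%R L -> size L = (k + d)%N ->
  \det (\matrix_(i < k + d, j < k + d) confluent_row (k + d) k x i L`_j) *
    \det (weight_mx (k + d) L) =
  \det (\matrix_(i < k, b < k)
          divdiff (k + d) L (fun m => m%:~R ^+ b * x i ^ m)) *
  \prod_(i < d) (i`!%:R)^-1.
Proof.
move=> sL szL; rewrite -det_mulmx; set A := _ *m _.
have AE (i b : 'I_(k + d)) :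
    A i b = divdiff (k + d) L (fun m => m%:~R ^+ b * confluent_row (k + d) k x i m).
  rewrite mxE; apply: eq_bigr => j _; rewrite !mxE mulrA; congr (_ / _).
  by rewrite mulrC.
clearbody A; rewrite -[A]submxK.
have -> : dlsubmx A = 0.
  apply/matrixP => i b; rewrite !mxE AE /confluent_row /= ltnNge leq_addr /=.
  have := ltn_ord i; have := ltn_ord b; move=> bk id0.
  by rewrite divdiff_pow_gbinom //; [case: eqP => //; lia | lia].
rewrite det_ublock; congr (_ * _).
  congr (\det _); apply/matrixP => i b; rewrite !mxE AE /=.
  by apply: eq_bigr => j _; rewrite /confluent_row /= ltn_ord.
rewrite -det_tr det_trig; last first.
  apply/is_trig_mxP => i b ib; rewrite !mxE AE /confluent_row /=.
  rewrite ltnNge leq_addr /=; have := ltn_ord i; have := ltn_ord b; move=> bk id0.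
  by rewrite divdiff_pow_gbinom //; [case: eqP => //; lia | lia].
rewrite (reindex_inj rev_ord_inj); apply: eq_bigr => i _.
rewrite !mxE AE /confluent_row /= ltnNge leq_addr /= divdiff_pow_gbinom //.
  case: eqP => [_|]; first by congr ((_ `!%:R)^-1); have := ltn_ord i; lia.
  by have := ltn_ord i; lia.
by have := ltn_ord i; lia.
Qed.

Definition normalized_gt n L (u : nat -> C) : C :=
  gt_sum n L u / gt_sum n L (fun=> 1).

Lemma gt_sum_pad1 (d k : nat) (L : seq int) (x : nat -> C) :
  sorted >%R L -> size L = (k + d)%N -> (forall i, (i < k)%N -> x i != 0) ->
  gt_sum (k + d) L (pad1 k x) * (vandermonde k x * \prod_(i < k) (x i - 1) ^+ d) *
    \det (weight_mx (k + d) L) =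
  \det (\matrix_(i < k, b < k)
          divdiff (k + d) L (fun m => m%:~R ^+ b * x i ^ m)) *
  \prod_(i < d) (i`!%:R)^-1.
Proof.
move=> sL szL x0; rewrite -det_confluent_weight //; congr (_ * _).
rewrite mulrC; have := @det_confluent C d k L x sL.
by rewrite (addnC d k) => <-.
Qed.

Lemma gt_sum1_weight n L : sorted >%R L -> size L = n ->
  gt_sum n L (fun=> 1) * \det (weight_mx n L) = \prod_(i < n) (i`!%:R)^-1 :> C.
Proof.
move=> sL szL; have := @gt_sum_pad1 n 0 L (fun=> 1) sL szL.
rewrite /vandermonde !big_ord0 !mulr1 det_mx00 mul1r add0n => <- //.
Qed.

Lemma gt_sum1_neq0 n L : sorted >%R L -> size L = n ->
  gt_sum n L (fun=> 1) != 0 :> C.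
Proof.
move=> sL szL; have := gt_sum1_weight sL szL.
have : \prod_(i < n) (i`!%:R)^-1 != 0 :> C.
  by apply/prodf_neq0 => i _; rewrite invr_eq0 fact_neq0.
by move=> /[swap] <-; rewrite mulf_eq0 negb_or => /andP[].
Qed.

(** The quotient of [gt_sum_pad1] by its case of no free variables ([gt_sum1_weight]), in which the
    determinant of [weight_mx] cancels. As m^b x^m is (x d/dx)^b x^m, the right side involves only
    one-variable functions and their derivatives. *)
Lemma normalized_gt_det (d k : nat) (L : seq int) (x : nat -> C) :
  sorted >%R L -> size L = (k + d)%N -> (forall i, (i < k)%N -> x i != 0) ->
  normalized_gt (k + d) L (pad1 k x) *
    (vandermonde k x * \prod_(i < k) (x i - 1) ^+ d) =
  \det (\matrix_(i < k, b < k)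
          divdiff (k + d) L (fun m => m%:~R ^+ b * x i ^ m)) *
  \prod_(i < k) ((d + i)%N`!%:R).
Proof.
move=> sL szL x0; rewrite /normalized_gt.
have g0 := gt_sum1_neq0 sL szL.
have w0 := @det_weight_mx_neq0 C _ _ sL szL.
have := gt_sum_pad1 sL szL x0; have := gt_sum1_weight sL szL.
rewrite (addnC k d) big_split_ord /=; set P := \prod_(i < d) _; set Q := \prod_(i < k) _.
rewrite -(addnC k d); set W := \det (weight_mx _ _); set D := \det _.
have -> : \prod_(i < k) (d + i)`!%:R = Q^-1 :> C.
  by rewrite /Q -prodfV; apply: eq_bigr => i _; rewrite invrK.
have P0 : P != 0 by apply/prodf_neq0 => i _; rewrite invr_eq0 fact_neq0.
have Q0 : Q != 0 by apply/prodf_neq0 => i _; rewrite invr_eq0 fact_neq0.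
move=> E1 E2; apply: (mulIf w0); rewrite -/W.
have -> : D = gt_sum (k + d) L (pad1 k x) *
    (vandermonde k x * \prod_(i < k) (x i - 1) ^+ d) * W / P by rewrite E2 mulfK.
have -> : W = P * Q / gt_sum (k + d) L (fun=> 1) by rewrite -E1 mulrAC divff ?mul1r.
by field; rewrite g0 Q0 P0.
Qed.

End Reduction.

(** * Real-valued moduli and convergence in the complex numbers *)

Section Modulus.
Context {R : realType}.
Implicit Types (z w : Cplx R) (r : R).

(** The norm on [Cplx R] takes values in [Cplx R], whose order is only partial; with a real-valued
    copy all estimates are real inequalities. *)
Definition modulus z : R := complex.Re `|z|.

HB.instance Definition _ := GRing.RMorphism.copy (@of_real R)
  (real_complex R : R -> Cplx R).

Lemma of_real_inj : injective (@of_real R).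
Proof. by move=> x y []. Qed.

Lemma of_real_eq0 r : (of_real r == 0) = (r == 0).
Proof. by rewrite -(inj_eq of_real_inj) rmorph0. Qed.

Lemma of_realV r : of_real r^-1 = (of_real r)^-1.
Proof. exact: (fmorphV (@of_real R)). Qed.

Lemma of_real_le (a b : R) : (of_real a <= of_real b) = (a <= b).
Proof. exact: lecR. Qed.

Lemma of_real_lt (a b : R) : (of_real a < of_real b) = (a < b).
Proof. exact: ltcR. Qed.

Lemma of_real_modulus z : of_real (modulus z) = `|z|.
Proof. by rewrite /modulus normc_def. Qed.

Lemma modulus_ge0 z : 0 <= modulus z.
Proof. by rewrite -of_real_le of_real_modulus rmorph0. Qed.

Lemma modulusD z w : modulus (z + w) <= modulus z + modulus w.
Proof. by rewrite -of_real_le rmorphD /= !of_real_modulus ler_normD. Qed.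

Lemma modulusM z w : modulus (z * w) = modulus z * modulus w.
Proof. by apply: of_real_inj; rewrite rmorphM /= !of_real_modulus normrM. Qed.

Lemma modulusV z : modulus z^-1 = (modulus z)^-1.
Proof. by apply: of_real_inj; rewrite of_realV !of_real_modulus normfV. Qed.

Lemma modulusN z : modulus (- z) = modulus z.
Proof. by apply: of_real_inj; rewrite !of_real_modulus normrN. Qed.

Lemma modulus_of_real r : modulus (of_real r) = `|r|.
Proof. by rewrite /modulus normc_def /= expr0n /= addr0 sqrtr_sqr. Qed.

Lemma modulus_of_real_ge0 r : 0 <= r -> modulus (of_real r) = r.
Proof. by move=> r0; rewrite modulus_of_real ger0_norm. Qed.

Lemma modulus0 : modulus 0 = 0.
Proof. by rewrite -(rmorph0 (@of_real R)) modulus_of_real normr0. Qed.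

Lemma modulus1 : modulus 1 = 1.
Proof. by rewrite -(rmorph1 (@of_real R)) modulus_of_real normr1. Qed.

Lemma modulus_nat n : modulus n%:R = n%:R.
Proof. by rewrite -(rmorph_nat (@of_real R)) modulus_of_real normr_nat. Qed.

Lemma modulus_int (m : int) : modulus m%:~R = `|m|%:R.
Proof.
by rewrite -(rmorph_int (@of_real R)) modulus_of_real natr_absz intr_norm.
Qed.

Lemma modulus_eq0 z : (modulus z == 0) = (z == 0).
Proof. by rewrite -of_real_eq0 of_real_modulus normr_eq0. Qed.

Lemma modulus_gt0 z : (0 < modulus z) = (z != 0).
Proof. by rewrite lt_neqAle modulus_ge0 andbT eq_sym modulus_eq0. Qed.

Lemma modulusX z n : modulus (z ^+ n) = modulus z ^+ n.
Proof. by elim: n => [|n IHn]; rewrite ?expr0 ?modulus1 // !exprS modulusM IHn. Qed.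

Lemma modulusXz z (m : int) : modulus (z ^ m) = modulus z ^ m.
Proof. by case: m => n; rewrite ?NegzE -?exprnN ?modulusV -?exprnP modulusX. Qed.

Lemma modulusB z w : modulus (z - w) = modulus (w - z).
Proof. by rewrite -opprB modulusN. Qed.

Lemma modulus_sub_le z w : modulus (z - w) <= modulus z + modulus w.
Proof. by rewrite -(modulusN w) modulusD. Qed.

Lemma modulus_dist_le z w : modulus z - modulus w <= modulus (z - w).
Proof. by rewrite lerBlDr -{1}(subrK w z) modulusD. Qed.

Lemma modulus_sum (I : Type) (s : seq I) (P : pred I) (F : I -> Cplx R) :
  modulus (\sum_(i <- s | P i) F i) <= \sum_(i <- s | P i) modulus (F i).
Proof.
apply: (big_ind2 (fun (z : Cplx R) r => modulus z <= r)) => //.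
  by rewrite modulus0.
by move=> z a w b za wb; apply: le_trans (modulusD _ _) _; apply: lerD.
Qed.

Lemma modulus_prod (I : Type) (s : seq I) (P : pred I) (F : I -> Cplx R) :
  modulus (\prod_(i <- s | P i) F i) = \prod_(i <- s | P i) modulus (F i).
Proof. by apply: (big_morph modulus modulusM modulus1). Qed.

Lemma normRe_le_modulus z : `|complex.Re z| <= modulus z.
Proof.
by have := normc_ge_Re z; rewrite -[`|z|]/(`|(z : Cplx R)|) -of_real_modulus lecR.
Qed.

Lemma normIm_le_modulus z : `|complex.Im z| <= modulus z.
Proof.
rewrite /modulus normc_def /= -[leLHS]ger0_norm // -sqrtr_sqr.
by rewrite ler_wsqrtr // real_normK ?num_real // lerDr sqr_ge0.
Qed.

Lemma modulus_le_ReIm z : modulus z <= `|complex.Re z| + `|complex.Im z|.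
Proof.
rewrite /modulus normc_def /= -[leRHS]ger0_norm ?addr_ge0 // -sqrtr_sqr.
rewrite ler_wsqrtr // sqrrD !real_normK ?num_real // lerD2r lerDl.
by rewrite mulrn_wge0 // mulr_ge0.
Qed.

(** A positive element of [Cplx R] is real, so real tolerances are enough. *)
Lemma cvg_CplxP (u : nat -> Cplx R) (l : Cplx R) :
  (u @ \oo --> l) <->
  forall e : R, 0 < e -> exists N0, forall N, (N0 <= N)%N -> modulus (u N - l) <= e.
Proof.
split=> [ul e e0|ul].
  have e0' : (0 : Cplx R) < of_real e by rewrite -(rmorph0 (@of_real R)) of_real_lt.
  have /cvgrPdist_le/(_ _ e0')[N0 _ h] := ul.
  exists N0 => N N0N; have := h N N0N.
  by rewrite /= -of_real_modulus of_real_le modulusB.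
apply/cvgrPdist_le => e e0.
have eE : e = of_real (complex.Re e).
  by case: e e0 => a b; rewrite ltcE /= => /andP[/eqP -> _].
have e0' : 0 < complex.Re e by rewrite -of_real_lt -eE rmorph0.
have [N0 h] := ul _ e0'.
exists N0 => // N /= N0N; rewrite -of_real_modulus eE of_real_le modulusB.
exact: h.
Qed.

Lemma cvg_realP (u : nat -> R) (l : R) :
  (u @ \oo --> l) <->
  forall e : R, 0 < e -> exists N0, forall N, (N0 <= N)%N -> `|u N - l| <= e.
Proof.
split=> [ul e e0|ul].
  have /cvgrPdist_le/(_ _ e0)[N0 _ h] := ul.
  by exists N0 => N N0N; have := h N N0N; rewrite /= distrC.
apply/cvgrPdist_le => e e0; have [N0 h] := ul _ e0.
by exists N0 => // N /= N0N; rewrite distrC; apply: h.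
Qed.

Lemma cvg_of_real (u : nat -> R) (l : R) :
  u @ \oo --> l -> (fun N => of_real (u N)) @ \oo --> of_real l.
Proof.
move/cvg_realP => ul; apply/cvg_CplxP => e e0; have [N0 h] := ul _ e0.
exists N0 => N N0N; rewrite -rmorphB /= modulus_of_real; exact: h.
Qed.

End Modulus.

(** * Reduction of several variables to one *)

Section LaurentLists.
Context {R : realType}.
Local Notation C := (Cplx R).
Implicit Types (s : seq (C * int)) (x c : C).

Definition leval s x : C := \sum_(t <- s) t.1 * x ^ t.2.
(* The derivation x d/dx. *)
Definition lderiv s := [seq (t.1 * t.2%:~R, t.2) | t <- s].
Definition lscale c s := [seq (c * t.1, t.2) | t <- s].
Definition lshift (m : int) s := [seq (t.1, t.2 + m) | t <- s].
Definition lmul s s' := [seq (t.1 * t'.1, t.2 + t'.2) | t <- s, t' <- s'].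

Lemma leval_cat s s' x : leval (s ++ s') x = leval s x + leval s' x.
Proof. exact: big_cat. Qed.

Lemma leval_scale c s x : leval (lscale c s) x = c * leval s x.
Proof.
by rewrite /leval big_map mulr_sumr; apply: eq_bigr => t _; rewrite mulrA.
Qed.

Lemma leval_shift m s x : x != 0 -> leval (lshift m s) x = x ^ m * leval s x.
Proof.
move=> x0; rewrite /leval big_map mulr_sumr; apply: eq_bigr => t _.
by rewrite /= expfzDr //; ring.
Qed.

Lemma leval_mul s s' x : x != 0 -> leval (lmul s s') x = leval s x * leval s' x.
Proof.
move=> x0; rewrite /leval big_allpairs_dep mulr_suml; apply: eq_bigr => t _.
rewrite mulr_sumr; apply: eq_bigr => t' _ /=.
by rewrite expfzDr // mulrACA.
Qed.

Lemma lderiv_cat s s' : lderiv (s ++ s') = lderiv s ++ lderiv s'.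
Proof. exact: map_cat. Qed.

Lemma leval_lderiv_scale c s x :
  leval (lderiv (lscale c s)) x = c * leval (lderiv s) x.
Proof.
rewrite /leval /lderiv /lscale !big_map mulr_sumr.
by apply: eq_bigr => t _ /=; rewrite !mulrA.
Qed.

Lemma leval_lderiv_shift m s x : x != 0 ->
  leval (lderiv (lshift m s)) x =
  x ^ m * (m%:~R * leval s x + leval (lderiv s) x).
Proof.
move=> x0; rewrite /leval /lderiv /lshift !big_map /=.
rewrite [m%:~R * _]mulr_sumr -big_split mulr_sumr.
apply: eq_bigr => t _ /=; rewrite rmorphD /= expfzDr //; ring.
Qed.

Lemma leval_lderiv_mul s s' x : x != 0 -> leval (lderiv (lmul s s')) x =
  leval (lderiv s) x * leval s' x + leval s x * leval (lderiv s') x.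
Proof.
move=> x0; rewrite /leval big_map big_allpairs_dep !big_map !mulr_suml -big_split.
apply: eq_bigr => t _ /=; rewrite !mulr_sumr -big_split; apply: eq_bigr => t' _ /=.
by rewrite rmorphD /= expfzDr //; ring.
Qed.

(** A function may be represented by several lists, so the derivative has to be shown to depend on
    the function alone. A large power of x clears negative exponents; the resulting polynomial
    vanishes, hence so does its formal derivative. *)
Lemma leval_lderiv_eq0 s : (forall x, x != 0 -> leval s x = 0) ->
  forall x, x != 0 -> leval (lderiv s) x = 0.
Proof.
move=> s0 x x0; pose K : nat := (\sum_(t <- s) `|t.2|)%N.
have K_ge t : t \in s -> 0 <= t.2 + K%:Z.
  move=> ts; suff : (`|t.2| <= K)%N by lia.
  rewrite /K (big_rem t) //=; exact: leq_addr.
pose p : {poly C} := \sum_(t <- s) t.1 *: 'X^(absz (t.2 + K%:Z)).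
have pE y : y != 0 -> p.[y] = y ^+ K * leval s y.
  move=> y0; rewrite /p horner_sum /leval mulr_sumr big_seq [RHS]big_seq.
  apply: eq_bigr => t ts; rewrite hornerZ hornerXn mulrCA exprnP.
  by rewrite gez0_abs ?K_ge // expfzDr // [y ^ _ * _]mulrC.
have /eqP : p * 'X = 0.
  apply: poly_eq0_horner => y; rewrite hornerM hornerX.
  by have [->|y0] := eqVneq y 0; rewrite ?mulr0 // pE // s0 // mulr0 mul0r.
rewrite mulf_eq0 polyX_eq0 orbF => /eqP p0.
have : x * p^`().[x] = x ^+ K * (leval (lderiv s) x + K%:R * leval s x).
  rewrite /p raddf_sum horner_sum /leval big_map.
  rewrite [K%:R * _]mulr_sumr -big_split !mulr_sumr big_seq [RHS]big_seq.
  apply: eq_bigr => t ts /=; rewrite linearZ /= derivXn hornerZ hornerMn hornerXn.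
  have tK := K_ge t ts; set n := absz _.
  have nE : n%:R = t.2%:~R + K%:R :> C by rewrite -[LHS]/(n%:Z%:~R) gez0_abs // rmorphD.
  have xnE : x ^+ n = x ^+ K * x ^ t.2 by rewrite exprnP gez0_abs // expfzDr // mulrC.
  transitivity (t.1 * (n%:R * x ^+ n)); last by rewrite nE xnE; ring.
  rewrite mulrCA -[_ *+ n]mulr_natl; congr (_ * _).
  by case: (n) => [|m]; rewrite ?mul0r ?mulr0 // exprS mulrCA.
rewrite p0 deriv0 horner0 mulr0 s0 // mulr0 addr0 => /esym/eqP.
by rewrite mulf_eq0 expf_eq0 (negbTE x0) andbF => /eqP.
Qed.

Lemma lderiv_unique s s' : (forall x, x != 0 -> leval s x = leval s' x) ->
  forall x, x != 0 -> leval (lderiv s) x = leval (lderiv s') x.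
Proof.
move=> ss' x x0; apply/eqP; rewrite -subr_eq0; apply/eqP.
have := @leval_lderiv_eq0 (s ++ lscale (-1) s') _ x x0.
rewrite lderiv_cat leval_cat leval_lderiv_scale mulN1r; apply=> y y0.
by rewrite leval_cat leval_scale ss' // mulN1r subrr.
Qed.

Fixpoint lpow_sub1 n : seq (C * int) :=
  if n is n'.+1 then lmul [:: (1, 1); (-1, 0)] (lpow_sub1 n') else [:: (1, 0)].

Lemma leval_pow_sub1 n x : x != 0 -> leval (lpow_sub1 n) x = (x - 1) ^+ n.
Proof.
move=> x0; elim: n => [|n IHn]; first by rewrite /leval big_seq1 /= mulr1.
rewrite leval_mul // IHn exprS; congr (_ * _).
by rewrite /leval big_cons big_seq1 /= expr1z expr0z mul1r mulr1.
Qed.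

Lemma leval_lderiv_pow_sub1 n x : x != 0 ->
  leval (lderiv (lpow_sub1 n.+1)) x = n.+1%:R * x * (x - 1) ^+ n.
Proof.
move=> x0; elim: n => [|n IHn].
  rewrite /leval /= !big_cons big_nil /= !addr0 expr1z expr0z; ring.
rewrite -[lpow_sub1 n.+2]/(lmul [:: (1, 1); (-1, 0)] (lpow_sub1 n.+1)).
rewrite leval_lderiv_mul // IHn leval_pow_sub1 //.
rewrite /leval /= !big_cons big_nil /= !addr0 expr1z expr0z -natr1 exprS; ring.
Qed.

Lemma lderiv_factor m c p q :
  (forall x, x != 0 -> leval p x * c = (x - 1) ^+ m.+1 * leval q x) ->
  forall x, x != 0 -> leval (lderiv p) x * c =
    (x - 1) ^+ m * (m.+1%:R * x * leval q x + (x - 1) * leval (lderiv q) x).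
Proof.
move=> pq x x0.
have := @lderiv_unique (lscale c p) (lmul (lpow_sub1 m.+1) q) _ x x0.
rewrite leval_lderiv_scale leval_lderiv_mul // leval_lderiv_pow_sub1 //.
rewrite leval_pow_sub1 // mulrC => ->; first by rewrite exprS; ring.
by move=> y y0; rewrite leval_scale leval_mul // leval_pow_sub1 // mulrC pq.
Qed.

Variable rho : R.
Hypothesis rho_ge1 : 1 <= rho.

(** The factor rho^|m| dominates x^m on the annulus rho^-1 <= |x| <= rho, and raising [j] by one
    pays for one application of [lderiv]. Requiring a bound for every [j], as [lbounded] does, makes
    the class stable under differentiation. *)
Definition lnorm (j : nat) s : R :=
  \sum_(t <- s) modulus t.1 * ((1 + `|t.2|%:R) ^+ j * rho ^+ `|t.2|).

Definition lbounded N0 (f : nat -> seq (C * int)) :=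
  forall j, exists M, forall N, (N0 <= N)%N -> lnorm j (f N) <= M.

Lemma lnorm_ge0 j s : 0 <= lnorm j s.
Proof.
apply: sumr_ge0 => t _; rewrite mulr_ge0 ?modulus_ge0 // mulr_ge0 ?exprn_ge0 //.
exact: le_trans rho_ge1.
Qed.

Lemma lbounded_cat N0 (f g : nat -> seq (C * int)) : lbounded N0 f -> lbounded N0 g ->
  lbounded N0 (fun N => f N ++ g N).
Proof.
move=> b1 b2 j; have [M1 h1] := b1 j; have [M2 h2] := b2 j.
exists (M1 + M2) => N N0N; rewrite /lnorm big_cat /=.
by apply: lerD; [apply: h1 | apply: h2].
Qed.

Lemma lbounded_scale N0 (c : nat -> C) K (f : nat -> seq (C * int)) : lbounded N0 f ->
  (forall N, (N0 <= N)%N -> modulus (c N) <= K) ->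
  lbounded N0 (fun N => lscale (c N) (f N)).
Proof.
move=> b cK j; have [M h] := b j; exists (K * M) => N N0N.
have -> : lnorm j (lscale (c N) (f N)) = modulus (c N) * lnorm j (f N).
  rewrite /lnorm big_map mulr_sumr; apply: eq_bigr => t _ /=.
  by rewrite modulusM -mulrA.
by apply: ler_pM; rewrite ?modulus_ge0 ?lnorm_ge0 ?cK ?h.
Qed.

Lemma lbounded_deriv N0 (f : nat -> seq (C * int)) : lbounded N0 f ->
  lbounded N0 (fun N => lderiv (f N)).
Proof.
move=> b j; have [M h] := b j.+1; exists M => N N0N; apply: le_trans (h N N0N).
rewrite /lnorm big_map; apply: ler_sum => t _ /=.
rewrite modulusM modulus_int -!mulrA ler_wpM2l ?modulus_ge0 //.
rewrite exprS -!mulrA ler_wpM2r ?lerDr //.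
by rewrite mulr_ge0 ?exprn_ge0 ?addr_ge0 // (le_trans _ rho_ge1).
Qed.

Lemma lbounded_shift1 N0 (f : nat -> seq (C * int)) : lbounded N0 f ->
  lbounded N0 (fun N => lshift 1 (f N)).
Proof.
move=> b j; have [M h] := b j; exists (2 ^+ j * rho * M) => N N0N.
apply: (@le_trans _ _ (2 ^+ j * rho * lnorm j (f N))); last first.
  by rewrite ler_wpM2l ?h // mulr_ge0 ?exprn_ge0 ?(le_trans _ rho_ge1).
rewrite /lnorm big_map mulr_sumr; apply: ler_sum => t _ /=.
rewrite [leRHS]mulrCA ler_wpM2l ?modulus_ge0 // mulrACA -exprMn -exprS.
have le1 : (`|(t.2 + 1)%R| <= `|t.2|.+1)%N by lia.
have rho0 : 0 <= rho by apply: le_trans rho_ge1.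
apply: ler_pM; rewrite ?exprn_ge0 ?addr_ge0 //.
  rewrite lerXn2r ?nnegrE ?addr_ge0 ?mulr_ge0 //.
  rewrite mulrDr mulr1 [2 * _]mulr_natl mulr2n.
  have : `|t.2 + 1|%:R <= `|t.2|%:R + 1 :> R by rewrite natr1 ler_nat.
  by have : 0 <= `|t.2|%:R :> R by []; lra.
exact: ler_weXn2l.
Qed.

Lemma lbounded_shift N0 (f : nat -> seq (C * int)) m : lbounded N0 f ->
  lbounded N0 (fun N => lshift (m%:Z) (f N)).
Proof.
move=> b; elim: m => [|m IHm].
  move=> j; have [M h] := b j; exists M => N /h; rewrite /lshift /lnorm big_map.
  by under [X in X <= _ -> _]eq_bigr => t _ do rewrite -[t.2]addr0.
have := lbounded_shift1 IHm => {}IHm j; have [M h] := IHm j.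
exists M => N /h; rewrite /lshift /lnorm !big_map.
by under eq_bigr => t _ do rewrite /= -addrA -[m%:Z + 1]/(m + 1)%:Z addn1.
Qed.

Lemma leval_le_lnorm s x : rho^-1 <= modulus x <= rho ->
  modulus (leval s x) <= lnorm 0 s.
Proof.
move=> /andP[xl xu]; have rho0 : 0 < rho by apply: lt_le_trans rho_ge1.
apply: le_trans (modulus_sum _ _ _) _; apply: ler_sum => t _.
rewrite modulusM expr0 mul1r ler_wpM2l ?modulus_ge0 // modulusXz.
have x0 : 0 < modulus x by apply: lt_le_trans xl; rewrite invr_gt0.
case: t.2 => m /=; first by rewrite -exprnP lerXn2r ?nnegrE ?modulus_ge0 // ltW.
rewrite NegzE -exprnN -exprVn lerXn2r ?nnegrE ?invr_ge0 ?modulus_ge0 ?(ltW rho0) //.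
by rewrite -[leRHS]invrK lef_pV2 ?posrE ?invr_gt0.
Qed.

End LaurentLists.

(** * Limits of sums, products and determinants *)

Section SequenceLimits.
Context {K : numFieldType}.
Implicit Types (u v : nat -> K) (a b : K).

Lemma cvgn_eq_near u v a N0 : (forall N, (N0 <= N)%N -> u N = v N) ->
  u @ \oo --> a -> v @ \oo --> a.
Proof.
move=> uv ua; have uv' : {near \oo, u =1 v} by exists N0 => // N /= /uv.
exact: cvg_trans (near_eq_cvg uv') ua.
Qed.

Lemma cvgn_cst a : (fun=> a) @ \oo --> a.
Proof. exact: cvg_cst. Qed.

Lemma cvgnM u v a b : u @ \oo --> a -> v @ \oo --> b ->
  (fun N => u N * v N) @ \oo --> a * b.
Proof. exact: cvgM. Qed.

Lemma cvgnZ c u a : u @ \oo --> a -> (fun N => c * u N) @ \oo --> c * a.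
Proof. by apply: cvgnM; apply: cvg_cst. Qed.

Lemma cvgnV u a : a != 0 -> u @ \oo --> a -> (fun N => (u N)^-1) @ \oo --> a^-1.
Proof. exact: cvgV. Qed.

Lemma cvgn_sum (I : Type) (s : seq I) (P : pred I) (u : I -> nat -> K) (a : I -> K) :
  (forall i, P i -> u i @ \oo --> a i) ->
  (fun N => \sum_(i <- s | P i) u i N) @ \oo --> \sum_(i <- s | P i) a i.
Proof.
move=> ua; elim: s => [|i s IHs].
  by rewrite big_nil; under eq_fun do rewrite big_nil; apply: cvg_cst.
rewrite big_cons; under eq_fun do rewrite big_cons.
by case: ifP => // Pi; apply: cvgD => //; apply: ua.
Qed.

Lemma cvgn_prod (I : Type) (s : seq I) (P : pred I) (u : I -> nat -> K) (a : I -> K) :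
  (forall i, P i -> u i @ \oo --> a i) ->
  (fun N => \prod_(i <- s | P i) u i N) @ \oo --> \prod_(i <- s | P i) a i.
Proof.
move=> ua; elim: s => [|i s IHs].
  by rewrite big_nil; under eq_fun do rewrite big_nil; apply: cvg_cst.
rewrite big_cons; under eq_fun do rewrite big_cons.
by case: ifP => // Pi; apply: cvgM => //; apply: ua.
Qed.

Lemma cvgn_det n (A : 'I_n -> 'I_n -> nat -> K) (a : 'I_n -> 'I_n -> K) :
  (forall i j, A i j @ \oo --> a i j) ->
  (fun N => \det (\matrix_(i, j) A i j N)) @ \oo --> \det (\matrix_(i, j) a i j).
Proof.
move=> Aa; apply: cvgn_sum => s _; apply: cvgnZ.
under eq_fun do under eq_bigr do rewrite mxE.
under eq_bigr do rewrite mxE.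
exact: cvgn_prod.
Qed.

End SequenceLimits.

(** * The limit of the determinantal formula *)

Section RatioLimits.
Context {R : realType}.
Local Notation C := (Cplx R).

Lemma cvgn_invn : (fun N => (N%:R : R)^-1) @ \oo --> (0 : R).
Proof.
apply/cvg_realP => e e0.
have [N0 hN0] : exists N0 : nat, e^-1 <= N0%:R.
  by exists (Num.truncn e^-1).+1; rewrite ltW // truncnS_gt.
exists N0 => N N0N; rewrite subr0 normfV normr_nat.
rewrite -[leRHS]invrK lef_pV2 ?posrE ?invr_gt0 //.
  by apply: le_trans hN0 _; rewrite ler_nat.
apply: lt_le_trans (_ : 0 < e^-1) _; first by rewrite invr_gt0.
by apply: le_trans hN0 _; rewrite ler_nat.
Qed.

Lemma cvgn_ratio_nat c : (fun N => (N%:R : R) / (N - c)%:R) @ \oo --> (1 : R).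
Proof.
have h : (fun N => 1 - c%:R * (N%:R : R)^-1) @ \oo --> (1 - c%:R * 0 : R).
  by apply: cvgB; [apply: cvg_cst | apply: cvgnZ; apply: cvgn_invn].
rewrite mulr0 subr0 in h.
have := cvgnV (oner_neq0 R) h; rewrite invr1; apply: (cvgn_eq_near (N0 := c.+1)).
move=> N cN; have N0 : N%:R != 0 :> R by rewrite pnatr_eq0; lia.
have Nc0 : (N - c)%:R != 0 :> R by rewrite pnatr_eq0; lia.
rewrite /=; have E : (N - c)%:R = N%:R - c%:R :> R by rewrite natrB //; lia.
rewrite E in Nc0 *; rewrite -[X in (X - _)^-1](divff N0) -mulrBl invfM invrK mulrC //.
Qed.

Lemma cvgn_fact_ratio b :
  (fun N => (N%:R ^+ b * (N - b.+1)`!%:R) / (N.-1)`!%:R : R) @ \oo --> (1 : R).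
Proof.
elim: b => [|b IHb].
  apply: (cvgn_eq_near (N0 := 0) (u := fun=> 1)); last exact: cvg_cst.
  by move=> N _; rewrite expr0 mul1r subn1 divff // fact_neq0.
have := cvgnM IHb (cvgn_ratio_nat b.+1); rewrite mulr1.
apply: (cvgn_eq_near (N0 := b.+2)) => N bN /=.
have -> : (N - b.+1)%N = (N - b.+2).+1 by lia.
rewrite factS natrM exprS.
have f0 : (N.-1)`!%:R != 0 :> R by apply: fact_neq0.
have s0 : (N - b.+2).+1%:R != 0 :> R by rewrite pnatr_eq0.
by field; rewrite f0 addrC natr1 s0.
Qed.

Lemma leval_powerlist N (L : seq int) b (x : C) :
  leval [seq ((L`_j)%:~R ^+ b / node_prod N L j, L`_j) | j <- iota 0 N] x =
  divdiff N L (fun m => m%:~R ^+ b * x ^ m).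
Proof.
rewrite /leval big_map /divdiff -[N in iota 0 N]subn0 big_mkord.
by apply: eq_bigr => j _; rewrite /= mulrAC.
Qed.

Lemma prod_pairs k (a : nat -> C) :
  \prod_(i < k) \prod_(j < k | (i < j)%N) (a i * a j) = \prod_(i < k) a i ^+ k.-1.
Proof.
elim: k => [|k IHk]; first by rewrite !big_ord0.
rewrite big_ord_recr /= [X in _ * X]big1 ?mulr1; last first.
  by move=> j; rewrite ltnNge -ltnS ltn_ord.
have -> : \prod_(i < k) \prod_(j < k.+1 | (i < j)%N) (a i * a j) =
    (\prod_(i < k) \prod_(j < k | (i < j)%N) (a i * a j)) *
    \prod_(i < k) (a i * a k).
  rewrite -big_split; apply: eq_bigr => i _ /=.
  by rewrite big_mkcond big_ord_recr /= ltn_ord -big_mkcond.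
rewrite IHk big_ord_recr big_split /= prodr_const card_ord mulrA -big_split.
congr (_ * _); apply: eq_bigr => i _ /=; rewrite -exprSr.
by case: k i {IHk} => // -[].
Qed.

Section OneToMany.
Variables (rho : R) (N0 : nat) (L : nat -> seq int) (S : nat -> seq (C * int)).
Hypotheses (rho_ge1 : 1 <= rho) (sL : forall N, sorted >%R (L N))
  (szL : forall N, size (L N) = N).
Hypothesis SE : forall N x, (N0 <= N)%N -> x != 0 ->
  leval (S N) x = normalized_gt N (L N) (pad1 1 (fun=> x)).
Hypothesis bS : lbounded rho N0 S.

(* Applying (x d/dx)^b to (x - 1)^(N-1) S, every derivative falling on S      *)
(* costs a factor N.                                                          *)
Lemma divdiff_expansion b : exists B, lbounded rho N0 B /\
  forall N, (N0 <= N)%N -> (b < N)%N -> forall x : C, x != 0 ->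
    divdiff N (L N) (fun m => m%:~R ^+ b * x ^ m) * (N.-1)`!%:R =
    N%:R ^+ b * (x - 1) ^+ (N - b.+1) *
      (x ^+ b * leval (S N) x + N%:R^-1 * leval (B N) x).
Proof.
elim: b => [|b [B [bB BE]]].
  exists (fun=> [::]); split.
    by move=> j; exists 0 => N _; rewrite /lnorm big_nil.
  move=> N N0N Npos x x0; rewrite /leval big_nil mulr0 addr0 !expr0 !mul1r.
  rewrite -/(leval _ _) SE //.
  have [szN sN] : size (L N) = (1 + N.-1)%N /\ (1 + N.-1)%N = N.
    by rewrite szL; lia.
  have := @normalized_gt_det C N.-1 1 (L N) (fun=> x) (sL N) szN (fun _ _ => x0).
  rewrite sN /vandermonde !big_ord1 addn0 big_pred0 => [|i]; last first.
    by case: i => -[].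
  by rewrite mul1r det_mx11 mxE subn1 mulrC => <-.
pose iN N : C := N%:R^-1.
pose T N := lshift (b%:Z) (S N).
pose D N := lscale b%:R (T N) ++ lshift (b%:Z) (lderiv (S N)) ++ lscale (iN N) (lderiv (B N)).
(* The Leibniz rule gives (N - b - 1) x (T + B/N) + (x - 1) D, with T = x^b S and D the derivative
   of T + B/N. Taking out N x T leaves precisely these four terms, which divided by N form the new
   error. *)
exists (fun N => lscale (- b.+1%:R) (lshift 1 (T N)) ++
  lscale (1 - b.+1%:R * iN N) (lshift 1 (B N)) ++ lshift 1 (D N) ++ lscale (-1) (D N)).
have iN_le N : modulus (iN N) <= 1.
  rewrite modulusV modulus_nat; case: N => [|N]; first by rewrite invr0 ler01.
  by rewrite invf_le1 ?ltr0Sn // ler1n.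
have bT : lbounded rho N0 T by apply: lbounded_shift.
have bD : lbounded rho N0 D.
  apply: lbounded_cat; first exact: (lbounded_scale rho_ge1 (c := fun=> b%:R) (K := modulus (b%:R : C))).
  apply: lbounded_cat; first by apply/lbounded_shift => //; apply: lbounded_deriv.
  by apply: (lbounded_scale rho_ge1 (K := 1)) => //; apply: lbounded_deriv.
split.
  apply: lbounded_cat.
    apply: (lbounded_scale rho_ge1 (K := b.+1%:R)); first exact: lbounded_shift1.
    by move=> N _; rewrite modulusN modulus_nat.
  apply: lbounded_cat.
    apply: (lbounded_scale rho_ge1 (K := 1 + b.+1%:R)); first exact: lbounded_shift1.
    move=> N _; apply: le_trans (modulus_sub_le _ _) _.
    by rewrite modulus1 modulusM modulus_nat lerD2l ler_piMr.
  apply: lbounded_cat; first exact: lbounded_shift1.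
  apply: (lbounded_scale rho_ge1 (K := 1)) => // N _.
  by rewrite modulusN modulus1.
move=> N N0N bN x x0.
have NC0 : N%:R != 0 :> C by rewrite pnatr_eq0; lia.
have DE : leval (lderiv (T N ++ lscale (iN N) (B N))) x = leval (D N) x.
  rewrite lderiv_cat !leval_cat leval_lderiv_shift // leval_lderiv_scale.
  rewrite !leval_scale !leval_shift // addrA; congr (_ + _).
  by rewrite mulrDr mulrCA.
have := @lderiv_factor R (N - b.+2)
   ((N.-1)`!%:R / N%:R ^+ b)
   [seq (((L N)`_j)%:~R ^+ b / node_prod N (L N) j, (L N)`_j) | j <- iota 0 N]
   (T N ++ lscale (iN N) (B N)) _ x x0.
rewrite DE leval_cat leval_scale leval_shift // -exprnP.
have -> : leval (lderiv [seq (((L N)`_j)%:~R ^+ b / node_prod N (L N) j, (L N)`_j)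
    | j <- iota 0 N]) x =
  leval [seq (((L N)`_j)%:~R ^+ b.+1 / node_prod N (L N) j, (L N)`_j) | j <- iota 0 N] x.
  rewrite /leval /lderiv !big_map; apply: eq_bigr => j _ /=.
  by rewrite exprSr; congr (_ * _); rewrite mulrAC.
rewrite leval_powerlist => E.
rewrite !leval_cat !leval_scale !leval_shift // expr1z -exprnP.
move: E; set DS := leval (D N) x; set BB := leval (B N) x; set SS := leval (S N) x.
have -> : (N - b.+2).+1%:R = N%:R - b.+1%:R :> C by rewrite -natrB; [congr _%:R; lia | lia].
set A := divdiff _ _ _ => E.
have -> : A * (N.-1)`!%:R = N%:R ^+ b * (A * ((N.-1)`!%:R / N%:R ^+ b)).
  by field; rewrite expf_neq0.
rewrite {}E ?exprS /iN; first by field.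
move=> y y0; rewrite leval_powerlist leval_cat leval_scale leval_shift //.
rewrite mulrA BE //; last exact: ltnW.
have -> : (N - b.+1)%N = (N - b.+2).+1 by lia.
by rewrite -exprnP; field; rewrite NC0 expf_neq0.
Qed.

(** With (x_i - 1)^(N-1) taken out of row i and N^b / (N-1)! out of column b, the entries tend to
    phi_i (x_i / (x_i - 1))^b. Two values of x / (x - 1) differ by (x_i - x_j) / ((x_i - 1)(x_j -
    1)), so the limiting Vandermonde determinant cancels [vandermonde k x] and the powers (x_i -
    1)^(k-1). The remaining factorials give a factor tending to 1 by [cvgn_fact_ratio]. *)
Lemma normalized_gt_cvg k (x phi : nat -> C) :
  (forall i, (i < k)%N -> x i != 1) ->
  (forall i, (i < k)%N -> rho^-1 <= modulus (x i) <= rho) ->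
  (forall i j, (i < k)%N -> (j < k)%N -> x i = x j -> i = j) ->
  (forall i, (i < k)%N -> (fun N => leval (S N) (x i)) @ \oo --> phi i) ->
  (fun N => normalized_gt N (L N) (pad1 k x)) @ \oo --> \prod_(i < k) phi i.
Proof.
move=> x1 xrho xinj Sphi.
have rho0 : 0 < rho by apply: lt_le_trans rho_ge1.
have x0 i : (i < k)%N -> x i != 0.
  move=> /xrho /andP[xl _]; rewrite -modulus_gt0; apply: lt_le_trans xl.
  by rewrite invr_gt0.
have x10 i : (i < k)%N -> x i - 1 != 0 by move=> ik; rewrite subr_eq0 x1.
pose Z i b N := divdiff N (L N) (fun m => m%:~R ^+ b * x i ^ m) * (N.-1)`!%:R /
  (N%:R ^+ b * (x i - 1) ^+ (N - b.+1)).
have Zcvg i b : (i < k)%N -> Z i b @ \oo --> x i ^+ b * phi i.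
  move=> ik; have [B [bB BE]] := divdiff_expansion b.
  apply: (cvgn_eq_near (N0 := (N0 + b.+1)%N)
    (u := fun N => x i ^+ b * leval (S N) (x i) + N%:R^-1 * leval (B N) (x i))).
    move=> N NN; rewrite /Z BE ?x0 //; [|lia|lia].
    have NC0 : N%:R != 0 :> C by rewrite pnatr_eq0; lia.
    by rewrite mulrAC divff ?mul1r // mulf_neq0 // expf_neq0 // x10.
  rewrite -[X in _ --> X]addr0; apply: cvgD; first exact/cvgnZ/Sphi.
  apply/cvg_CplxP => e e0; have [M hM] := bB 0%N.
  have M0 : 0 <= `|M| + 1 by rewrite addr_ge0.
  have /(cvg_realP _ 0).1/(_ (e / (`|M| + 1))) := cvgn_invn.
  rewrite divr_gt0 ?ltr_wpDl // => /(_ isT)[N1 h1].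
  exists (maxn N0 N1) => N; rewrite geq_max => /andP[N0N N1N].
  have := h1 N N1N; rewrite !subr0 normfV normr_nat => h.
  rewrite modulusM modulusV modulus_nat.
  have -> : e = e / (`|M| + 1) * (`|M| + 1) by rewrite divfK // gt_eqF // ltr_wpDl.
  apply: ler_pM; rewrite ?invr_ge0 ?modulus_ge0 //.
  apply: le_trans (leval_le_lnorm rho_ge1 _ (xrho i ik)) _.
  apply: le_trans (hM N N0N) _; apply: le_trans (ler_norm _) _.
  by rewrite lerDl.
pose A i b N := ((x i - 1) ^+ b)^-1 * Z i b N.
pose P N : C := \prod_(b < k) (N%:R ^+ b * (N - b.+1)`!%:R / (N.-1)`!%:R).
have V0 : vandermonde k x != 0 by apply: vandermonde_neq0.
pose E : C := (\prod_(i < k) (x i - 1) ^+ k.-1) / vandermonde k x.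
have Pcvg : P @ \oo --> (1 : C).
  rewrite -[X in _ --> X](_ : \prod_(b < k) (1 : C) = 1); last by rewrite big1.
  apply: cvgn_prod => b _; have := cvg_of_real (cvgn_fact_ratio b).
  rewrite rmorph1; apply: (cvgn_eq_near (N0 := 0%N)) => N _ /=.
  by rewrite !rmorphM /= of_realV rmorphXn !rmorph_nat.
have PEcvg : (fun N => P N * E) @ \oo --> 1 * E.
  by apply: cvgnM; [exact: Pcvg | exact: cvgn_cst].
have detcvg : (fun N => \det (\matrix_(i < k, b < k) A i b N)) @ \oo -->
    \det (\matrix_(i < k, b < k) (phi i * (x i / (x i - 1)) ^+ b * 1)).
  apply: (cvgn_det (A := fun i b : 'I_k => A i b)
    (a := fun i b : 'I_k => phi i * (x i / (x i - 1)) ^+ b * 1)) => i b.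
  have -> : phi i * (x i / (x i - 1)) ^+ b * 1 =
      ((x i - 1) ^+ b)^-1 * (x i ^+ b * phi i).
    by rewrite mulr1 expr_div_n; ring.
  exact/cvgnZ/Zcvg.
have lim_det := cvgnM PEcvg detcvg.
have limE : 1 * E * \det (\matrix_(i < k, b < k) (phi i * (x i / (x i - 1)) ^+ b * 1)) =
    \prod_(i < k) phi i.
  rewrite mul1r det_scale [X in _ * (_ * X * _)]big1 // mulr1 mulrCA -[RHS]mulr1.
  congr (_ * _); rewrite -det_tr.
  have -> : (\matrix_(i < k, b < k) (x i / (x i - 1)) ^+ b)^T =
      Vandermonde k (\row_(i < k) (x i / (x i - 1))).
    by apply/matrixP => i j; rewrite !mxE.
  rewrite det_Vandermonde.
  have -> : \prod_(i < k) \prod_(j < k | (i < j)%N)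
      ((\row_(l < k) (x l / (x l - 1))) 0 j - (\row_(l < k) (x l / (x l - 1))) 0 i) =
    vandermonde k x * \prod_(i < k) \prod_(j < k | (i < j)%N)
       ((x i - 1)^-1 * (x j - 1)^-1).
    rewrite -big_split; apply: eq_bigr => i _; rewrite -big_split.
    apply: eq_bigr => j _; rewrite !mxE /=.
    have xi := x10 i (ltn_ord i); have xj := x10 j (ltn_ord j).
    by field; rewrite xi xj.
  rewrite (prod_pairs k (fun i => (x i - 1)^-1)) /E mulrA divfK //.
  by rewrite -big_split big1 // => i _ /=; rewrite exprVn mulfV // expf_neq0 // x10.
rewrite limE in lim_det; apply: (cvgn_eq_near (N0 := (N0 + k.+1)%N) _ lim_det).
move=> N NN; have [d Nd] : exists d, N = (k + d)%N by exists (N - k)%N; lia.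
have := @normalized_gt_det C d k (L N) x (sL N); rewrite -Nd => /(_ (szL N) x0).
have -> : \det (\matrix_(i < k, b < k)
      divdiff N (L N) (fun m => m%:~R ^+ b * x i ^ m)) =
    \det (\matrix_(i < k, b < k)
      ((x i - 1) ^+ N.-1 * A i b N * (N%:R ^+ b / (N.-1)`!%:R))).
  congr (\det _); apply/matrixP => i b; rewrite !mxE /A /Z.
  have -> : N.-1 = (b + (N - b.+1))%N by have := ltn_ord b; lia.
  have NC0 : N%:R != 0 :> C by rewrite pnatr_eq0; lia.
  have f0 m : m`!%:R != 0 :> C by apply: fact_neq0.
  by rewrite exprD; field; rewrite f0 !expf_neq0 ?x10.
rewrite (det_scale (fun i : 'I_k => (x i - 1) ^+ N.-1)
  (fun b : 'I_k => N%:R ^+ b / (N.-1)`!%:R) (fun i b : 'I_k => A i b N)).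
have -> : \prod_(i < k) (d + i)`!%:R = \prod_(b < k) (N - b.+1)`!%:R :> C.
  rewrite (reindex_inj rev_ord_inj); apply: eq_bigr => b _ /=.
  by congr ((_ `!)%:R); have := ltn_ord b; lia.
have -> : \prod_(i < k) (x i - 1) ^+ N.-1 =
    (\prod_(i < k) (x i - 1) ^+ d) * \prod_(i < k) (x i - 1) ^+ k.-1.
  rewrite -big_split; apply: eq_bigr => i _ /=; rewrite -exprD.
  by congr (_ ^+ _); have := ltn_ord i; lia.
have PE : P N = (\prod_(b < k) (N%:R ^+ b / (N.-1)`!%:R)) *
    \prod_(b < k) (N - b.+1)`!%:R.
  by rewrite -big_split; apply: eq_bigr => b _ /=; rewrite mulrAC.
rewrite PE /E; set X := \prod_(i < k) (x i - 1) ^+ d.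
have X0 : X != 0 by apply/prodf_neq0 => i _; rewrite expf_neq0 // x10.
move=> H; apply: (mulIf (mulf_neq0 V0 X0)); rewrite H.
by field.
Qed.

End OneToMany.
End RatioLimits.

(** * Taylor expansions and continuation along the unit circle *)

Section TaylorExpansions.
Context {R : realType}.
Local Notation C := (Cplx R).
Implicit Types (f g : C -> C) (c d : nat -> C) (z h : C) (r M q : R).

Lemma geometric_small q K e : 0 <= q < 1 -> 0 < e ->
  exists n0, forall n, (n0 <= n)%N -> K * q ^+ n <= e.
Proof.
move=> /andP[q0 q1] e0.
have qn : (fun n => q ^+ n) @ \oo --> (0 : R) by apply: cvg_expr; rewrite ger0_norm.
have /cvg_realP/(_ e e0)[n0 h] := cvgnZ (c := K) qn.
by exists n0 => n /h; rewrite mulr0 subr0; apply: le_trans; apply: ler_norm.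
Qed.

Definition psum c h m : C := \sum_(j < m) c j * h ^+ j.

(* f is the sum of the power series c around z on the disc of radius r, where *)
(* c has weighted l1-norm at most M; this norm is submultiplicative.          *)
Definition taylor z r f c M :=
  (forall n, \sum_(j < n) modulus (c j) * r ^+ j <= M) /\
  (forall h, modulus h < r -> exists K, forall m,
     modulus (f (z + h) - psum c h m) <= K * (modulus h / r) ^+ m).

Lemma taylor_ge0 z r f c M : taylor z r f c M -> 0 <= M.
Proof. by case=> /(_ 0%N); rewrite big_ord0. Qed.

Lemma taylor_coef z r f c M j : 0 < r -> taylor z r f c M ->
  modulus (c j) * r ^+ j <= M.
Proof.
move=> r0 [/(_ j.+1) h _]; apply: le_trans h; rewrite big_ord_recr /= lerDr.
by apply: sumr_ge0 => i _; rewrite mulr_ge0 ?modulus_ge0 // exprn_ge0 // ltW.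
Qed.

(** The constant [K] in [taylor] may depend on the point, but it improves to [M]: compare with a
    much longer partial sum, whose own remainder is negligible, and bound the terms in between by
    the norm times q^m. *)
Lemma taylor_remainder z r f c M h m : 0 < r -> taylor z r f c M ->
  modulus h < r ->
  modulus (f (z + h) - psum c h m) <= M * (modulus h / r) ^+ m.
Proof.
move=> r0 [cM cf] hr; have [K hK] := cf h hr; set q := modulus h / r.
have q01 : 0 <= q < 1.
  by rewrite /q divr_ge0 ?modulus_ge0 ?ltW //= ltr_pdivrMr ?mul1r.
have /andP[q0 q1] := q01.
apply/ler_addgt0Pr => e e0; have [n0 hn0] := geometric_small K q01 e0.
have := hn0 (n0 + m)%N (leq_addr _ _); move: (n0 + m)%N (leq_addl n0 m) => n mn hn.
have -> : f (z + h) - psum c h m =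
    (psum c h n - psum c h m) + (f (z + h) - psum c h n) by ring.
apply: le_trans (modulusD _ _) _; apply: lerD; last exact: le_trans (hK n) hn.
rewrite /psum -(big_mkord xpredT (fun j => c j * h ^+ j)).
rewrite (big_cat_nat (n := m)) //= big_mkord addrAC subrr add0r.
apply: le_trans (modulus_sum _ _ _) _.
apply: (@le_trans _ _ (\sum_(m <= j < n) modulus (c j) * r ^+ j * q ^+ m)).
  rewrite big_seq [leRHS]big_seq; apply: ler_sum => j.
  rewrite mem_index_iota => /andP[mj _].
  rewrite modulusM modulusX -mulrA ler_wpM2l ?modulus_ge0 //.
  have -> : modulus h = r * q by rewrite /q mulrC divfK // gt_eqF.
  rewrite exprMn ler_wpM2l ?exprn_ge0 ?(ltW r0) //.
  by rewrite ler_wiXn2l // ltW.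
rewrite -mulr_suml ler_wpM2r ?exprn_ge0 //; apply: le_trans (cM n).
rewrite -(big_mkord xpredT (fun j => modulus (c j) * r ^+ j)).
rewrite [leRHS](big_cat_nat (n := m)) //= lerDr; apply: sumr_ge0 => j _.
by rewrite mulr_ge0 ?modulus_ge0 // exprn_ge0 // ltW.
Qed.

Lemma taylor_bound z r f c M h : 0 < r -> taylor z r f c M -> modulus h < r ->
  modulus (f (z + h)) <= M.
Proof.
move=> r0 tf hr; have := taylor_remainder 0 r0 tf hr.
by rewrite /psum big_ord0 subr0 expr0 mulr1.
Qed.

Lemma eq_taylor z r f g c M : (forall h, modulus h < r -> f (z + h) = g (z + h)) ->
  taylor z r f c M -> taylor z r g c M.
Proof.
move=> fg [cM cf]; split=> // h hr; have [K hK] := cf h hr.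
by exists K => m; rewrite -fg.
Qed.

Lemma taylor_le z r f c M M' : M <= M' -> taylor z r f c M -> taylor z r f c M'.
Proof. by move=> MM' [cM cf]; split=> // n; apply: le_trans MM'. Qed.

Lemma taylor_shrink z r r' f c M : 0 < r' -> r' <= r ->
  taylor z r f c M -> taylor z r' f c M.
Proof.
move=> r0' rr' tf; have r0 : 0 < r by apply: lt_le_trans rr'.
split=> [n|h hr].
  apply: le_trans (tf.1 n); apply: ler_sum => j _; rewrite ler_wpM2l ?modulus_ge0 //.
  by rewrite lerXn2r // nnegrE ltW.
exists M => m; apply: le_trans (taylor_remainder m r0 tf (lt_le_trans hr rr')) _.
rewrite ler_wpM2l ?(taylor_ge0 tf) // lerXn2r ?nnegrE ?divr_ge0 ?modulus_ge0 ?(ltW r0) ?(ltW r0') //.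
by rewrite ler_wpM2l ?modulus_ge0 // lef_pV2.
Qed.

Lemma taylorD z r f g c d M M' : 0 < r ->
  taylor z r f c M -> taylor z r g d M' ->
  taylor z r (fun x => f x + g x) (fun j => c j + d j) (M + M').
Proof.
move=> r0 [cM cf] [dM dg]; split=> [n|h hr].
  apply: le_trans (lerD (cM n) (dM n)); rewrite -big_split; apply: ler_sum => j _ /=.
  by rewrite -mulrDl ler_wpM2r ?modulusD // exprn_ge0 // ltW.
have [K hK] := cf h hr; have [K' hK'] := dg h hr; exists (K + K') => m.
have -> : psum (fun j => c j + d j) h m = psum c h m + psum d h m.
  by rewrite /psum -big_split; apply: eq_bigr => j _; rewrite mulrDl.
rewrite opprD addrACA mulrDl; apply: le_trans (modulusD _ _) _.
exact: lerD.
Qed.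

Lemma taylorZ z r f c M (a : C) : taylor z r f c M ->
  taylor z r (fun x => a * f x) (fun j => a * c j) (modulus a * M).
Proof.
move=> [cM cf]; split=> [n|h hr].
  apply: le_trans (ler_wpM2l (modulus_ge0 a) (cM n)); rewrite mulr_sumr.
  by apply: ler_sum => j _; rewrite modulusM mulrA.
have [K hK] := cf h hr; exists (modulus a * K) => m.
have -> : psum (fun j => a * c j) h m = a * psum c h m.
  by rewrite /psum mulr_sumr; apply: eq_bigr => j _; rewrite mulrA.
by rewrite -mulrBr modulusM -mulrA ler_wpM2l ?modulus_ge0.
Qed.

Lemma sum_cauchy_product (K : comNzRingType) (a b : nat -> K) n :
  \sum_(j < n) \sum_(i < j.+1) a i * b (j - i)%N =
  \sum_(i < n) a i * \sum_(j < n - i) b j.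
Proof.
elim: n => [|n IHn]; first by rewrite !big_ord0.
rewrite big_ord_recr /= IHn [RHS]big_ord_recr /= subSnn big_ord1.
rewrite [X in _ + X = _]big_ord_recr /= subnn addrA; congr (_ + _).
rewrite -big_split; apply: eq_bigr => i _ /=.
by rewrite subSn ?(ltnW (ltn_ord i)) // big_ord_recr /= mulrDr.
Qed.

(** The remainder of the Cauchy product splits as (f - P_m) g plus the sum of c_i h^i (g - Q_(m-i)),
    where P and Q are the partial sums of f and g; by [taylor_remainder] both pieces are of order
    q^m. *)
Lemma taylorM z r f g c d M M' : 0 < r ->
  taylor z r f c M -> taylor z r g d M' ->
  taylor z r (fun x => f x * g x)
    (fun j => \sum_(i < j.+1) c i * d (j - i)%N) (M * M').
Proof.
move=> r0 tf tg; have [cM cf] := tf; have [dM dg] := tg.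
have r0' : 0 <= r by apply: ltW.
have pos (u : nat -> C) j : 0 <= modulus (u j) * r ^+ j.
  by rewrite mulr_ge0 ?modulus_ge0 ?exprn_ge0.
split=> [n|h hr].
  apply: (@le_trans _ _ (\sum_(j < n) \sum_(i < j.+1)
      (modulus (c i) * r ^+ i) * (modulus (d (j - i)%N) * r ^+ (j - i)))).
    apply: ler_sum => j _.
    apply: (@le_trans _ _ ((\sum_(i < j.+1) modulus (c i * d (j - i)%N)) * r ^+ j)).
      by rewrite ler_wpM2r ?exprn_ge0 // modulus_sum.
    rewrite mulr_suml; apply: ler_sum => i _; rewrite modulusM.
    by rewrite mulrACA -exprD subnKC // -ltnS.
  rewrite (@sum_cauchy_product R (fun i => modulus (c i) * r ^+ i)
    (fun i => modulus (d i) * r ^+ i)).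
  apply: (@le_trans _ _ (\sum_(i < n) modulus (c i) * r ^+ i * M')).
    by apply: ler_sum => i _; rewrite ler_wpM2l.
  by rewrite -mulr_suml ler_wpM2r ?cM // (taylor_ge0 tg).
exists (2 * (M * M')) => m; set q := modulus h / r.
have hq : modulus h = r * q by rewrite /q mulrC divfK // gt_eqF.
have q0 : 0 <= q by rewrite divr_ge0 ?modulus_ge0.
have -> : psum (fun j => \sum_(i < j.+1) c i * d (j - i)%N) h m =
    \sum_(i < m) c i * h ^+ i * psum d h (m - i).
  rewrite /psum -(@sum_cauchy_product _ (fun i => c i * h ^+ i) (fun i => d i * h ^+ i)).
  apply: eq_bigr => j _; rewrite mulr_suml; apply: eq_bigr => i _ /=.
  by rewrite [RHS]mulrACA -exprD subnKC // -ltnS.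
have -> : f (z + h) * g (z + h) - \sum_(i < m) c i * h ^+ i * psum d h (m - i) =
   (f (z + h) - psum c h m) * g (z + h) +
   \sum_(i < m) c i * h ^+ i * (g (z + h) - psum d h (m - i)).
  under [X in _ = _ + X]eq_bigr do rewrite mulrBr.
  by rewrite sumrB -mulr_suml -/(psum c h m); ring.
have -> : 2 * (M * M') * q ^+ m = M * q ^+ m * M' + M * (M' * q ^+ m) by ring.
apply: le_trans (modulusD _ _) _; apply: lerD.
  by rewrite modulusM; apply: ler_pM; rewrite ?modulus_ge0 ?(taylor_remainder m r0 tf hr) ?(taylor_bound r0 tg hr).
apply: le_trans (modulus_sum _ _ _) _.
apply: (@le_trans _ _ (\sum_(i < m) modulus (c i) * r ^+ i * (M' * q ^+ m))).
  apply: ler_sum => i _; rewrite !modulusM modulusX hq exprMn -!mulrA.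
  rewrite ler_wpM2l ?modulus_ge0 // ler_wpM2l ?exprn_ge0 //.
  have := taylor_remainder (m - i) r0 tg hr; rewrite -/q => ht.
  have := ler_wpM2l (exprn_ge0 i q0) ht; rewrite mulrCA -exprD subnKC //.
  exact: ltnW.
by rewrite -mulr_suml ler_wpM2r // mulr_ge0 ?exprn_ge0 // (taylor_ge0 tg).
Qed.

Lemma taylor_affine z r (a b : C) : 0 < r ->
  taylor z r (fun x => a + b * x)
    (fun j => if j == 0%N then a + b * z else if j == 1%N then b else 0)
    (modulus (a + b * z) + modulus b * r).
Proof.
move=> r0; set c := (X in taylor _ _ _ X _); set M := (X in taylor _ _ _ _ X).
have E0 : 0 <= modulus (a + b * z) by apply: modulus_ge0.
have E1 : 0 <= modulus b * r by rewrite mulr_ge0 ?modulus_ge0 ?ltW.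
split=> [[|[|n]]|h hr].
- by rewrite big_ord0 addr_ge0.
- by rewrite big_ord1 expr0 mulr1 /c /= lerDl.
- rewrite 2!big_ord_recl big1 => [|i _]; last by rewrite /c /= modulus0 mul0r.
  by rewrite addr0 expr0 expr1 mulr1.
exists M => -[|[|m]].
- rewrite /psum big_ord0 subr0 expr0 mulr1 mulrDr addrA.
  apply: le_trans (modulusD _ _) _; rewrite lerD2l modulusM.
  by rewrite ler_wpM2l ?modulus_ge0 ?ltW.
- rewrite /psum big_ord1 expr0 mulr1 /c /= expr1.
  have -> : a + b * (z + h) - (a + b * z) = b * h by ring.
  rewrite modulusM; have -> : modulus b * modulus h = modulus b * r * (modulus h / r).
    by rewrite -mulrA [r * _]mulrC divfK // gt_eqF.
  by rewrite ler_wpM2r ?lerDr // divr_ge0 ?modulus_ge0 ?ltW.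
- rewrite /psum 2!big_ord_recl big1 => [|i _]; last by rewrite /c /= mul0r.
  rewrite /c /= expr0 expr1 mulr1 addr0.
  have -> : a + b * (z + h) - (a + b * z + b * h) = 0 by ring.
  rewrite modulus0 mulr_ge0 ?addr_ge0 // exprn_ge0 // divr_ge0 ?modulus_ge0 ?ltW //.
Qed.

Lemma sum_geometric q n : 0 <= q < 1 -> \sum_(j < n) q ^+ j <= (1 - q)^-1.
Proof.
move=> /andP[q0 q1]; have q1' : 0 < 1 - q by rewrite subr_gt0.
rewrite -[leRHS]mul1r ler_pdivlMr // mulrC -opprB mulNr -subrX1 opprB.
by rewrite gerBl exprn_ge0.
Qed.

Lemma taylor_inv z r (a b : C) : 0 < r -> modulus b * r < modulus (a + b * z) ->
  taylor z r (fun x => (a + b * x)^-1)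
    (fun j => (- b) ^+ j / (a + b * z) ^+ j.+1)
    (modulus (a + b * z) - modulus b * r)^-1.
Proof.
move=> r0 br; set w := a + b * z.
have E1 : 0 <= modulus b * r by rewrite mulr_ge0 ?modulus_ge0 ?ltW.
have w0 : 0 < modulus w by apply: le_lt_trans br.
have wn0 : w != 0 by rewrite -modulus_gt0.
pose p := modulus b * r / modulus w.
have p01 : 0 <= p < 1 by rewrite divr_ge0 ?modulus_ge0 //= ltr_pdivrMr ?mul1r.
split=> [n|h hr].
  have -> : (modulus w - modulus b * r)^-1 = (modulus w)^-1 * (1 - p)^-1.
    by rewrite -invfM mulrBr mulr1 /p [_ * (_ / _)]mulrC divfK // gt_eqF.
  apply: le_trans (_ : (modulus w)^-1 * \sum_(j < n) p ^+ j <= _).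
    rewrite mulr_sumr; apply: ler_sum => j _.
    rewrite modulusM modulusV !modulusX modulusN exprS invfM /p !exprMn exprVn.
    by rewrite le_eqVlt; apply/orP; left; apply/eqP; ring.
  by rewrite ler_wpM2l ?invr_ge0 ?modulus_ge0 // sum_geometric.
have bh : modulus (b * h) < modulus w.
  by apply: le_lt_trans br; rewrite modulusM ler_wpM2l ?modulus_ge0 ?ltW.
have wbh : w + b * h != 0.
  have := modulus_dist_le w (- (b * h)); rewrite opprK modulusN -modulus_gt0.
  by apply: lt_le_trans; rewrite subr_gt0.
exists (modulus (w + b * h)^-1) => m.
have -> : a + b * (z + h) = w + b * h by rewrite /w; ring.
have -> : (w + b * h)^-1 - psum (fun j => (- b) ^+ j / w ^+ j.+1) h m =
    (w + b * h)^-1 * (- (b * h) / w) ^+ m.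
  elim: m => [|m IHm]; first by rewrite /psum big_ord0 subr0 expr0 mulr1.
  rewrite /psum big_ord_recr /= opprD addrA -/(psum _ _ _) IHm.
  have -> : (- b) ^+ m / w ^+ m.+1 * h ^+ m = w^-1 * (- (b * h) / w) ^+ m.
    by rewrite exprS invfM -mulNr !exprMn exprVn; ring.
  by rewrite -mulrBl exprS mulrA; congr (_ * _); field; rewrite wn0 wbh.
rewrite modulusM ler_wpM2l ?modulus_ge0 // modulusX.
rewrite lerXn2r ?nnegrE ?modulus_ge0 ?divr_ge0 ?modulus_ge0 ?(ltW r0) //.
rewrite !modulusM modulusN modulusV modulusM ler_pdivrMr // mulrAC ler_pdivlMr //.
by rewrite mulrAC [leRHS]mulrC ler_wpM2r ?modulus_ge0 ?ltW.
Qed.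

Lemma taylor_cst z r (a : C) : 0 < r ->
  taylor z r (fun=> a) (fun j => if j == 0%N then a else 0) (modulus a).
Proof.
move=> r0; have := @taylor_affine z r a 0 r0.
rewrite mul0r addr0 modulus0 mul0r addr0 => -[cM cf]; split=> [n|h hr].
  apply: le_trans (cM n); apply: ler_sum => j _.
  by case: j => -[|[|j]] //= _; rewrite modulus0.
have [K hK] := cf h hr; exists K => m; have := hK m; rewrite mul0r addr0.
rewrite /psum; congr (modulus (_ - _) <= _).
by apply: eq_bigr => -[[|[|j]] ?].
Qed.

Lemma taylor_prod (I : eqType) (s : seq I) z r (F : I -> C -> C) (M : I -> R) :
  0 < r -> (forall i, i \in s -> exists c, taylor z r (F i) c (M i)) ->
  exists c, taylor z r (fun x => \prod_(i <- s) F i x) c (\prod_(i <- s) M i).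
Proof.
move=> r0; elim: s => [|i s IHs] Fs.
  exists (fun j => if j == 0%N then 1 else 0); rewrite big_nil -[M in taylor _ _ _ _ M]modulus1.
  by apply: eq_taylor (taylor_cst z 1 r0) => h _; rewrite big_nil.
have [c tc] := Fs i (mem_head _ _).
have [d td] := IHs (fun j js => Fs j (mem_behead (s := i :: s) js)).
eexists; rewrite big_cons; apply: eq_taylor (taylorM r0 tc td) => h _.
by rewrite big_cons.
Qed.

End TaylorExpansions.

Section AnalyticContinuation.
Context {R : realType}.
Local Notation C := (Cplx R).

Lemma cvgn_CplxE (u : nat -> C) :
  u @ \oo --> (0 : C) <->
  forall e : R, 0 < e -> exists N0, forall N, (N0 <= N)%N -> modulus (u N) <= e.
Proof.
split=> [/cvg_CplxP h e /h [N0 hN]|h].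
  by exists N0 => N /hN; rewrite subr0.
by apply/cvg_CplxP => e /h [N0 hN]; exists N0 => N /hN; rewrite subr0.
Qed.

Section VanishingSequence.
Variables (D : nat -> C -> C) (r M : R) (N0 : nat) (z : C) (c : nat -> nat -> C).
Hypotheses (r0 : 0 < r)
  (Dc : forall N, (N0 <= N)%N -> taylor z r (D N) (c N) M).

Lemma psum_cvg0 m h : (forall j, (j < m)%N -> c ^~ j @ \oo --> (0 : C)) ->
  (fun N => psum (c N) h m) @ \oo --> (0 : C).
Proof.
move=> c0; rewrite -[X in _ --> X](_ : \sum_(j < m) 0 * h ^+ j = 0); last first.
  by rewrite big1 // => j _; rewrite mul0r.
apply: cvgn_sum => j _; apply: cvgnM; last exact: cvgn_cst.
exact: c0.
Qed.

(** A common norm bound makes the tails of all the series uniformly small, which leaves a finite sum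
    of vanishing coefficients. *)
Lemma taylor_cvg0 h : (forall j, c ^~ j @ \oo --> (0 : C)) -> modulus h < r ->
  (fun N => D N (z + h)) @ \oo --> (0 : C).
Proof.
move=> c0 hr; apply/cvgn_CplxE => e e0.
have q01 : 0 <= modulus h / r < 1.
  by rewrite divr_ge0 ?modulus_ge0 ?ltW //= ltr_pdivrMr ?mul1r.
have e20 : 0 < e / 2 by rewrite divr_gt0.
have [m hm] := geometric_small M q01 e20.
have /cvgn_CplxE/(_ _ e20)[N1 hN1] := psum_cvg0 h (m := m) (fun j _ => c0 j).
exists (maxn N0 N1) => N; rewrite geq_max => /andP[N0N N1N].
rewrite -[D N _](subrK (psum (c N) h m)) [e]splitr.
apply: le_trans (modulusD _ _) _; apply: lerD; last exact: hN1.
exact: le_trans (taylor_remainder m r0 (Dc N0N) hr) (hm m (leqnn _)).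
Qed.

(** Together with [taylor_cvg0] this is a form of Vitali's theorem: convergence to 0 on a small disc
    extends to the whole disc on which the expansions are bounded. By strong induction, c_m h^m is
    isolated from the value at a small h up to the earlier terms and a remainder of order
    |h|^(m+1). *)
Lemma taylor_coef_cvg0 delta : 0 < delta ->
  (forall h, modulus h < delta -> (fun N => D N (z + h)) @ \oo --> (0 : C)) ->
  forall j, c ^~ j @ \oo --> (0 : C).
Proof.
move=> d0 Dh; elim/ltn_ind => m IHm; apply/cvgn_CplxE => e e0.
have M0 : 0 <= M by apply: taylor_ge0 (Dc (leqnn N0)).
have e20 : 0 < e / 2 by rewrite divr_gt0.
(* The third bound makes the remainder M (t/r)^(m+1) at most (e/2) t^m, which remains small after
   division by t^m. *)
pose t := Num.min (delta / 2) (Num.min (r / 2) (e / 2 * r ^+ m.+1 / (M + 1))).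
have M10 : 0 < M + 1 by apply: ltr_wpDl.
have t0 : 0 < t.
  by rewrite /t !lt_min !divr_gt0 ?mulr_gt0 ?exprn_gt0 ?divr_gt0.
have td : t < delta.
  by apply: le_lt_trans (_ : delta / 2 < _); [by rewrite /t ge_min lexx | by rewrite gtr_pMr // invf_lt1 // ltr1n].
have tr : t < r.
  by apply: le_lt_trans (_ : r / 2 < _); [by rewrite /t !ge_min lexx orbT | by rewrite gtr_pMr // invf_lt1 // ltr1n].
have tM : M * t / r ^+ m.+1 <= e / 2.
  rewrite ler_pdivrMr ?exprn_gt0 //.
  apply: (@le_trans _ _ ((M + 1) * t)); first by rewrite ler_wpM2r ?lerDl ?ltW.
  by rewrite mulrC -ler_pdivlMr // /t !ge_min lexx !orbT.
pose h : C := of_real t.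
have mh : modulus h = t by rewrite modulus_of_real_ge0 ?ltW.
have et0 : 0 < e / 2 / 2 * t ^+ m by rewrite mulr_gt0 ?exprn_gt0 // divr_gt0.
have hd : modulus h < delta by rewrite mh.
have /cvgn_CplxE/(_ _ et0)[N1 hN1] := Dh h hd.
have /cvgn_CplxE/(_ _ et0)[N2 hN2] := psum_cvg0 h IHm.
exists (maxn N0 (maxn N1 N2)) => N; rewrite !geq_max => /and3P[N0N N1N N2N].
have hr : modulus h < r by rewrite mh.
have rem := taylor_remainder m.+1 r0 (Dc N0N) hr.
have E : c N m * h ^+ m =
    D N (z + h) - psum (c N) h m - (D N (z + h) - psum (c N) h m.+1).
  by rewrite /psum big_ord_recr /=; ring.
have : modulus (c N m * h ^+ m) <= e * t ^+ m.
  rewrite E; apply: le_trans (modulus_sub_le _ _) _.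
  have -> : e * t ^+ m = (e / 2 / 2 * t ^+ m + e / 2 / 2 * t ^+ m) + e / 2 * t ^+ m.
    by field.
  apply: lerD.
    by apply: le_trans (modulus_sub_le _ _) _; apply: lerD; [apply: hN1 | apply: hN2].
  apply: le_trans rem _; rewrite mh.
  have -> : M * (t / r) ^+ m.+1 = M * t / r ^+ m.+1 * t ^+ m.
    by rewrite exprMn exprVn exprS; ring.
  by rewrite ler_wpM2r ?exprn_ge0 ?(ltW t0).
by rewrite modulusM modulusX mh ler_pM2r ?exprn_gt0.
Qed.

End VanishingSequence.

Lemma taylor_unique z r f g c d (M M' : R) delta : 0 < r -> 0 < delta ->
  taylor z r f c M -> taylor z r g d M' ->
  (forall h, modulus h < delta -> f (z + h) = g (z + h)) -> c =1 d.
Proof.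
move=> r0 d0 tf tg fg j.
have tfg := taylorD r0 tf (taylorZ (-1) tg).
have := @taylor_coef_cvg0 (fun _ x => f x + -1 * g x) r _ 0%N z
  (fun _ j => c j + -1 * d j) r0 (fun _ _ => tfg) delta d0 _ j.
move=> /(_ _)/cvgn_CplxE h; apply/eqP; rewrite -subr_eq0 -modulus_eq0 eq_le modulus_ge0 andbT.
apply/ler_addgt0Pr => e e0; rewrite add0r -mulN1r.
case: (h _ e e0) => [h' hd|N1 /(_ _ (leqnn _)) //].
have -> : (fun N : nat => f (z + h') + -1 * g (z + h')) = fun=> 0.
  by apply/funext => _; rewrite fg // mulN1r subrr.
exact: cvgn_cst.
Qed.

(** Iterated square roots with nonnegative real part: such a root v of w has |v + 1| >= sqrt 2 >
    7/5, and (v - 1)(v + 1) = w - 1, so each step shrinks the distance to 1 by 5/7. *)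
Lemma unit_root_near1 (n : nat) (z : C) : modulus z = 1 ->
  exists w : C, [/\ modulus w = 1, w ^+ (2 ^ n) = z & modulus (w - 1) <= 2 * (5 / 7) ^+ n].
Proof.
move=> z1; elim: n => [|n [w [w1 wz wn]]].
  exists z; rewrite expn0 !expr1 expr0 mulr1; split=> //.
  by apply: le_trans (modulus_sub_le _ _) _; rewrite z1 modulus1.
have [v [v2 vRe]] : exists v : C, v ^+ 2 = w /\ 0 <= complex.Re v.
  have [s0|s0] := leP 0 (complex.Re (sqrtc w)).
    by exists (sqrtc w); rewrite sqr_sqrtc.
  exists (- sqrtc w : C); split; first by rewrite sqrrN; apply: sqr_sqrtc.
  by case: (sqrtc w) s0 => a b /= a0; rewrite oppr_ge0 ltW.
have v1 : modulus v = 1.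
  have /eqP : modulus v ^+ 2 = 1 by rewrite -modulusX v2.
  by rewrite sqrp_eq1 ?modulus_ge0 // => /eqP.
exists v; split=> //; first by rewrite expnS exprM v2.
have mod2 (u : C) : modulus u ^+ 2 = complex.Re u ^+ 2 + complex.Im u ^+ 2.
  rewrite /modulus normc_def /= sqr_sqrtr //.
  by rewrite addr_ge0 ?sqr_ge0.
have vp1 : 7 / 5 <= modulus (v + 1).
  rewrite -[leLHS]ger0_norm ?divr_ge0 // -[leRHS]ger0_norm ?modulus_ge0 //.
  rewrite -ler_sqr ?nnegrE ?normr_ge0 // !real_normK ?num_real //.
  have := mod2 v; have := mod2 (v + 1); rewrite v1 expr1n.
  by case: (v) vRe => a b /=; rewrite addr0; nra.
have : modulus (v - 1) * modulus (v + 1) <= 2 * (5 / 7) ^+ n.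
  by rewrite -modulusM; have -> : (v - 1) * (v + 1) = w - 1 by rewrite -v2; ring.
have := modulus_ge0 (v - 1); rewrite exprS; set X := modulus (v - 1).
move=> X0 XV; suff : X * (7 / 5) <= 2 * (5 / 7) ^+ n by lra.
by apply: le_trans XV; rewrite ler_wpM2l.
Qed.

Section Continuation.
Variables (D : nat -> C -> C) (r M : R) (N0 : nat).
Hypotheses (r0 : 0 < r)
  (Dtaylor : forall N z, (N0 <= N)%N -> modulus z = 1 ->
     exists c, taylor z r (D N) c M).

Definition locally_vanishing (z : C) := exists delta : R, 0 < delta /\
  forall h, modulus h < delta -> (fun N => D N (z + h)) @ \oo --> (0 : C).

Lemma locally_vanishing_disc z h : modulus z = 1 -> locally_vanishing z ->
  modulus h < r -> (fun N => D N (z + h)) @ \oo --> (0 : C).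
Proof.
move=> z1 [delta [d0 Dd]] hr.
have [c Dc] : exists c, forall N, (N0 <= N)%N -> taylor z r (D N) (c N) M.
  have h1 N : exists c, (N0 <= N)%N -> taylor z r (D N) c M.
    have [N0N|NN0] := leqP N0 N; last by exists (fun=> 0).
    by have [c tc] := Dtaylor N0N z1; exists c.
  by exists (fun N => projT1 (cid (h1 N))) => N; exact: (projT2 (cid (h1 N))).
apply: (taylor_cvg0 r0 Dc) hr.
exact: (taylor_coef_cvg0 r0 Dc d0).
Qed.

(* A point of the unit circle is joined to 1 by the powers of one of its      *)
(* roots w, chosen so close to 1 that the steps have length less than r.      *)
Lemma locally_vanishing_annulus : locally_vanishing 1 ->
  forall x, 1 - r < modulus x < 1 + r -> x != 0 ->
  (fun N => D N x) @ \oo --> (0 : C).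
Proof.
move=> D1 x /andP[xl xu] x0.
have mx0 : 0 < modulus x by rewrite modulus_gt0.
pose z := x * of_real (modulus x)^-1.
have z1 : modulus z = 1.
  by rewrite modulusM modulus_of_real_ge0 ?invr_ge0 ?modulus_ge0 // divff // gt_eqF.
have zx : modulus (x - z) < r.
  have -> : x - z = z * of_real (modulus x - 1).
    rewrite rmorphB rmorph1 mulrBr mulr1 /z -mulrA -rmorphM /= mulVf ?gt_eqF //.
    by rewrite rmorph1 mulr1.
  rewrite modulusM z1 mul1r modulus_of_real ltr_norml; apply/andP; split; lra.
have -> : x = z + (x - z) by ring.
apply: locally_vanishing_disc zx => //.
have q01 : 0 <= (5 / 7 : R) < 1 by apply/andP; split; lra.
have [n hn] := geometric_small 2 q01 (divr_gt0 r0 (ltr0Sn R 1)).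
have [w [w1 wz wn]] := unit_root_near1 n z1.
have wr : modulus (w - 1) < r.
  apply: le_lt_trans wn _; apply: le_lt_trans (hn n (leqnn _)) _; lra.
rewrite -wz; elim: (2 ^ n)%N => [|m IHm]; first by rewrite expr0.
exists (r - modulus (w - 1)); split; first by rewrite subr_gt0.
move=> h hh; have wm1 : modulus (w ^+ m) = 1 by rewrite modulusX w1 expr1n.
have -> : w ^+ m.+1 + h = w ^+ m + (w ^+ m * (w - 1) + h) by rewrite exprSr; ring.
apply: locally_vanishing_disc => //.
apply: le_lt_trans (modulusD _ _) _; rewrite modulusM wm1 mul1r; lra.
Qed.

End Continuation.
End AnalyticContinuation.

(** * Taylor coefficients in one variable *)

Section OneVariable.
Context {R : realType}.
Local Notation C := (Cplx R).

Lemma normalized_gt1 N (L : seq int) (x : C) : sorted >%R L -> size L = N ->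
  (0 < N)%N -> x != 0 ->
  normalized_gt N L (pad1 1 (fun=> x)) * (x - 1) ^+ N.-1 =
  (N.-1)`!%:R * divdiff N L (fun m => x ^ m).
Proof.
move=> sL szL N0 x0.
have [szN sN] : size L = (1 + N.-1)%N /\ (1 + N.-1)%N = N by rewrite szL; lia.
have := @normalized_gt_det C N.-1 1 L (fun=> x) sL szN (fun _ _ => x0).
rewrite sN /vandermonde !big_ord1 addn0 big_pred0 => [|i]; last by case: i => -[].
rewrite mul1r det_mx11 mxE => ->; rewrite mulrC; congr (_ * _).
by apply: eq_bigr => j _; rewrite expr0 mul1r.
Qed.

Lemma normalized_gt_at1 N (L : seq int) : sorted >%R L -> size L = N ->
  normalized_gt N L (pad1 1 (fun=> 1)) = 1 :> C.
Proof.
move=> sL szL; rewrite /normalized_gt (eq_gt_sum _ (v := fun=> 1)).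
  by rewrite divff // gt_sum1_neq0.
by move=> i _; rewrite /pad1; case: ifP.
Qed.

Lemma taylor_sum (z : C) r n (F : nat -> C -> C) (c : nat -> nat -> C) (M : nat -> R) :
  0 < r -> (forall i, (i < n)%N -> taylor z r (F i) (c i) (M i)) ->
  taylor z r (fun x => \sum_(i < n) F i x) (fun j => \sum_(i < n) c i j)
    (\sum_(i < n) M i).
Proof.
move=> r0; elim: n => [|n IHn] Fc.
  have -> : (fun x => \sum_(i < 0) F i x) = fun=> 0 by apply/funext => x; rewrite big_ord0.
  have -> : (fun j => \sum_(i < 0) c i j) = fun j => if j == 0%N then 0 else 0.
    by apply/funext => j; rewrite big_ord0; case: ifP.
  by rewrite big_ord0 -(@modulus0 R); apply: taylor_cst.
have -> : (fun x => \sum_(i < n.+1) F i x) = fun x => \sum_(i < n) F i x + F n x.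
  by apply/funext => x; rewrite big_ord_recr.
have -> : (fun j => \sum_(i < n.+1) c i j) = fun j => \sum_(i < n) c i j + c n j.
  by apply/funext => x; rewrite big_ord_recr.
rewrite big_ord_recr /=; apply: taylorD => //; last exact: Fc.
by apply: IHn => i ni; apply: Fc; apply: ltnW.
Qed.

Lemma disc1_neq0 (h : C) : modulus h < 1 -> 1 + h != 0.
Proof.
move=> h1; rewrite -modulus_gt0.
have := modulus_dist_le 1 (- h); rewrite opprK modulusN modulus1.
by apply: lt_le_trans; rewrite subr_gt0.
Qed.

Lemma gbinomSl (l : int) j :
  gbinom (l + 1) j = gbinom l j + (if j is j'.+1 then gbinom l j' else 0) :> C.
Proof.
case: j => [|j]; first by rewrite !gbinom0 addr0.
by rewrite [RHS]addrC -(gbinom_pascal l j) subrK.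
Qed.

Lemma taylor_mulX r (f : C -> C) c M : 0 < r -> taylor 1 r f c M ->
  taylor 1 r (fun x => x * f x)
    (fun j => c j + (if j is j'.+1 then c j' else 0)) ((1 + r) * M).
Proof.
move=> r0 tf; have tX := @taylor_affine R 1 r 0 1 r0.
have := taylorM r0 tX tf; rewrite add0r mulr1 modulus1 mul1r.
set d := (X in taylor _ _ _ X _) => h.
have -> : (fun j => c j + (if j is j'.+1 then c j' else 0)) = d.
  apply/funext => j; rewrite /d; case: j => [|j].
    by rewrite big_ord1 /= subn0 mul1r addr0.
  rewrite 2!big_ord_recl big1 => [|i _]; last by rewrite /= mul0r.
  by rewrite /= !mul1r addr0 subn0 subn1.
by apply: eq_taylor h => h _; rewrite add0r mul1r.
Qed.

(** The binomial series. For negative exponents the coefficients of x^(-n-1) come from those of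
    x^(-n): multiplication by x acts on coefficients as Pascal's rule does, and expansions are
    unique. *)
Lemma taylor_expz r (l : int) : 0 < r < 1 ->
  exists M, taylor 1 r (fun x : C => x ^ l) (gbinom l) M.
Proof.
move=> /andP[r0 r1].
have base : exists M, taylor 1 r (fun x : C => x ^ 0) (gbinom 0) M.
  exists (modulus (1 : C)); have := @taylor_cst R 1 r 1 r0.
  have -> : gbinom 0 = fun j => if j == 0%N then 1 else 0 :> C.
    apply/funext => j; case: j => [|j]; first by rewrite gbinom0.
    by rewrite /gbinom big_ord_recl subrr !mul0r.
  exact: eq_taylor.
have pos n : exists M, taylor 1 r (fun x : C => x ^ n%:Z) (gbinom n%:Z) M.
  elim: n => [//|n [M tn]]; exists ((1 + r) * M).
  have := taylor_mulX r0 tn.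
  have -> : (fun j => gbinom n%:Z j + (if j is j'.+1 then gbinom n%:Z j' else 0)) =
      gbinom n.+1%:Z :> (nat -> C).
    by apply/funext => j; rewrite -gbinomSl -addn1 PoszD.
  apply: eq_taylor => h hr; rewrite -addn1 PoszD expfzDr ?expr1z ?[_ * (1 + h)]mulrC //.
  by apply: disc1_neq0; apply: lt_trans r1.
have neg n : exists M, taylor 1 r (fun x : C => x ^ (- n%:Z)) (gbinom (- n%:Z)) M.
  elim: n => [|n [M tn]]; first by rewrite oppr0.
  have r1' : modulus (1 : C) * r < modulus (0 + 1 * 1 : C).
    by rewrite mulr1 add0r modulus1 mul1r.
  have tV := taylor_inv r0 r1'; have := taylorM r0 tV tn.
  set d := (X in taylor _ _ _ X _); set K := (X in taylor _ _ _ _ X) => td0.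
  have nz h : modulus h < r -> 1 + h != 0 :> C.
    by move=> hr; apply: disc1_neq0; apply: lt_trans r1.
  have nE : - n%:Z = - n.+1%:Z + 1 by lia.
  have td : taylor 1 r (fun x : C => x ^ (- n.+1%:Z)) d K.
    apply: eq_taylor td0 => h hr.
    by rewrite add0r mul1r nE expfzDr ?nz // expr1z mulrC mulfK ?nz.
  exists K; have tdX := taylor_mulX r0 td.
  have dE : (fun j => d j + (if j is j'.+1 then d j' else 0)) =1 gbinom (- n%:Z).
    apply: (taylor_unique r0 r0 tdX tn) => h hr.
    by rewrite nE [in RHS]expfzDr ?nz // expr1z mulrC.
  have -> // : gbinom (- n.+1%:Z) = d.
  apply/funext; elim=> [|j IHj].
    by have := dE 0%N; rewrite /= addr0 !gbinom0.
  have := dE j.+1; rewrite nE gbinomSl -IHj => /addIr ->//.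
by case: l => n; [exact: pos | rewrite NegzE; exact: neg].
Qed.

(** The Taylor coefficient of order m of S_N at 1, obtained from [normalized_gt1] by expanding x^l
    in binomial coefficients and cancelling (x - 1)^(N-1). *)
Definition schur_coef N (L : seq int) (m : nat) : C :=
  (N.-1)`!%:R * divdiff N L (fun l => gbinom l (N.-1 + m)).

Lemma schur_coef0 N (L : seq int) : sorted >%R L -> size L = N -> (0 < N)%N ->
  schur_coef N L 0 = 1.
Proof.
move=> sL szL N0; rewrite /schur_coef addn0.
have -> : divdiff N L (fun l => gbinom l N.-1) =
    divdiff N L (fun l => l%:~R ^+ 0 * gbinom l N.-1) :> C.
  by apply: eq_bigr => j _; rewrite expr0 mul1r.
by rewrite divdiff_pow_gbinom ?addn0 ?prednK // eqxx divff // fact_neq0.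
Qed.

Lemma schur_taylor_sum N (L : seq int) r h : sorted >%R L -> size L = N -> (0 < N)%N ->
  0 < r < 1 -> modulus h < r -> exists K, forall m,
  modulus (normalized_gt N L (pad1 1 (fun=> 1 + h)) - psum (schur_coef N L) h m) <=
    K * (modulus h / r) ^+ m.
Proof.
move=> sL szL N0 r01 hr; have /andP[r0 r1] := r01.
have h1 : 1 + h != 0 by apply: disc1_neq0; apply: lt_trans r1.
(* At h = 0 the factor h^(N-1) cannot be cancelled; the value there is 1 by normalization. *)
have [->|hn0] := eqVneq h 0.
  exists 1 => -[|m]; rewrite addr0 normalized_gt_at1 // mul1r.
    by rewrite /psum big_ord0 subr0 expr0 modulus1.
  rewrite /psum big_ord_recl big1 => [|i _]; last by rewrite exprS mul0r mulr0.
  by rewrite expr0 schur_coef0 // !mulr1 addr0 subrr modulus0 mul0r exprn_ge0.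
pose M j := projT1 (cid (@taylor_expz r L`_j r01)).
have tM j : taylor 1 r (fun x : C => x ^ L`_j) (gbinom L`_j) (M j).
  exact: (projT2 (cid (@taylor_expz r L`_j r01))).
have := taylor_sum (n := N) r0 (fun j _ => taylorZ (node_prod N L j)^-1 (tM j)).
set b := (X in taylor _ _ _ X _); case=> _ /(_ h hr) [K hK].
have bE n : b n = divdiff N L (fun l => gbinom l n).
  by apply: eq_bigr => j _; rewrite mulrC.
have b0 n : (n < N.-1)%N -> b n = 0.
  move=> nN; rewrite bE.
  have -> : divdiff N L (fun l => gbinom l n) =
      divdiff N L (fun l => l%:~R ^+ 0 * gbinom l n) :> C.
    by apply: eq_bigr => j _; rewrite expr0 mul1r.
  rewrite divdiff_pow_gbinom // ?addn0; last by lia.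
  by case: eqP => // nE; lia.
have psumE m : (N.-1)`!%:R * psum b h (N.-1 + m) =
    h ^+ N.-1 * psum (schur_coef N L) h m.
  rewrite /psum big_split_ord /= big1 ?add0r => [|j _]; last by rewrite b0 ?mul0r.
  rewrite !mulr_sumr; apply: eq_bigr => j _; rewrite /= bE /schur_coef exprD; ring.
have E := normalized_gt1 sL szL N0 h1.
have FE : \sum_(j < N) (node_prod N L j)^-1 * (1 + h) ^ L`_j =
    divdiff N L (fun m => (1 + h) ^ m) by apply: eq_bigr => j _; rewrite mulrC.
have hN0 : 0 < modulus (h ^+ N.-1) by rewrite modulus_gt0 expf_neq0.
set q := modulus h / r.
exists ((N.-1)`!%:R * K * q ^+ N.-1 / modulus (h ^+ N.-1)) => m.
rewrite mulrAC ler_pdivlMr // -modulusM mulrBl [psum _ _ _ * _]mulrC -psumE.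
move: E; have -> : 1 + h - 1 = h by ring.
move=> ->; rewrite -FE -mulrBr modulusM modulus_nat.
rewrite -[_ * q ^+ m]mulrA -exprD -mulrA ler_wpM2l ?ler0n //; exact: hK.
Qed.

Definition pf_weight N (L : seq int) j : C :=
  (\prod_(i < N) (node L j - i%:R)) / node_prod N L j.

Definition pf_point N (L : seq int) j : C := node L j - N%:R.

(* The partial fraction expansion of prod_i (u + N - i) / (u + N - L_i) in    *)
(* the variable s = 1 / u.                                                    *)
Definition pf_sum N (L : seq int) (s : C) : C :=
  1 + \sum_(j < N) pf_weight N L j * (s * (1 - pf_point N L j * s)^-1).

Definition pf_moment N L n : C :=
  \sum_(j < N) pf_weight N L j * pf_point N L j ^+ n.

Definition pf_fmoment N L n m : C := \sum_(j < N) pf_weight N L j *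
  (pf_point N L j ^+ n * \prod_(i < m) (pf_point N L j - i%:R)).

Definition pf_coef N L m : C :=
  if m is m'.+1 then pf_moment N L m' / N%:R ^+ m else 1.

(** The numerator and the denominator are monic of degree N, so their difference has lower degree
    and is recovered by Lagrange interpolation at the zeros of the denominator. *)
Lemma pf_sum_shift N L (t : C) : sorted >%R L -> size L = N ->
  t - N%:R != 0 -> (forall j, (j < N)%N -> t != node L j) ->
  (\prod_(i < N) (t - i%:R)) / \prod_(j < N) (t - node L j) =
  pf_sum N L (t - N%:R)^-1.
Proof.
move=> sL szL tN tL.
have tL0 j : (j < N)%N -> t - node L j != 0 by move=> jN; rewrite subr_eq0 tL.
have pL0 : \prod_(j < N) (t - node L j) != 0.
  by apply/prodf_neq0 => j _; apply: tL0.
pose p : {poly C} := \prod_(i < N) ('X - i%:R%:P).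
pose q : {poly C} := \prod_(j < N) ('X - (node L j)%:P).
have szp : size p = N.+1 by rewrite size_prod_XsubC /index_enum -enumT size_enum_ord.
have szq : size q = N.+1 by rewrite size_prod_XsubC /index_enum -enumT size_enum_ord.
have pE x : p.[x] = \prod_(i < N) (x - i%:R).
  by rewrite horner_prod; apply: eq_bigr => i _; rewrite !hornerE.
have qE x : q.[x] = \prod_(j < N) (x - node L j).
  by rewrite horner_prod; apply: eq_bigr => i _; rewrite !hornerE.
have szpq : (size (p - q)%R <= N)%N.
  apply/leq_sizeP => i; rewrite leq_eqVlt => /orP[/eqP<-|Ni].
    have /monicP := monic_prod_XsubC (index_enum 'I_N) xpredT (fun i : 'I_N => i%:R : C).
    have /monicP := monic_prod_XsubC (index_enum 'I_N) xpredT (fun i : 'I_N => node L i : C).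
    by rewrite !lead_coefE -/p -/q szp szq coefB /= => -> ->; rewrite subrr.
  by rewrite coefB !nth_default ?szp ?szq ?subrr.
have := lagrange_interpolation sL szL szpq.
move/(congr1 (fun r : {poly C} => r.[t])).
rewrite hornerD hornerN pE qE horner_sum => /eqP; rewrite subr_eq => /eqP ->.
rewrite mulrDl divff // addrC; congr (_ + _); rewrite mulr_suml.
apply: eq_bigr => j _; rewrite hornerZ node_polyE hornerD hornerN pE qE.
rewrite [X in _ - X](bigD1 j) //= subrr mul0r subr0 -/(pf_weight N L j).
rewrite -mulrA; congr (_ * _); rewrite [X in _ / X](bigD1 j) //=.
have P0 : \prod_(i < N | (i : nat) != j) (t - node L i) != 0.
  by apply/prodf_neq0 => i _; apply: tL0.
rewrite (eq_bigl (fun i : 'I_N => i != j)) in P0 *; last by move=> i; rewrite -val_eqE.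
rewrite invfM mulrCA mulfV // mulr1 -invfM; congr (_^-1).
by rewrite /pf_point mulrBr mulr1 mulrCA divff // mulr1; ring.
Qed.

Lemma fact_shift N m : (0 < N)%N ->
  (N.-1 + m)`!%:R = (N.-1)`!%:R * \prod_(i < m) (N + i)%:R :> C.
Proof.
move=> N0; elim: m => [|m IHm]; first by rewrite addn0 big_ord0 mulr1.
rewrite addnS factS natrM IHm big_ord_recr /= mulrC -mulrA.
by congr (_ * (_ * _%:R)); lia.
Qed.

(** The falling product defining the binomial coefficient of L_j of order N + m splits after N
    factors: the first part is the numerator of [pf_weight], the second is a falling factorial in
    L_j - N. *)
Lemma schur_coef_fmoment N L m : (0 < N)%N ->
  schur_coef N L m.+1 * \prod_(i < m.+1) (N + i)%:R = pf_fmoment N L 0 m.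
Proof.
move=> N0; rewrite /schur_coef mulrAC -fact_shift // mulr_sumr.
apply: eq_bigr => j _; rewrite /gbinom; set f := (_ `!)%:R.
have f0 : f != 0 by apply: fact_neq0.
have -> : (N.-1 + m.+1)%N = (N + m)%N by lia.
rewrite big_split_ord /= /pf_weight expr0 mul1r /node.
have -> : \prod_(i < m) ((L`_j)%:~R - (N + i)%:R) =
    \prod_(i < m) (pf_point N L j - i%:R).
  by apply: eq_bigr => i _; rewrite natrD opprD addrA.
by move: (node_prod N L j)^-1 => p; field.
Qed.

Lemma pf_fmomentS N L n m :
  pf_fmoment N L n m.+1 = pf_fmoment N L n.+1 m - m%:R * pf_fmoment N L n m.
Proof.
rewrite /pf_fmoment mulr_sumr -sumrB; apply: eq_bigr => j _.
by rewrite big_ord_recr /= exprS; ring.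
Qed.

Lemma pf_fmoment0 N L n : pf_fmoment N L n 0 = pf_moment N L n.
Proof. by apply: eq_bigr => j _; rewrite big_ord0 mulr1. Qed.

Section MomentBounds.
Variables (N : nat) (L : seq int) (K Y : R).
Hypotheses (K0 : 0 <= K) (Y0 : 0 <= Y)
  (bound : forall n, modulus (pf_moment N L n) <= K * Y ^+ n).

(** Only the moments are controlled, not the individual terms, so the estimate is propagated through
    the recursion [pf_fmomentS]. *)
Lemma pf_fmoment_bound n m :
  modulus (pf_fmoment N L n m) <= K * Y ^+ n * \prod_(i < m) (Y + i%:R).
Proof.
elim: m n => [|m IHm] n; first by rewrite pf_fmoment0 big_ord0 mulr1.
rewrite pf_fmomentS; apply: le_trans (modulus_sub_le _ _) _.
have h := ler_wpM2l (ler0n R m) (IHm n); rewrite modulusM modulus_nat.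
apply: le_trans (lerD (IHm n.+1) h) _.
rewrite big_ord_recr /= exprS le_eqVlt; apply/orP; left; apply/eqP; ring.
Qed.

Lemma pf_fmoment_approx n m :
  modulus (pf_fmoment N L n m - pf_moment N L (n + m)) <=
  K * Y ^+ n * (\prod_(i < m) (Y + i%:R) - Y ^+ m).
Proof.
elim: m n => [|m IHm] n.
  by rewrite pf_fmoment0 addn0 subrr modulus0 big_ord0 expr0 subrr mulr0.
rewrite pf_fmomentS addrAC; apply: le_trans (modulus_sub_le _ _) _.
have h1 := IHm n.+1; rewrite addSnnS in h1.
have h2 := ler_wpM2l (ler0n R m) (pf_fmoment_bound n m).
rewrite modulusM modulus_nat; apply: le_trans (lerD h1 h2) _.
rewrite big_ord_recr /= !exprS le_eqVlt; apply/orP; left; apply/eqP; ring.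
Qed.

End MomentBounds.

End OneVariable.

(** * Comparison of Taylor coefficients at 1 *)

Section SchurVersusProduct.
Context {R : realType}.
Local Notation C := (Cplx R).

Lemma prod_const_ord (K : comNzRingType) n (a : K) : \prod_(i < n) a = a ^+ n.
Proof. by rewrite prodr_const card_ord. Qed.

Lemma taylor_pf_sum N (L : seq int) : (0 < N)%N ->
  exists r M, 0 < r /\
    taylor 1 r (fun x : C => pf_sum N L ((x - 1) / N%:R)) (pf_coef N L) M.
Proof.
move=> N0; have NR : 0 < N%:R :> R by rewrite ltr0n.
have NC : N%:R != 0 :> C by rewrite pnatr_eq0 -lt0n.
pose y j := pf_point N L j : C.
pose T : R := 1 + \sum_(j < N) modulus (y j).
have T0 : 0 < T by rewrite ltr_pwDl // sumr_ge0 // => j _; apply: modulus_ge0.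
pose r := N%:R / T; have r0 : 0 < r by rewrite divr_gt0.
have yr j : (j < N)%N -> modulus (- (y j / N%:R)) * r < 1.
  move=> jN; rewrite modulusN modulusM modulusV modulus_nat mulrA divfK ?gt_eqF //.
  rewrite ltr_pdivrMr // mul1r /T (bigD1 (Ordinal jN)) //= addrCA ltrDl.
  by rewrite ltr_pwDl // sumr_ge0 // => i _; apply: modulus_ge0.
have tF j : (j < N)%N -> exists M, taylor 1 r
    (fun x : C => pf_weight N L j * ((x - 1) / N%:R * (1 - y j * ((x - 1) / N%:R))^-1))
    (fun n => if n is n'.+1 then pf_weight N L j * y j ^+ n' / N%:R ^+ n else 0) M.
  move=> jN; have t1 := @taylor_affine R 1 r (- N%:R^-1) N%:R^-1 r0.
  have E1 : 1 + y j / N%:R + - (y j / N%:R) * 1 = 1 :> C by ring.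
  have yr1 : modulus (- (y j / N%:R)) * r < modulus (1 + y j / N%:R + - (y j / N%:R) * 1).
    by rewrite E1 modulus1 yr.
  have t2 := taylor_inv r0 yr1.
  have := taylorZ (pf_weight N L j) (taylorM r0 t1 t2).
  set d := (X in taylor _ _ _ X _); set M := (X in taylor _ _ _ _ X) => t3; exists M.
  have -> : (fun n => if n is n'.+1 then pf_weight N L j * y j ^+ n' / N%:R ^+ n else 0) = d.
    apply/funext => -[|n]; rewrite /d.
      by rewrite big_ord1 /= mulr1 addNr mul0r mulr0.
    rewrite 2!big_ord_recl big1 => [|i _]; last by rewrite /= mul0r.
    rewrite /= addr0 mulr1 addNr mul0r add0r subSS subn0 E1 !expr1n divr1 opprK.
    by rewrite -mulrA exprMn exprVn exprS invfM; congr (_ * _); ring.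
  apply: eq_taylor t3 => h _; congr (_ * (_ * _^-1)); last by ring.
  by ring.
pose M j := if pselect (j < N)%N is left jN then projT1 (cid (tF j jN)) else 0.
have tM j : (j < N)%N -> taylor 1 r
    (fun x : C => pf_weight N L j * ((x - 1) / N%:R * (1 - y j * ((x - 1) / N%:R))^-1))
    (fun n => if n is n'.+1 then pf_weight N L j * y j ^+ n' / N%:R ^+ n else 0) (M j).
  by move=> jN; rewrite /M; case: pselect => // jN'; apply: projT2 (cid _).
have := taylorD r0 (taylor_cst 1 (1 : C) r0) (taylor_sum r0 tM).
set d := (X in taylor _ _ _ X _); set K := (X in taylor _ _ _ _ X) => td.
exists r, K; split=> //; have -> // : pf_coef N L = d.
apply/funext => -[|n]; rewrite /d /=; first by rewrite big1 ?addr0.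
by rewrite add0r mulr_suml.
Qed.

Section CoefficientComparison.
Variables (N : nat) (L : seq int) (r M delta : R) (G : C -> C) (g : nat -> C).
Hypotheses (N0 : (0 < N)%N) (sL : sorted >%R L) (szL : size L = N)
  (r01 : 0 < r < 1) (tG : taylor 1 r G g M) (d0 : 0 < delta)
  (GE : forall h, modulus h < delta -> G (1 + h) = pf_sum N L (h / N%:R)).

Let r0 : 0 < r. Proof. by case/andP: r01. Qed.
Let NR : 0 < N%:R :> R. Proof. by rewrite ltr0n. Qed.
Let M0 : 0 <= M. Proof. exact: taylor_ge0 tG. Qed.

(** The expansion of the partial fractions converges a priori only on a disc depending on N.
    Uniqueness identifies its coefficients with those of [G], from which they inherit the bound with
    constants [r] and [M]. *)
Lemma pf_coefE : g =1 pf_coef N L.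
Proof.
have [r' [M' [r0' tP]]] := taylor_pf_sum L N0.
pose s := Num.min r r'; have s0 : 0 < s by rewrite lt_min r0 r0'.
have sr : s <= r by rewrite ge_min lexx.
have sr' : s <= r' by rewrite ge_min lexx orbT.
apply: (taylor_unique s0 d0 (taylor_shrink s0 sr tG) (taylor_shrink s0 sr' tP)).
by move=> h hd; rewrite GE // addrAC subrr add0r.
Qed.

Lemma pf_coef_bound m : modulus (pf_coef N L m) <= M / r ^+ m.
Proof. by rewrite -pf_coefE ler_pdivlMr ?exprn_gt0 //; apply: taylor_coef tG. Qed.

Lemma pf_moment_bound n :
  modulus (pf_moment N L n : C) <= M * (N%:R / r) * (N%:R / r) ^+ n.
Proof.
have := pf_coef_bound n.+1; rewrite /pf_coef modulusM modulusV modulusX modulus_nat.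
rewrite ler_pdivrMr ?exprn_gt0 //; move=> h; apply: le_trans h _.
rewrite -mulrA -exprS expr_div_n le_eqVlt; apply/orP; left; apply/eqP; ring.
Qed.

Let prodN m : 0 < \prod_(i < m) (N + i)%:R :> R.
Proof. by apply: prodr_gt0 => i _; rewrite ltr0n addn_gt0 N0. Qed.

Let Y0 : 0 <= N%:R / r. Proof. by rewrite divr_ge0 // ltW. Qed.
Let K0 : 0 <= M * (N%:R / r). Proof. by rewrite mulr_ge0. Qed.

Lemma schur_coefE m :
  schur_coef N L m.+1 = pf_fmoment N L 0 m / (\prod_(i < m.+1) (N + i)%:R) :> C.
Proof.
rewrite -schur_coef_fmoment // mulfK //; apply/prodf_neq0 => i _.
by rewrite pnatr_eq0 -lt0n addn_gt0 N0.
Qed.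

Lemma modulus_prod_nat m : modulus (\prod_(i < m) (N + i)%:R : C) =
  \prod_(i < m) (N + i)%:R.
Proof. by rewrite modulus_prod; apply: eq_bigr => i _; rewrite modulus_nat. Qed.

(** Factor by factor, N/r + i <= (N + i + 1)/r because r < 1, so the rising products in numerator
    and denominator compensate up to powers of r. *)
Lemma schur_coef_bound m : modulus (schur_coef N L m) <= M / r ^+ m.
Proof.
case: m => [|m]; first by have := pf_coef_bound 0; rewrite schur_coef0.
rewrite schur_coefE modulusM modulusV modulus_prod_nat.
have h := pf_fmoment_bound pf_moment_bound 0 m; rewrite expr0 mulr1 in h.
rewrite ler_pdivrMr //; apply: le_trans h _.
have -> : M / r ^+ m.+1 * \prod_(i < m.+1) (N + i)%:R =
    M * (N%:R / r) * (\prod_(i < m) ((N + i.+1)%:R / r)).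
  rewrite big_ord_recl addn0 exprS big_split /= prodr_const card_ord exprVn.
  rewrite invfM; under [in LHS]eq_bigr do rewrite /bump add1n; ring.
rewrite ler_wpM2l //; apply: ler_prod => i _; apply/andP; split.
  by rewrite addr_ge0.
rewrite natrD -natr1 mulrDl lerD2l; case/andP: r01 => _ r1.
rewrite ler_pdivlMr //; apply: le_trans (_ : i%:R <= _); last by rewrite lerDl.
by rewrite ler_piMr // ltW.
Qed.

(** The first term accounts for replacing the factorial moment by the ordinary one, the second for
    replacing N (N+1) ... (N+m) by N^(m+1). *)
Definition coef_error (m N' : nat) : R :=
  M / r * (\prod_(i < m) (r^-1 + i%:R * N'%:R^-1) - r^-1 ^+ m) +
  M / r ^+ m.+1 * (1 - \prod_(i < m.+1) (1 + i%:R * N'%:R^-1)^-1).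

Lemma schur_coef_approx m :
  modulus (schur_coef N L m.+1 - pf_coef N L m.+1) <= coef_error m N.
Proof.
set P : R := \prod_(i < m.+1) (N + i)%:R.
have NR0 : N%:R != 0 :> R by rewrite gt_eqF.
have NC : N%:R != 0 :> C by rewrite pnatr_eq0 -lt0n.
have PE : \prod_(i < m.+1) (1 + i%:R * N%:R^-1)^-1 = N%:R ^+ m.+1 / P.
  rewrite /P -prodfV -prod_const_ord -big_split.
  apply: eq_bigr => i _ /=; rewrite natrD -[RHS]invf_div; congr (_^-1).
  by rewrite mulrDl divff.
have P0 : 0 < P by apply: prodN.
have PC0 : \prod_(i < m.+1) (N + i)%:R != 0 :> C.
  by apply/prodf_neq0 => i _; rewrite pnatr_eq0 -lt0n addn_gt0 N0.
have NP : N%:R ^+ m.+1 <= P.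
  rewrite -prod_const_ord; apply: ler_prod => i _.
  by rewrite ler0n ler_nat leq_addr.
have -> : schur_coef N L m.+1 - pf_coef N L m.+1 =
    (pf_fmoment N L 0 m - pf_moment N L (0 + m)) / (\prod_(i < m.+1) (N + i)%:R) +
    pf_coef N L m.+1 * (N%:R ^+ m.+1 / (\prod_(i < m.+1) (N + i)%:R) - 1) :> C.
  rewrite schur_coefE /pf_coef add0n; field.
  by rewrite PC0 expf_neq0.
apply: le_trans (modulusD _ _) _; apply: lerD.
  rewrite modulusM modulusV modulus_prod_nat -/P ler_pdivrMr //.
  have h := pf_fmoment_approx pf_moment_bound 0 m; rewrite expr0 mulr1 in h.
  apply: le_trans h _.
  have -> : M * (N%:R / r) * (\prod_(i < m) (N%:R / r + i%:R) - (N%:R / r) ^+ m) =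
      M / r * (\prod_(i < m) (r^-1 + i%:R * N%:R^-1) - r^-1 ^+ m) * N%:R ^+ m.+1.
    have -> : \prod_(i < m) (N%:R / r + i%:R) =
        N%:R ^+ m * \prod_(i < m) (r^-1 + i%:R * N%:R^-1).
      rewrite -prod_const_ord -big_split.
      apply: eq_bigr => i _ /=; rewrite mulrDr mulrCA divff // mulr1 //.
    by rewrite expr_div_n exprVn exprS; ring.
  rewrite ler_wpM2l // mulr_ge0 ?divr_ge0 ?(ltW r0) // subr_ge0.
  rewrite -prod_const_ord; apply: ler_prod => i _.
  by rewrite invr_ge0 (ltW r0) lerDl divr_ge0.
rewrite modulusM; apply: ler_pM; rewrite ?modulus_ge0 ?pf_coef_bound //.
have -> : N%:R ^+ m.+1 / (\prod_(i < m.+1) (N + i)%:R) - 1 =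
    of_real (N%:R ^+ m.+1 / P - 1).
  rewrite rmorphB rmorphM /= of_realV rmorphXn rmorph_nat rmorph1 /P rmorph_prod.
  by under [in RHS]eq_bigr do rewrite rmorph_nat.
rewrite modulus_of_real PE -normrN opprB ger0_norm // subr_ge0.
by rewrite ler_pdivrMr // mul1r.
Qed.

End CoefficientComparison.

Lemma coef_error_cvg0 (r M : R) m : 0 < r ->
  (coef_error r M m) @ \oo --> (0 : R).
Proof.
move=> r0; have cI i : (fun N => i%:R * (N%:R : R)^-1) @ \oo --> (0 : R).
  by rewrite -[X in _ --> X](mulr0 (i%:R : R)); apply: cvgnZ; apply: cvgn_invn.
rewrite /coef_error.
have -> : (0 : R) = M / r * (r^-1 ^+ m - r^-1 ^+ m) + M / r ^+ m.+1 * (1 - 1).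
  by rewrite !subrr !mulr0 addr0.
apply: cvgD; apply: cvgnZ; apply: cvgB; try exact: cvg_cst.
  rewrite -(prod_const_ord m); apply: cvgn_prod => i _.
  by rewrite -[X in _ --> X]addr0; apply: cvgD; [exact: cvg_cst | exact: cI].
rewrite -[X in _ --> X](_ : \prod_(i < m.+1) (1 + 0 : R)^-1 = 1); last first.
  by rewrite big1 // => i _; rewrite addr0 invr1.
apply: cvgn_prod => i _; apply: cvgnV; first by rewrite addr0 oner_neq0.
by apply: cvgD; [exact: cvg_cst | exact: cI].
Qed.

Section Comparison.
Variables (L : nat -> seq int) (G : nat -> C -> C) (N0 : nat) (r M : R).
Hypotheses (N00 : (0 < N0)%N) (sL : forall N, sorted >%R (L N))
  (szL : forall N, size (L N) = N) (r01 : 0 < r < 1)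
  (tG : forall N, (N0 <= N)%N -> exists g, taylor 1 r (G N) g M)
  (GE : forall N, (N0 <= N)%N -> exists delta : R, 0 < delta /\
     forall h, modulus h < delta -> G N (1 + h) = pf_sum N (L N) (h / N%:R)).

Let r0 : 0 < r. Proof. by case/andP: r01. Qed.
Let r20 : 0 < r / 2. Proof. by rewrite divr_gt0. Qed.

Let S N x : C := normalized_gt N (L N) (pad1 1 (fun=> x)).

(** Halving the radius turns the bounds M / r^j on single coefficients into a geometric series of
    sum at most 2 M. *)
Lemma taylor_schur N : (N0 <= N)%N -> taylor 1 (r / 2) (S N) (schur_coef N (L N)) (2 * M).
Proof.
move=> N0N; have [g tg] := tG N0N; have [delta [d0 Gd]] := GE N0N.
have Npos : (0 < N)%N by apply: leq_trans N0N.
have M0 := taylor_ge0 tg.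
split=> [n|h hr]; last first.
  apply: schur_taylor_sum => //; rewrite r20 /=; case/andP: r01 => _ r1; lra.
apply: (@le_trans _ _ (\sum_(j < n) M * 2^-1 ^+ j)).
  apply: ler_sum => j _; rewrite expr_div_n exprVn.
  have := schur_coef_bound Npos (sL N) (szL N) r01 tg d0 Gd j.
  rewrite ler_pdivlMr ?exprn_gt0 // => h.
  by rewrite mulrA ler_wpM2r // invr_ge0 exprn_ge0.
rewrite -mulr_sumr mulrC ler_wpM2r //.
apply: le_trans (sum_geometric n _) _; first by apply/andP; split; lra.
by rewrite le_eqVlt; apply/orP; left; apply/eqP; field.
Qed.

Lemma schur_minus_product_vanishing :
  locally_vanishing (fun N x => S N x - G N x) 1.
Proof.
exists (r / 2); split=> // h hr.
have [c tc] : exists c : nat -> nat -> C, forall N, (N0 <= N)%N ->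
    taylor 1 (r / 2) (fun x => S N x + -1 * G N x) (c N) (2 * M + modulus (-1 : C) * M) /\
    c N =1 (fun j => schur_coef N (L N) j - pf_coef N (L N) j).
  exists (fun N j => schur_coef N (L N) j + -1 * pf_coef N (L N) j) => N N0N.
  split; last by move=> j; rewrite mulN1r.
  have [g tg] := tG N0N; have [delta [d0 Gd]] := GE N0N.
  have Npos : (0 < N)%N by apply: leq_trans N0N.
  have gE : g = pf_coef N (L N) by apply/funext; apply: (pf_coefE Npos r01 tg d0 Gd).
  rewrite gE in tg; apply: taylorD => //; first exact: taylor_schur.
  apply: taylorZ; apply: taylor_shrink tg => //.
  by rewrite ler_pdivrMr // ler_peMr ?ler1n // ltW.
have := @taylor_cvg0 R (fun N x => S N x + -1 * G N x) (r / 2) _ N0 1 c r20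
  (fun N N0N => (tc N N0N).1) h _ hr.
under eq_fun do rewrite mulN1r; apply=> -[|m].
  apply: (cvgn_eq_near (N0 := N0) (u := fun=> 0)); last exact: cvgn_cst.
  by move=> N N0N; rewrite (tc N N0N).2 schur_coef0 ?subrr //; apply: leq_trans N0N.
apply/cvgn_CplxE => e e0.
have /cvg_realP/(_ e e0)[N1 hN1] := @coef_error_cvg0 r M m r0.
exists (maxn N0 N1) => N; rewrite geq_max => /andP[N0N N1N].
have [g tg] := tG N0N; have [delta [d0 Gd]] := GE N0N.
have Npos : (0 < N)%N by apply: leq_trans N0N.
have := schur_coef_approx Npos r01 tg d0 Gd m.
rewrite -((tc N N0N).2 m.+1) => /le_trans; apply.
by have := hN1 N N1N; rewrite subr0; apply: le_trans; apply: ler_norm.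
Qed.

End Comparison.
End SchurVersusProduct.

(** * Products over Frobenius coordinates *)

Section FrobeniusCoordinates.
Context {K : numFieldType}.

Lemma ltn_count_iota (P : pred nat) n i : (forall j, P j.+1 -> P j) ->
  (i < count P (iota 0 n))%N = (i < n)%N && P i.
Proof.
move=> Pdec; have Ple a b : (a <= b)%N -> P b -> P a.
  move=> /subnK <-; elim: (b - a)%N => // k IHk /Pdec; exact: IHk.
elim: n => [//|n IHn]; rewrite -[in iota 0 _]addn1 iotaD count_cat /= addn0 add0n.
case Pn: (P n); last first.
  by rewrite addn0 IHn ltnS; case: (ltngtP i n) => // ->; rewrite Pn.
have -> : count P (iota 0 n) = n.
  rewrite -[RHS](size_iota 0); apply/eqP; rewrite -all_count; apply/allP => j.
  by rewrite mem_iota add0n => jn; apply: Ple Pn; apply: ltnW.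
rewrite addn1; case: ltnP => //=; rewrite ltnS => i_n.
by rewrite (Ple _ _ i_n Pn).
Qed.

Section Diagram.
Variable mu : seq nat.
Hypothesis mu_sorted : sorted geq mu.

Lemma row_length_decr i : (row_length mu i.+1 <= row_length mu i)%N.
Proof.
rewrite /row_length; have [imu|] := ltnP i.+1 (size mu); last by move/(nth_default _)->.
by have /(sortedP 0%N)/(_ i imu) := mu_sorted.
Qed.

Lemma ltn_col_length i j : (i < col_length mu j)%N = (j < row_length mu i)%N.
Proof.
have -> : col_length mu j = count (fun i => (j < row_length mu i)%N) (iota 0 (size mu)).
  by rewrite /col_length -{1}(mkseq_nth 0%N mu) /mkseq count_map.
rewrite ltn_count_iota => [|a]; last by move/leq_trans; apply; apply: row_length_decr.
by case: ltnP => //= imu; rewrite /row_length nth_default.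
Qed.

Lemma ltn_diag_length i : (i < diag_length mu)%N = (i < row_length mu i)%N.
Proof.
rewrite /diag_length ltn_count_iota => [|a].
  by case: ltnP => //= imu; rewrite /row_length nth_default.
by move=> h; apply: leq_trans (row_length_decr a); apply: ltnW.
Qed.

Lemma diag_length_le_size : (diag_length mu <= size mu)%N.
Proof. by rewrite /diag_length -{2}(size_iota 0 (size mu)) count_size. Qed.

Lemma col_length_le_size j : (col_length mu j <= size mu)%N.
Proof. exact: count_size. Qed.

Lemma telescope_prod (g : nat -> K) a b : (a <= b)%N ->
  (forall j, (a <= j <= b)%N -> g j != 0) ->
  \prod_(a <= j < b) (g j / g j.+1) = g a / g b.
Proof.
move=> /subnK <-; elim: (b - a)%N => [|k IHk] g0.
  by rewrite big_geq // divff // g0 ?leqnn.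
rewrite addSn big_nat_recr ?leq_addl //= IHk => [|j /andP[aj jk]]; last first.
  by apply: g0; rewrite aj leqW.
by rewrite mulrA divfK // g0 // leq_addl leqnSn.
Qed.

Lemma prod_ord_range (F : nat -> K) a b n : (b <= n)%N ->
  \prod_(i < n | (a <= i)%N && (i < b)%N) F i = \prod_(a <= i < b) F i.
Proof.
move=> bn; rewrite [RHS](big_nat_widen _ _ n) // (big_nat_widenl a 0) // big_mkord.
by apply: eq_bigl => i; rewrite /= andbC.
Qed.

(* Both sides are the product of (u - c + 1) / (u - c) over the boxes of mu,  *)
(* c being the content of the box: row by row on the left, and by principal   *)
(* hooks on the right.                                                        *)
Lemma frobenius_product n (u : K) : (size mu <= n)%N ->
  (forall z : int, (`|z| <= n + row_length mu 0)%N -> u + z%:~R != 0) ->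
  \prod_(i < n) ((u + i.+1%:R) / (u + i.+1%:R - (row_length mu i)%:R)) =
  \prod_(i < diag_length mu)
    ((u + (col_length mu i)%:R - i%:R) / (u + i.+1%:R - (row_length mu i)%:R)).
Proof.
move=> mun u0.
have row0 i : (row_length mu i <= row_length mu 0)%N.
  by elim: i => // i; apply: leq_trans (row_length_decr i).
have uN0 (a b : nat) : (a <= n)%N -> (b <= row_length mu 0 + n)%N -> (b - a <= row_length mu 0 + n)%N ->
    u + a%:R - b%:R != 0.
  move=> an br ba; have -> : u + a%:R - b%:R = u + (a%:Z - b%:Z)%:~R by rewrite rmorphB addrA.
  by apply: u0; lia.
(* The factor of the box (i, j), of content j - i. Only boxes strictly below the diagonal are
   regrouped, from rows ([E1]) into columns ([E2]); in each row the boxes on or right of the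
   diagonal telescope at once to the last factor of [E3]. *)
pose phi (i j : nat) : K := (u + i.+1%:R - j%:R) / (u + i%:R - j%:R).
pose m i := minn i (row_length mu i).
have E1 (i : 'I_n) : \prod_(j < n | (j < i)%N && (j < row_length mu i)%N) phi i j =
    (u + i.+1%:R) / (u + i.+1%:R - (m i)%:R).
  have i_n := ltn_ord i.
  transitivity (\prod_(0 <= j < m i) phi i j).
    rewrite big_mkord (big_ord_widen_cond n xpredT (fun j => phi i j)).
      by apply: eq_bigl => j; rewrite /m leq_min.
    by rewrite /m geq_min ltnW.
  pose g (j : nat) := u + i.+1%:R - j%:R.
  have -> : (u + i.+1%:R) / (u + i.+1%:R - (m i)%:R) = g 0%N / g (m i) by rewrite /g subr0.
  rewrite -telescope_prod //.
    apply: eq_big_nat => j _; rewrite /phi /g; congr (_ / _).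
    by rewrite -!natr1; ring.
  move=> j /andP[_ jm]; apply: uN0; rewrite /m in jm; move: jm (row0 i); lia.
have E2 (j : 'I_n) : \prod_(i < n | (j < i)%N && (j < row_length mu i)%N) phi i j =
    if (j < diag_length mu)%N then (u + (col_length mu j)%:R - j%:R) / (u + 1) else 1.
  have colE := ltn_col_length.
  transitivity (\prod_(j.+1 <= i < col_length mu j) phi i j).
    rewrite -(prod_ord_range (fun i => phi i j) _ (n := n)).
      by apply: eq_bigl => i; rewrite colE.
    by apply: leq_trans mun; apply: col_length_le_size.
  rewrite ltn_diag_length -colE; case: ifPn => [jcol|]; last first.
    by rewrite -leqNgt => jc; rewrite big_geq // leqW.
  have coln : (col_length mu j <= n)%N.
    by apply: leq_trans mun; apply: col_length_le_size.
  pose g (i : nat) := u + i%:R - j%:R.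
  have -> : (u + (col_length mu j)%:R - j%:R) / (u + 1) = (g j.+1 / g (col_length mu j))^-1.
    by rewrite invf_div /g -natr1; congr (_ / _); ring.
  rewrite -telescope_prod //; last first.
    move=> i /andP[ji icol]; apply: uN0; [exact: leq_trans coln | | ]; have := ltn_ord j; lia.
  by rewrite -prodfV; apply: eq_bigr => i _; rewrite invf_div.
have [nE|n0] := posnP n.
  have d0 : diag_length mu = 0%N.
    by apply/eqP; rewrite -leqn0 -nE (leq_trans diag_length_le_size).
  by rewrite nE d0 !big_ord0.
have u10 : u + 1 != 0 by apply: (u0 1); lia.
have E3 (i : 'I_n) : (u + i.+1%:R) / (u + i.+1%:R - (row_length mu i)%:R) =
    (\prod_(j < n | (j < i)%N && (j < row_length mu i)%N) phi i j) *
    (if (i < diag_length mu)%N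
     then (u + 1) / (u + i.+1%:R - (row_length mu i)%:R) else 1).
  rewrite E1 ltn_diag_length /m; case: ifPn => [ir|]; last first.
    by rewrite -leqNgt mulr1 => /minn_idPr ->.
  rewrite (minn_idPl (ltnW ir)).
  have -> : u + i.+1%:R - i%:R = u + 1 by rewrite -natr1; ring.
  by rewrite mulrA divfK.
under eq_bigr => i _ do rewrite E3.
rewrite big_split /= (exchange_big_dep xpredT) //=.
under eq_bigr => j _ do rewrite E2.
rewrite -big_split /=.
have dn : (diag_length mu <= n)%N by apply: leq_trans diag_length_le_size _.
rewrite (big_ord_widen n (fun i => (u + (col_length mu i)%:R - i%:R) /
  (u + i.+1%:R - (row_length mu i)%:R)) dn) [RHS]big_mkcond.
apply: eq_bigr => i _; case: ifP => _; last by rewrite mulr1.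
by rewrite mulrA divfK.
Qed.

End Diagram.
End FrobeniusCoordinates.

(** * The two diagrams of a signature *)

Section SignatureDiagrams.

Definition positive_part (s : seq int) : seq nat :=
  [seq `|z|%N | z : int <- s & 0 < z].

Lemma nth_positive_part (s : seq int) i : sorted >=%R s ->
  nth 0%N (positive_part s) i = if 0 < s`_i then absz s`_i else 0%N.
Proof.
elim: s i => [|a s IHs] i ss; first by rewrite /positive_part /= !nth_nil.
have ss' : sorted >=%R s by apply: path_sorted ss.
have [a0|a0] := ltP 0 a.
  by rewrite /positive_part /= a0; case: i => [|i] /=; rewrite ?a0 // IHs.
have sle : all (fun z => z <= 0) (a :: s).
  rewrite /= a0; have /allP sa := order_path_min ge_trans ss.
  by apply/allP => z /sa /= za; apply: le_trans a0.
have -> : positive_part (a :: s) = [::].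
  rewrite /positive_part (eq_in_filter (a2 := pred0)) ?filter_pred0 // => z.
  by move/(allP sle); rewrite leNgt => /negbTE.
rewrite nth_nil; case: ltP => //; have [is_|si] := ltnP i (size (a :: s)).
  by have := all_nthP 0 sle i is_; rewrite ltNge => ->.
by rewrite nth_default // ltxx.
Qed.

Lemma sorted_positive_part (s : seq int) : sorted >=%R s -> sorted geq (positive_part s).
Proof.
move=> ss; apply/(sortedP 0%N) => i _; rewrite /= !nth_positive_part //.
have [is_|si] := ltnP i.+1 (size s); last by rewrite [s`_i.+1]nth_default // ltxx.
have /(sortedP 0)/(_ i is_) /= := ss.
move: (s`_i.+1) (s`_i) => x y xy.
by case: (ltrP 0 x) => // x0; case: (ltrP 0 y) => y0; lia.
Qed.

Lemma size_positive_part (s : seq int) : (size (positive_part s) <= size s)%N.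
Proof. by rewrite size_map size_filter count_size. Qed.

Lemma neg_diagramE N (l : signature N) :
  neg_diagram l = positive_part [seq - z | z <- rev (val l)].
Proof.
rewrite /neg_diagram /positive_part -map_rev -filter_rev filter_map -map_comp.
rewrite (eq_filter (a2 := preim (fun z : int => - z) (fun z => 0 < z))).
  by apply: eq_map => z /=; rewrite abszN.
by move=> z /=; rewrite oppr_gt0.
Qed.

Lemma sorted_opp_rev (s : seq int) : sorted >=%R s -> sorted >=%R [seq - z | z <- rev s].
Proof.
rewrite sorted_map => ss; rewrite rev_sorted; apply: sub_sorted ss => x y /=.
by rewrite lerN2.
Qed.

Lemma row_pos_diagram N (l : signature N) i :
  row_length (pos_diagram l) i = if 0 < (val l)`_i then absz (val l)`_i else 0%N.
Proof. exact: nth_positive_part (valP l). Qed.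

Lemma row_neg_diagram N (l : signature N) i : (i < N)%N ->
  row_length (neg_diagram l) i =
  if (val l)`_(N - i.+1) < 0 then absz (val l)`_(N - i.+1) else 0%N.
Proof.
move=> iN; rewrite neg_diagramE /row_length nth_positive_part; last first.
  exact/sorted_opp_rev/(valP l).
by rewrite (nth_map 0) ?size_rev ?size_tuple // nth_rev ?size_tuple // oppr_gt0 abszN.
Qed.

Lemma sorted_pos_diagram N (l : signature N) : sorted geq (pos_diagram l).
Proof. exact/sorted_positive_part/(valP l). Qed.

Lemma sorted_neg_diagram N (l : signature N) : sorted geq (neg_diagram l).
Proof. rewrite neg_diagramE; exact/sorted_positive_part/sorted_opp_rev/(valP l). Qed.

Lemma size_pos_diagram N (l : signature N) : (size (pos_diagram l) <= N)%N.
Proof. by rewrite -[leqRHS](size_tuple (val l)) size_positive_part. Qed.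

Lemma size_neg_diagram N (l : signature N) : (size (neg_diagram l) <= N)%N.
Proof.
by rewrite neg_diagramE (leq_trans (size_positive_part _)) // size_map size_rev size_tuple.
Qed.

End SignatureDiagrams.

Section FrobeniusFunction.
Context {R : realType}.
Local Notation C := (Cplx R).

(* The numbers (p_i - 1/2) / N and (q_i + 1/2) / N for s = 0, which is used   *)
(* for the positive diagram, and (p_i + 1/2) / N and (q_i - 1/2) / N for      *)
(* s = 1, used for the negative one.                                          *)
Definition frob_a (s N : nat) (mu : seq nat) (i : nat) : R :=
  ((row_length mu i)%:R - i.+1%:R + s%:R) / N%:R.
Definition frob_b (s N : nat) (mu : seq nat) (i : nat) : R :=
  ((col_length mu i)%:R - i%:R - s%:R) / N%:R.

Definition frob_factor (a b : R) (y : C) : C :=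
  (1 + of_real b * y) / (1 - of_real a * y).

Definition frob_fun (s N : nat) (mu : seq nat) (y : C) : C :=
  \prod_(i < diag_length mu) frob_factor (frob_a s N mu i) (frob_b s N mu i) y.

Lemma frob_factor0 a b : frob_factor a b 0 = 1.
Proof. by rewrite /frob_factor !mulr0 addr0 subr0 divr1. Qed.

(** With u = N/h, [pf_sum_shift] gives a product over rows, in each of which at most one of the two
    diagrams is present. [frobenius_product] is applied to the positive diagram at u and, after
    reversing the rows, to the negative one at -(u + N + 1). *)
Lemma frob_fun_near1 N (l : signature N) : (0 < N)%N ->
  exists delta : R, 0 < delta /\ forall h : C, modulus h < delta ->
    frob_fun 0 N (pos_diagram l) h *
    frob_fun 1 N (neg_diagram l) ((1 + h)^-1 - 1) =
    pf_sum N (shifted_parts l) (h / N%:R).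
Proof.
move=> N0; set mu := pos_diagram l; set nu := neg_diagram l.
(* All integer shifts of u that occur are at most T in absolute value; |h| < 1/(T+1) forces |u| > T
   + 1, so no denominator vanishes. *)
pose T := (2 * N + 2 + row_length mu 0 + row_length nu 0)%N.
have NC : N%:R != 0 :> C by rewrite pnatr_eq0 -lt0n.
exists (T.+1%:R^-1); split; first by rewrite invr_gt0.
move=> h hT; have [->|h0] := eqVneq h 0.
  rewrite addr0 invr1 subrr mul0r /frob_fun /pf_sum !big1 ?mulr1 ?addr0 // => i _.
  - by rewrite mul0r mulr0.
  - by rewrite frob_factor0.
  - by rewrite frob_factor0.
pose u := N%:R / h; have u0' : u != 0 by rewrite mulf_neq0 ?invr_eq0.
have uT : T.+1%:R < modulus u.
  rewrite modulusM modulus_nat modulusV.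
  have h0' : 0 < modulus h by rewrite modulus_gt0.
  rewrite ltr_pdivlMr //; apply: (@lt_le_trans _ _ 1).
    by rewrite mulrC -ltr_pdivlMr ?mul1r.
  by rewrite ler1n.
have u0 (z : int) : (`|z| <= T)%N -> u + z%:~R != 0.
  move=> zT; rewrite -modulus_gt0.
  have := modulus_dist_le u (- z%:~R); rewrite opprK modulusN modulus_int.
  apply: lt_le_trans; rewrite subr_gt0; apply: le_lt_trans uT.
  by rewrite ler_nat leqW.
have h1 : 1 + h != 0.
  apply: disc1_neq0; apply: lt_le_trans hT _.
  by rewrite invf_le1 ?ltr0Sn // ler1n.
pose rn (j : 'I_N) := row_length nu (N - j.+1).
have lamE (j : 'I_N) : (val l)`_j = (row_length mu j)%:Z - (rn j)%:Z.
  have jN := ltn_ord j.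
  rewrite /rn row_neg_diagram ?row_pos_diagram; last by lia.
  have -> : (N - (N - j.+1).+1)%N = j by lia.
  move: (_ `_j) => x; by case: (ltrP 0 x) => x0; case: (ltrP x 0) => x1; lia.
have rdec m : sorted geq m -> forall i, (row_length m i <= row_length m 0)%N.
  by move=> sm; elim=> // i; apply: leq_trans (row_length_decr sm i).
have muR := rdec mu (sorted_pos_diagram l); have nuR := rdec nu (sorted_neg_diagram l).
have zero_or (j : 'I_N) : row_length mu j = 0%N \/ rn j = 0%N.
  have jN := ltn_ord j.
  rewrite /rn row_neg_diagram ?row_pos_diagram; last by lia.
  have -> : (N - (N - j.+1).+1)%N = j by lia.
  move: (_ `_j) => x; case: (ltrP 0 x) => x0; case: (ltrP x 0) => x1;
    by [left | right | lia].
have LE (j : 'I_N) : u + N%:R - node (shifted_parts l) j =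
    u + j.+1%:R - (row_length mu j)%:R + (rn j)%:R.
  rewrite /node nth_mkseq // lamE !(rmorphB, rmorphD) /=; ring.
have -> : h / N%:R = (u + N%:R - N%:R)^-1 by rewrite addrK invf_div.
rewrite -pf_sum_shift ?sorted_shifted_parts ?size_shifted_parts //; last 2 first.
- by rewrite addrK.
- move=> j jN; rewrite -subr_eq0 (LE (Ordinal jN)).
  have -> : u + (Ordinal jN).+1%:R - (row_length mu (Ordinal jN))%:R + (rn (Ordinal jN))%:R =
     u + ((Ordinal jN).+1%:Z - (row_length mu (Ordinal jN))%:Z + (rn (Ordinal jN))%:Z)%:~R.
    by rewrite !(rmorphB, rmorphD) /= !addrA.
  by apply: u0; have := muR j; have := nuR (N - j.+1)%N; rewrite /rn /T /=; lia.
(* Reflection exchanges the signs of the parts. Since N / ((1+h)^-1 - 1) = -(u + N) = v + 1, the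
   coordinates of the negative diagram are shifted by one, whence s = 1 in [frob_fun]. *)
pose v := - (u + N.+1%:R).
have Emu := @frobenius_product C mu (sorted_pos_diagram l) N u (size_pos_diagram l).
have Enu := @frobenius_product C nu (sorted_neg_diagram l) N v (size_neg_diagram l).
have ratioE (A B X : C) : X != 0 -> (A / X) / (B / X) = A / B.
  by move=> X0; rewrite invf_div mulrA divfK.
have -> : frob_fun 0 N mu h =
    \prod_(i < N) ((u + i.+1%:R) / (u + i.+1%:R - (row_length mu i)%:R)).
  rewrite Emu; last by move=> z zT; apply: u0; rewrite /T; lia.
  apply: eq_bigr => i _; rewrite /frob_factor /frob_a /frob_b.
  rewrite !(rmorphM, rmorphB, rmorphD) /= !of_realV !rmorph_nat.
  rewrite -[RHS](ratioE _ _ u u0'); congr (_ / _); rewrite /u; field; rewrite ?h0 ?NC //.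
have -> : frob_fun 1 N nu ((1 + h)^-1 - 1) =
    \prod_(i < N) ((u + i.+1%:R) / (u + i.+1%:R + (rn i)%:R)).
  rewrite (reindex_inj rev_ord_inj) /=.
  transitivity (\prod_(i < N) ((v + i.+1%:R) / (v + i.+1%:R - (row_length nu i)%:R))).
    rewrite Enu; last first.
      move=> z zT; have -> : v + z%:~R = - (u + (N.+1%:Z - z)%:~R).
        by rewrite /v rmorphB /=; ring.
      by rewrite oppr_eq0; apply: u0; rewrite /T; lia.
    apply: eq_bigr => i _; rewrite /frob_factor /frob_a /frob_b.
    rewrite !(rmorphM, rmorphB, rmorphD) /= !of_realV !rmorph_nat.
    have X0 : - (u + N%:R) != 0 by rewrite oppr_eq0; apply: (u0 N%:Z); rewrite /T; lia.
    rewrite -[RHS](ratioE _ _ (- (u + N%:R)) X0).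
    have -> : (1 + h)^-1 - 1 = N%:R / - (u + N%:R).
      have -> : u + N%:R = N%:R * (1 + h) / h by rewrite /u; field.
      rewrite invrN mulrN !invfM invrK -!mulrA mulVKf //.
      by field.
    move: X0; set X := - _ => X0.
    have vE : v = X - 1 by rewrite /v /X -natr1; ring.
    clearbody X; rewrite vE {vE}; clear -NC X0.
    by congr (_ / _); field; rewrite NC X0.
  apply: eq_bigr => i _; have iN := ltn_ord i.
  have -> : rn (rev_ord i) = row_length nu i by rewrite /rn /=; congr row_length; lia.
  have -> : (N - i.+1).+1%:R = N%:R - i%:R :> C by rewrite -natrB; [congr _%:R | ]; lia.
  have -> : v + i.+1%:R = - (u + (N%:R - i%:R)) by rewrite /v -!natr1; ring.
  by rewrite -opprD invrN mulrNN.
rewrite -big_split /= [X in X / _](reindex_inj rev_ord_inj) -prodf_div.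
apply: eq_bigr => i _ /=; rewrite LE.
have iN := ltn_ord i.
have -> : u + N%:R - (N - i.+1)%:R = u + i.+1%:R by rewrite natrB //; ring.
have ui0 : u + i.+1%:R != 0 by apply: (u0 i.+1%:Z); rewrite /T; lia.
case: (zero_or i) => ->; first by rewrite subr0 divff // mul1r.
by rewrite !addr0 divff // mulr1.
Qed.

End FrobeniusFunction.

(** * Taylor norms of single factors on the unit circle *)

Section FactorBounds.
Context {R : realType}.
Local Notation C := (Cplx R).

(** The denominator is (1 + a) - a x, of modulus at least 1 at a point of the circle, and the
    numerator 1 - b + b x has modulus at most 1 there. The exponential form of the bound makes a
    product of factors depend only on the sum of all a + b. *)
Lemma taylor_factor_pos (z : C) (r a b : R) : modulus z = 1 -> 0 < r -> r <= 1 / 2 ->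
  0 <= a -> (1 + a) * r <= 1 / 2 -> 0 <= b <= 1 ->
  exists c, taylor z r (fun x => frob_factor a b (x - 1)) c (expR (2 * (a + b))).
Proof.
move=> z1 r0 r2 a0 ar /andP[b0 b1].
have num := taylor_affine z (of_real (1 - b)) (of_real b) r0.
have wle : 1 <= modulus (of_real (1 + a) + of_real (- a) * z).
  have := modulus_dist_le (of_real (1 + a)) (of_real a * z).
  rewrite rmorphN mulNr modulusM !modulus_of_real_ge0 ?addr_ge0 // z1 mulr1.
  by rewrite addrK.
have arlt : modulus (of_real (- a)) * r < modulus (of_real (1 + a) + of_real (- a) * z).
  by apply: lt_le_trans wle; rewrite modulus_of_real normrN ger0_norm //; lra.
have den := taylor_inv r0 arlt.
have := taylorM r0 num den; set c := (X in taylor _ _ _ X _) => tc; exists c.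
apply: taylor_le; last first.
  apply: eq_taylor tc => h _.
  rewrite /frob_factor !rmorphB !rmorphD !rmorph1 rmorphN /=; congr (_ / _); ring.
have h1 : modulus (of_real (1 - b) + of_real b * z) + modulus (of_real b) * r <= 1 + b * r.
  rewrite [modulus (of_real b)]modulus_of_real_ge0 // lerD2r.
  apply: le_trans (modulusD _ _) _.
  by rewrite modulusM !modulus_of_real_ge0 ?subr_ge0 // z1; lra.
have h2 : (modulus (of_real (1 + a) + of_real (- a) * z) - modulus (of_real (- a)) * r)^-1
    <= 1 + 2 * a * r.
  rewrite [modulus (of_real (- a))]modulus_of_real normrN ger0_norm //.
  set w := modulus _ in wle *.
  rewrite -[leRHS]invrK lef_pV2 ?posrE; last 2 first.
  - by lra.
  - by rewrite invr_gt0; nra.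
  rewrite -[(1 + _)^-1]mul1r ler_pdivrMr; last by nra.
  have s0 : 0 <= a * r by rewrite mulr_ge0 // ltW.
  have s2 : a * r <= 1 / 2 by lra.
  rewrite -[2 * a * r]mulrA; move: (a * r) s0 s2 => s s0 s2; nra.
apply: le_trans (_ : (1 + b * r) * (1 + 2 * a * r) <= _).
  apply: ler_pM => //; first by rewrite addr_ge0 ?modulus_ge0 // mulr_ge0 ?modulus_ge0 // ltW.
  by rewrite invr_ge0 subr_ge0 ltW.
have e1 : 1 + b * r <= expR b.
  by apply: le_trans (expR_ge1Dx b); rewrite lerD2l; nra.
have e2 : 1 + 2 * a * r <= expR (2 * a).
  by apply: le_trans (expR_ge1Dx (2 * a)); rewrite lerD2l; nra.
apply: le_trans (_ : expR b * expR (2 * a) <= _); first by apply: ler_pM => //; nra.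
by rewrite -expRD ler_expR; lra.
Qed.

(** The reciprocal of the denominator is x / ((1+a) x - a), which equals (1 + a / ((1+a) x - a)) /
    (1+a); again |(1+a) z - a| >= 1 on the circle. *)
Lemma taylor_factor_neg (z : C) (r a b : R) : modulus z = 1 -> 0 < r -> r <= 1 / 2 ->
  0 <= a -> (1 + a) * r <= 1 / 2 -> 0 <= b <= 1 ->
  exists c, taylor z r (fun x => frob_factor a b (x^-1 - 1)) c (expR (2 * (a + b))).
Proof.
move=> z1 r0 r2 a0 ar /andP[b0 b1].
have invlt : modulus (1 : C) * r < modulus (0 + 1 * z : C).
  by rewrite add0r mul1r modulus1 mul1r z1; lra.
have num := taylorD r0 (taylor_cst z (of_real (1 - b)) r0)
  (taylorZ (of_real b) (taylor_inv r0 invlt)).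
have wle : 1 <= modulus (of_real (- a) + of_real (1 + a) * z).
  have := modulus_dist_le (of_real (1 + a) * z) (of_real a).
  rewrite rmorphN [- _ + _]addrC modulusM !modulus_of_real_ge0 ?addr_ge0 // z1 mulr1.
  by rewrite addrK.
have arlt : modulus (of_real (1 + a)) * r < modulus (of_real (- a) + of_real (1 + a) * z).
  apply: lt_le_trans wle; rewrite modulus_of_real_ge0 ?addr_ge0 //; lra.
have den := taylorZ (of_real (1 + a)^-1) (taylorD r0 (taylor_cst z 1 r0)
  (taylorZ (of_real a) (taylor_inv r0 arlt))).
have := taylorM r0 num den; set c := (X in taylor _ _ _ X _) => tc; exists c.
apply: taylor_le; last first.
  apply: eq_taylor tc => h hr.
  set x := z + h.
  have x0 : x != 0.
    rewrite -modulus_gt0 /x; have := modulus_dist_le z (- h).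
    by rewrite opprK modulusN z1; apply: lt_le_trans; lra.
  have D0 : of_real (- a) + of_real (1 + a) * x != 0.
    rewrite -modulus_gt0; have := modulus_dist_le (of_real (- a) + of_real (1 + a) * z)
      (- (of_real (1 + a) * h)).
    rewrite opprK modulusN -addrA -mulrDr -/x; apply: lt_le_trans.
    rewrite modulusM modulus_of_real_ge0 ?addr_ge0 //.
    by rewrite subr_gt0; apply: lt_le_trans wle; nra.
  have A0 : of_real (1 + a) != 0 :> C by rewrite of_real_eq0 gt_eqF //; lra.
  rewrite /frob_factor add0r mul1r of_realV.
  have E : 1 - of_real a * (x^-1 - 1) = (of_real (- a) + of_real (1 + a) * x) / x.
    by rewrite rmorphN rmorphD rmorph1; field.
  rewrite E invf_div; move: D0 A0; rewrite !rmorphB !rmorphN !rmorphD !rmorph1 /= => D0 A0.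
  by field; rewrite ?x0 ?D0 ?A0.
have h1 : modulus (of_real (1 - b)) +
    modulus (of_real b) * (modulus (0 + 1 * z : C) - modulus (1 : C) * r)^-1 <= 1 + 2 * b * r.
  rewrite add0r mul1r z1 modulus1 mul1r !modulus_of_real_ge0 ?subr_ge0 //.
  have : (1 - r)^-1 <= 1 + 2 * r.
    rewrite -[leRHS]invrK lef_pV2 ?posrE; last 2 first.
    - by lra.
    - by rewrite invr_gt0; lra.
    by rewrite -[(1 + _)^-1]mul1r ler_pdivrMr; [nra | lra].
  by nra.
have h2 : modulus (of_real (1 + a)^-1 : C) * (modulus (1 : C) + modulus (of_real a) *
    (modulus (of_real (- a) + of_real (1 + a) * z) - modulus (of_real (1 + a)) * r)^-1)
    <= 1 + 2 * a.
  rewrite modulus_of_real_ge0 ?invr_ge0 ?addr_ge0 // modulus1.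
  rewrite (modulus_of_real_ge0 a0) [modulus (of_real (1 + a))]modulus_of_real_ge0 ?addr_ge0 //.
  set w := modulus _ in wle *.
  have w2 : (w - (1 + a) * r)^-1 <= 2.
    rewrite -[leRHS]invrK lef_pV2 ?posrE ?invr_gt0 //; lra.
  rewrite mulrC ler_pdivrMr; last by lra.
  have w0 : 0 <= (w - (1 + a) * r)^-1 by rewrite invr_ge0; lra.
  by nra.
apply: le_trans (_ : (1 + 2 * b * r) * (1 + 2 * a) <= _).
  apply: ler_pM => //.
    by rewrite addr_ge0 ?mulr_ge0 ?modulus_ge0 ?invr_ge0 ?subr_ge0 // ltW.
  by rewrite mulr_ge0 ?addr_ge0 ?mulr_ge0 ?modulus_ge0 ?invr_ge0 ?subr_ge0 // ltW.
have e1 : 1 + 2 * b * r <= expR (2 * b).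
  by apply: le_trans (expR_ge1Dx (2 * b)); rewrite lerD2l; nra.
have e2 : 1 + 2 * a <= expR (2 * a) by apply: expR_ge1Dx.
apply: le_trans (_ : expR (2 * b) * expR (2 * a) <= _).
  by apply: ler_pM => //; nra.
by rewrite -expRD ler_expR; lra.
Qed.

End FactorBounds.

(** * Limits of the products *)

Section ComplexExponential.
Context {R : realType}.
Local Notation C := (Cplx R).

Lemma is_derive_approx (f : R -> R) (x df : R) : is_derive x 1 f df ->
  forall eta, 0 < eta -> exists delta, 0 < delta /\
  forall h, `|h| < delta -> `|f (h + x) - f x - h * df| <= eta * `|h|.
Proof.
move=> [fx <-] eta eta0; have /cvgrPdist_le/(_ eta eta0)[d /= d0 hd] := fx.
exists d; split=> // h hd'; have [->|h0] := eqVneq h 0.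
  by rewrite add0r subrr mul0r subrr normr0 mulr0.
have := hd h; rewrite /= sub0r normrN => /(_ hd' h0); rewrite -/(derive f x 1).
have -> : h%:A = h by rewrite /GRing.scale /= mulr1.
set D := derive f x 1; set F := f (h + x) - f x => H.
have -> : F - h * D = - (h * (D - h^-1 * F)) by rewrite mulrBr mulVKf // opprB.
by rewrite normrN normrM mulrC ler_wpM2r.
Qed.

Let mulCE (a b c d : R) :
  ((a +i* b)%C : C) * (c +i* d)%C = ((a * c - b * d) +i* (a * d + b * c))%C.
Proof. by []. Qed.

Let subCE (a b c d : R) : 
  ((a +i* b)%C : C) - (c +i* d)%C = ((a - c) +i* (b - d))%C.
Proof. by []. Qed.

Let of_realE (a : R) : of_real a = (a +i* 0)%C :> C.
Proof. by []. Qed.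

Lemma cexpD (z w : C) : cexp (z + w) = cexp z * cexp w.
Proof.
case: z => a b; case: w => c d; rewrite /cexp /= expRD rmorphM /= mulrACA.
congr (_ * _); rewrite cosD sinD mulCE; congr (_ +i* _)%C; ring.
Qed.

Lemma cexp0 : cexp (0 : C) = 1.
Proof. by rewrite /cexp /= expR0 cos0 sin0 rmorph1 mul1r. Qed.

Lemma modulus_cexp (z : C) : modulus (cexp z) = expR (complex.Re z).
Proof.
rewrite /cexp modulusM modulus_of_real_ge0 ?expR_ge0 //.
rewrite -[RHS]mulr1; congr (_ * _); rewrite /modulus normc_def /=.
by rewrite cos2Dsin2 sqrtr1.
Qed.

Lemma modulus_cexp_le (z : C) : modulus (cexp z) <= expR (modulus z).
Proof.
rewrite modulus_cexp ler_expR; apply: le_trans (normRe_le_modulus z).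
exact: ler_norm.
Qed.

Lemma cexp_linear_approx (y : C) (eta : R) : 0 < eta ->
  exists delta, 0 < delta /\ forall e : R, `|e| < delta ->
    modulus (cexp (of_real e * y) - 1 - of_real e * y) <= eta * `|e|.
Proof.
case: y => a b eta0; have eta20 : 0 < eta / 2 by rewrite divr_gt0.
pose f (t : R) := expR (t * a) * cos (t * b).
pose g (t : R) := expR (t * a) * sin (t * b).
have df : is_derive (0 : R) 1 f a.
  by apply: is_derive_eq; rewrite !mul0r expR0 cos0 sin0 /GRing.scale /=; ring.
have dg : is_derive (0 : R) 1 g b.
  by apply: is_derive_eq; rewrite !mul0r expR0 cos0 sin0 /GRing.scale /=; ring.
have [d1 [d10 h1]] := is_derive_approx df eta20.
have [d2 [d20 h2]] := is_derive_approx dg eta20.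
exists (Num.min d1 d2); split; first by rewrite lt_min d10.
move=> e; rewrite lt_min => /andP[e1 e2].
apply: le_trans (modulus_le_ReIm _) _.
have := h1 e e1; have := h2 e e2; rewrite /f /g !mul0r !addr0 expR0 cos0 sin0 mulr1 mulr0 subr0.
have -> : cexp (of_real e * (a +i* b)%C) - 1 - of_real e * (a +i* b)%C =
  ((expR (e * a) * cos (e * b) - 1 - e * a) +i* (expR (e * a) * sin (e * b) - e * b))%C :> C.
  have -> : of_real e * (a +i* b)%C = (e * a +i* (e * b))%C :> C.
    by rewrite of_realE mulCE !mul0r subr0 addr0.
  rewrite /cexp /= of_realE mulCE !mul0r subr0 addr0.
  by rewrite -[1]/(1 +i* 0)%C !subCE subr0.
rewrite /= => h3 h4; rewrite [eta]splitr mulrDl; exact: lerD.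
Qed.

Lemma cvg_cexp (u : nat -> R) (l : R) (y : C) : u @ \oo --> l ->
  (fun N => cexp (of_real (u N) * y)) @ \oo --> cexp (of_real l * y).
Proof.
move=> ul; have [d [d0 hd]] := cexp_linear_approx y ltr01.
have -> : (fun N => cexp (of_real (u N) * y)) =
    fun N => cexp (of_real l * y) * cexp (of_real (u N - l) * y).
  apply/funext => N; rewrite -cexpD -mulrDl -rmorphD /=.
  by rewrite addrC subrK.
rewrite -[X in _ --> X]mulr1; apply: cvgnZ; apply/cvg_CplxP => e e0.
pose K := modulus y + 1; have K0 : 0 < K by rewrite ltr_wpDl ?modulus_ge0.
have m0 : 0 < Num.min (d / 2) (e / K) by rewrite lt_min !divr_gt0.
have /cvg_realP/(_ _ m0)[N0 hN] := ul.
exists N0 => N /hN; rewrite le_min => /andP[ud ue].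
have ud' : `|u N - l| < d by apply: le_lt_trans ud _; rewrite gtr_pMr // invf_lt1 // ltr1n.
rewrite -[_ - 1](subrK (of_real (u N - l) * y)).
apply: le_trans (modulusD _ _) _; apply: le_trans (lerD (hd _ ud') (lexx _)) _.
rewrite modulusM modulus_of_real mul1r; move: ue; rewrite ler_pdivlMr // /K mulrDr mulr1.
by rewrite addrC.
Qed.

Lemma cexp_sum (I : Type) (s : seq I) (P : pred I) (F : I -> C) :
  cexp (\sum_(i <- s | P i) F i) = \prod_(i <- s | P i) cexp (F i).
Proof. by apply: (big_morph _ cexpD cexp0). Qed.

Lemma cvg_Cplx_of_abs_series (u : nat -> C) (b : nat -> R) :
  (forall n, modulus (u n.+1 - u n) <= b n) -> cvgn (series b) ->
  exists l : C, u @ \oo --> l.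
Proof.
move=> ub cb.
have part (p : C -> R) : (forall z w, p (z - w) = p z - p w) ->
    (forall z, `|p z| <= modulus z) -> cvgn (fun n => p (u n)).
  move=> pB pm; have c1 : cvgn (series (fun n => p (u n.+1) - p (u n))).
    apply: normed_cvg; apply: series_le_cvg cb => n; rewrite ?normr_ge0 //.
      by apply: le_trans (ub n); apply: modulus_ge0.
    by rewrite /= -pB; apply: le_trans (pm _) (ub n).
  have -> : (fun n => p (u n)) =
      series (fun n => p (u n.+1) - p (u n)) \+ (fun=> p (u 0%N)).
    apply/funext => n; rewrite /= /series /=.
    by rewrite (telescope_sumr (fun n => p (u n))) // subrK.
  by apply: is_cvgD => //; apply: is_cvg_cst.
have cRe := part (@complex.Re R) _ normRe_le_modulus.
have cIm := part (@complex.Im R) _ normIm_le_modulus.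
have /cRe/cvg_realP hRe : forall z w : C, complex.Re (z - w) = complex.Re z - complex.Re w.
  by case=> ? ?; case.
have /cIm/cvg_realP hIm : forall z w : C, complex.Im (z - w) = complex.Im z - complex.Im w.
  by case=> ? ?; case.
move: hRe hIm; set l1 := limn _; set l2 := limn _ => hRe hIm.
exists ((l1 +i* l2)%C : C); apply/cvg_CplxP => e e0.
have e20 : 0 < e / 2 by rewrite divr_gt0.
have [N1 h1] := hRe _ e20; have [N2 h2] := hIm _ e20.
exists (maxn N1 N2) => N; rewrite geq_max => /andP[/h1 a1 /h2 a2].
apply: le_trans (modulus_le_ReIm _) _; rewrite [e]splitr.
by case: (u N) a1 a2 => x1 x2 /=; apply: lerD.
Qed.

End ComplexExponential.

(** * Products with many factors close to 1 *)

Section InfiniteProduct.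
Context {R : realType}.
Local Notation C := (Cplx R).

(** The factors are exchanged one at a time; as every majorant is at least 1, the product of all of
    them bounds each partial product. *)
Lemma modulus_prod_sub (s : seq nat) (z w : nat -> C) (m : nat -> R) :
  (forall i, i \in s -> 1 <= m i) ->
  (forall i, i \in s -> modulus (z i) <= m i) ->
  (forall i, i \in s -> modulus (w i) <= m i) ->
  modulus (\prod_(i <- s) z i - \prod_(i <- s) w i) <=
  (\prod_(i <- s) m i) * \sum_(i <- s) modulus (z i - w i).
Proof.
elim: s => [|i s IHs] m1 zm wm; first by rewrite !big_nil subrr modulus0 mulr0.
have is_ : i \in i :: s by apply: mem_head.
have sub j : j \in s -> j \in i :: s by move=> js; rewrite inE js orbT.
have IH := IHs (fun j js => m1 j (sub j js)) (fun j js => zm j (sub j js))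
  (fun j js => wm j (sub j js)).
have m_ge1 : 1 <= \prod_(j <- s) m j.
  rewrite big_seq; apply: (big_ind (fun x => 1 <= x)) => // [x y x1 y1|j js].
    by rewrite -[1]mulr1 ler_pM.
  by apply: m1; apply: sub.
have zs : modulus (\prod_(j <- s) z j) <= \prod_(j <- s) m j.
  rewrite modulus_prod big_seq [leRHS]big_seq; apply: ler_prod => j js.
  by rewrite modulus_ge0 zm // sub.
rewrite !big_cons.
set Z := \prod_(j <- s) z j in IH zs *; set W := \prod_(j <- s) w j in IH *.
set P := \prod_(j <- s) m j in IH m_ge1 zs *; set S := \sum_(j <- s) _ in IH *.
have -> : z i * Z - w i * W = (z i - w i) * Z + w i * (Z - W) by ring.
have mi := m1 i is_; have m0 : 0 <= m i by apply: le_trans mi.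
have P0 : 0 <= P by apply: le_trans m_ge1.
rewrite [leRHS]mulrDr; apply: le_trans (modulusD _ _) _; rewrite !modulusM.
apply: lerD; last by rewrite -mulrA ler_pM ?modulus_ge0 ?wm.
rewrite mulrC ler_wpM2r ?modulus_ge0 //; apply: le_trans zs _.
by rewrite -[leLHS]mul1r ler_wpM2r.
Qed.

Lemma frob_factor_sub1 (a b : R) (y : C) : 1 - of_real a * y != 0 ->
  frob_factor a b y - 1 = of_real (a + b) * y / (1 - of_real a * y).
Proof. by move=> D0; rewrite /frob_factor rmorphD /=; field. Qed.

Section Factor.
Variables (a b : R) (y : C).
Hypotheses (a0 : 0 <= a) (b0 : 0 <= b) (ay : 1 / 2 <= modulus (1 - of_real a * y)).

Let D0 : 1 - of_real a * y != 0.
Proof. rewrite -modulus_gt0; apply: lt_le_trans ay; lra. Qed.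

Let Dinv : (modulus (1 - of_real a * y))^-1 <= 2.
Proof.
rewrite -[leRHS]invrK lef_pV2 ?posrE ?invr_gt0 ?modulus_gt0 //.
by apply: le_trans ay; lra.
Qed.

Lemma frob_factor_sub1_le :
  modulus (frob_factor a b y - 1) <= 2 * modulus y * (a + b).
Proof.
rewrite frob_factor_sub1 // !modulusM modulusV modulus_of_real_ge0 ?addr_ge0 //.
apply: le_trans (ler_wpM2l _ Dinv) _; first by rewrite mulr_ge0 ?modulus_ge0 ?addr_ge0.
by rewrite le_eqVlt; apply/orP; left; apply/eqP; ring.
Qed.

Lemma frob_factor_le_exp :
  modulus (frob_factor a b y) <= expR (2 * modulus y * (a + b)).
Proof.
apply: le_trans (expR_ge1Dx _); rewrite -[frob_factor _ _ _](subrK 1).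
rewrite addrC; apply: le_trans (modulusD _ _) _.
by rewrite modulus1 lerD2l frob_factor_sub1_le.
Qed.

Lemma frob_factor_approx :
  modulus (frob_factor a b y - 1 - of_real (a + b) * y) <=
  2 * modulus y ^+ 2 * (a + b) ^+ 2.
Proof.
rewrite frob_factor_sub1 //.
have -> : of_real (a + b) * y / (1 - of_real a * y) - of_real (a + b) * y =
    of_real (a + b) * y * (of_real a * y) / (1 - of_real a * y) by field.
rewrite !modulusM modulusV !modulus_of_real_ge0 ?addr_ge0 //.
apply: le_trans (ler_wpM2l _ Dinv) _.
  by rewrite !mulr_ge0 ?modulus_ge0 ?addr_ge0.
have -> : (a + b) * modulus y * (a * modulus y) * 2 =
  2 * modulus y ^+ 2 * ((a + b) * a) by ring.
rewrite ler_wpM2l ?mulr_ge0 ?exprn_ge0 ?modulus_ge0 // expr2.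
by rewrite ler_wpM2l ?addr_ge0 // lerDl.
Qed.

End Factor.

Section HalfProduct.
Variables (al be : nat -> R) (ga : R) (a b : nat -> nat -> R) (d : nat -> nat)
  (A : R) (N0 : nat) (y : C).
Hypotheses (al_ge0 : forall i, 0 <= al i) (be_ge0 : forall i, 0 <= be i)
  (cvg_albe : cvgn (series (fun i => al i + be i)))
  (a_ge0 : forall N i, (N0 <= N)%N -> 0 <= a N i)
  (b_ge0 : forall N i, (N0 <= N)%N -> 0 <= b N i)
  (ab_supp : forall N i, (N0 <= N)%N -> (d N <= i)%N -> a N i = 0 /\ b N i = 0)
  (a_decr : forall N i, (N0 <= N)%N -> a N i.+1 <= a N i)
  (b_decr : forall N i, (N0 <= N)%N -> b N i.+1 <= b N i)
  (a_leA : forall N i, (N0 <= N)%N -> a N i <= A)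
  (a_cvg : forall i, a ^~ i @ \oo --> al i)
  (b_cvg : forall i, b ^~ i @ \oo --> be i)
  (sum_cvg : (fun N => \sum_(0 <= i < d N) (a N i + b N i)) @ \oo -->
     limn (series (fun i => al i + be i)) + ga)
  (yA : forall t, 0 <= t <= A -> 1 / 2 <= modulus (1 - of_real t * y)).

Let Y := modulus y.

Lemma al_leA i : 0 <= al i <= A.
Proof.
rewrite al_ge0 /=; apply/ler_addgt0Pr => e e0.
have /cvg_realP/(_ e e0)[N1 h] := @a_cvg i.
have := h _ (leq_maxr N0 N1); rewrite ler_distl => /andP[h1 _].
by rewrite -lerBlDr; apply: le_trans (a_leA i (leq_maxl N0 N1)); rewrite lerBlDr; lra.
Qed.

Definition partial_product n : C := \prod_(0 <= i < n) frob_factor (al i) (be i) y.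

Lemma partial_product_le n :
  modulus (partial_product n) <= expR (2 * Y * \sum_(0 <= i < n) (al i + be i)).
Proof.
rewrite /partial_product modulus_prod mulr_sumr expR_sum; apply: ler_prod => i _.
by rewrite modulus_ge0 frob_factor_le_exp // yA // al_leA.
Qed.

Lemma sum_albe_le n : \sum_(0 <= i < n) (al i + be i) <= limn (series (fun i => al i + be i)).
Proof.
apply: (nondecreasing_cvgn_le (u_ := series (fun i => al i + be i))) => //.
by apply/nondecreasing_seqP => k; rewrite /series /= big_nat_recr //= lerDl addr_ge0.
Qed.

Lemma partial_product_cvg : exists P : C, partial_product @ \oo --> P.
Proof.
pose M := expR (2 * Y * limn (series (fun i => al i + be i))).
apply: (@cvg_Cplx_of_abs_series R _ (fun n => M * (2 * Y) * (al n + be n))).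
  move=> n; rewrite /partial_product big_nat_recr //= -/(partial_product n).
  set f := frob_factor _ _ _.
  have -> : partial_product n * f - partial_product n = partial_product n * (f - 1).
    by rewrite mulrBr mulr1.
  rewrite modulusM.
  rewrite -[leRHS]mulrA; apply: ler_pM; rewrite ?modulus_ge0 //.
    apply: le_trans (partial_product_le n) _; rewrite ler_expR.
    by rewrite ler_wpM2l ?mulr_ge0 ?modulus_ge0 // sum_albe_le.
  by rewrite frob_factor_sub1_le // yA // al_leA.
exact: is_cvg_seriesZ.
Qed.

(** Cut the product at a fixed n. The first n factors converge individually. In the tail a + b is
    uniformly small, so each factor is cexp((a+b) y) up to a small multiple of a + b, and the tail
    is close to cexp of y times the tail sum, which tends to ga plus the remainder of the series. *)
Lemma half_product_cvg : exists P : C, partial_product @ \oo --> P /\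
  (fun N => \prod_(0 <= i < d N) frob_factor (a N i) (b N i) y) @ \oo -->
    cexp (of_real ga * y) * P.
Proof.
have [P PP] := partial_product_cvg; exists P; split; first exact: PP.
pose sigma := limn (series (fun i => al i + be i)).
pose tau n := sigma - \sum_(0 <= i < n) (al i + be i).
(* The limit in N, for fixed n, of the product whose factors beyond n are replaced by exponentials;
   as n grows it tends to the announced limit. *)
pose V n := partial_product n * cexp (of_real (ga + tau n) * y).
have tau0 : tau @ \oo --> (0 : R).
  by rewrite -(subrr sigma); apply: cvgB; [exact: cvgn_cst | exact: cvg_albe].
have VV : V @ \oo --> P * cexp (of_real ga * y).
  apply: cvgnM; first exact: PP.
  apply: cvg_cexp; rewrite -[X in _ --> X]addr0.
  by apply: cvgD; [exact: cvgn_cst | exact: tau0].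
pose B := sigma + ga + 1.
have [N1 hN1] : exists N1, forall N, (N1 <= N)%N -> \sum_(0 <= i < d N) (a N i + b N i) <= B.
  have /cvg_realP/(_ 1 ltr01)[N1 h] := sum_cvg; exists N1 => N /h.
  by rewrite ler_distl => /andP[_]; rewrite -/sigma.
have Y0 : 0 <= Y by apply: modulus_ge0.
have B0 : 0 <= B.
  apply: le_trans (hN1 _ (leq_maxr N0 N1)); apply: sumr_ge0 => i _.
  by rewrite addr_ge0 ?a_ge0 ?b_ge0 ?leq_maxl.
rewrite mulrC; apply/cvg_CplxP => eps eps0.
have eps30 : 0 < eps / 3 by rewrite divr_gt0.
pose K := expR (2 * Y * B) * B + 1.
have K0 : 0 < K by rewrite ltr_wpDl // mulr_ge0 ?expR_ge0.
pose eta := eps / 3 / K; have eta0 : 0 < eta by rewrite divr_gt0.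
have eta20 : 0 < eta / 2 by rewrite divr_gt0.
have [d1 [d10 hd1]] := cexp_linear_approx y eta20.
have Y20 : 0 < 2 * Y ^+ 2 + 1 by rewrite ltr_wpDl // mulr_ge0 ?exprn_ge0.
pose d2 := eta / 2 / (2 * Y ^+ 2 + 1); have d20 : 0 < d2 by rewrite divr_gt0.
have d120 : 0 < d1 / 2 by rewrite divr_gt0.
pose dl := Num.min (d1 / 2) d2; have dl0 : 0 < dl by rewrite lt_min d120.
have dl20 : 0 < dl / 2 by rewrite divr_gt0.
(* Smallness at the single index n suffices: for large N it passes to a N n + b N n and, by
   monotonicity, to all later indices. *)
have [n [n1 n2]] : exists n, al n + be n <= dl / 2 /\
    modulus (V n - P * cexp (of_real ga * y)) <= eps / 3.
  have /cvg_realP/(_ _ dl20)[n1 h1] := cvg_series_cvg_0 cvg_albe.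
  have /cvg_CplxP/(_ _ eps30)[n2 h2] := VV.
  exists (maxn n1 n2); split; last by apply: h2; apply: leq_maxr.
  have := h1 _ (leq_maxl n1 n2); rewrite subr0; apply: le_trans; exact: ler_norm.
pose Q N := \prod_(0 <= i < n) frob_factor (a N i) (b N i) y.
pose s N := \sum_(0 <= i < d N) (a N i + b N i) - \sum_(0 <= i < n) (a N i + b N i).
have factor_cvg i : (fun N => frob_factor (a N i) (b N i) y) @ \oo -->
    frob_factor (al i) (be i) y.
  rewrite /frob_factor; apply: cvgnM.
    apply: cvgD; first exact: cvgn_cst.
    by apply: cvgnM; [apply: cvg_of_real; apply: b_cvg | exact: cvgn_cst].
  apply: cvgnV.
    rewrite -modulus_gt0; apply: lt_le_trans (yA (al_leA i)); lra.
  apply: cvgB; first exact: cvgn_cst.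
  by apply: cvgnM; [apply: cvg_of_real; apply: a_cvg | exact: cvgn_cst].
have QV : (fun N => Q N * cexp (of_real (s N) * y)) @ \oo --> V n.
  apply: cvgnM; first by apply: cvgn_prod => i _; apply: factor_cvg.
  apply: cvg_cexp; rewrite /tau addrC addrAC; apply: cvgB; first exact: sum_cvg.
  by apply: cvgn_sum => i _; apply: cvgD; [apply: a_cvg | apply: b_cvg].
have /cvg_CplxP/(_ _ eps30)[N2 hN2] := QV.
have /cvg_realP/(_ _ dl20)[N3 hN3] : (fun N => a N n + b N n) @ \oo --> al n + be n.
  by apply: cvgD; [apply: a_cvg | apply: b_cvg].
exists (maxn (maxn N0 N1) (maxn N2 N3)) => N; rewrite !geq_max.
move=> /andP[/andP[N0N N1N] /andP[N2N N3N]].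
pose e i := a N i + b N i.
have e_ge0 i : 0 <= e i by rewrite addr_ge0 ?a_ge0 ?b_ge0.
have e_n : e n <= dl.
  have := hN3 N N3N; rewrite ler_distl => /andP[_ h]; apply: le_trans h _.
  by rewrite [leRHS]splitr lerD2r.
have e_small i : (n <= i)%N -> e i <= dl.
  move=> ni; apply: le_trans e_n; rewrite -(subnK ni).
  elim: (i - n)%N => // m; apply: le_trans; rewrite addSn.
  by apply: lerD; [apply: a_decr | apply: b_decr].
pose D := (n + d N)%N.
have e_supp i : (d N <= i)%N -> e i = 0.
  by move=> di; rewrite /e; have [-> ->] := ab_supp N0N di; rewrite addr0.
have sumD : \sum_(0 <= i < d N) e i = \sum_(0 <= i < D) e i.
  rewrite [RHS](big_cat_nat (n := d N)) ?leq_addl //= [X in _ = _ + X]big_nat_cond.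
  by rewrite [X in _ = _ + X]big1 ?addr0 // => i /andP[/andP[di _] _]; apply: e_supp.
have prodD : \prod_(0 <= i < d N) frob_factor (a N i) (b N i) y =
    Q N * \prod_(n <= i < D) frob_factor (a N i) (b N i) y.
  rewrite -(big_cat_nat (n := n)) ?leq_addr //=.
  rewrite [RHS](big_cat_nat (n := d N)) ?leq_addl //= [X in _ = _ * X]big_nat_cond.
  rewrite [X in _ = _ * X]big1 ?mulr1 // => i /andP[/andP[di _] _].
  have [-> ->] := ab_supp N0N di.
  by rewrite /frob_factor rmorph0 !mul0r addr0 subr0 divr1.
have sE : s N = \sum_(n <= i < D) e i.
  by rewrite /s -/e sumD (big_cat_nat (n := n)) ?leq_addr //= addrAC subrr add0r.
have sumB : \sum_(0 <= i < D) e i <= B by rewrite -sumD; apply: hN1.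
pose m i := expR (2 * Y * e i).
have facA i : 1 / 2 <= modulus (1 - of_real (a N i) * y) by rewrite yA // a_ge0 ?a_leA.
have diff : modulus (\prod_(n <= i < D) frob_factor (a N i) (b N i) y -
    \prod_(n <= i < D) cexp (of_real (e i) * y)) <=
    (\prod_(n <= i < D) m i) * (eta * B).
  apply: le_trans (modulus_prod_sub (m := m) _ _ _) _.
  - by move=> i _; rewrite -(expR0 R) ler_expR !mulr_ge0.
  - by move=> i _; apply: frob_factor_le_exp; rewrite ?a_ge0 ?b_ge0.
  - move=> i _; apply: le_trans (modulus_cexp_le _) _; rewrite ler_expR.
    rewrite modulusM modulus_of_real_ge0 // -/Y mulrC ler_wpM2r //.
    by rewrite ler_peMl // ler1n.
  rewrite ler_wpM2l ?prodr_ge0 // => [i _|]; first exact: expR_ge0.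
  apply: (@le_trans _ _ (\sum_(n <= i < D) eta * e i)).
    rewrite big_nat_cond [leRHS]big_nat_cond; apply: ler_sum => i /andP[/andP[ni _] _].
    have ed := e_small i ni.
    have -> : frob_factor (a N i) (b N i) y - cexp (of_real (e i) * y) =
      (frob_factor (a N i) (b N i) y - 1 - of_real (e i) * y) -
      (cexp (of_real (e i) * y) - 1 - of_real (e i) * y) by ring.
    apply: le_trans (modulus_sub_le _ _) _; rewrite [eta]splitr mulrDl; apply: lerD.
      apply: le_trans (frob_factor_approx _ _ _) _; rewrite ?a_ge0 ?b_ge0 //.
      rewrite -/Y -/(e i) [e i ^+ 2]expr2 mulrA; apply: ler_wpM2r => //.
      apply: le_trans (_ : (2 * Y ^+ 2 + 1) * d2 <= _).
        apply: ler_pM => //; first by rewrite mulr_ge0 ?exprn_ge0.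
          by rewrite lerDl.
        by apply: le_trans ed _; rewrite /dl ge_min lexx orbT.
      by rewrite /d2 mulrC divfK // gt_eqF.
    have ne : `|e i| = e i by rewrite ger0_norm.
    rewrite -{3}ne; apply: hd1; rewrite ne; apply: (le_lt_trans (le_trans ed _) (_ : d1 / 2 < d1)).
      by rewrite /dl ge_min lexx.
    by rewrite gtr_pMr // invf_lt1 // ltr1n.
  rewrite -mulr_sumr ler_wpM2l ?(ltW eta0) //; apply: le_trans sumB.
  rewrite [leRHS](big_cat_nat (n := n)) ?leq_addr //= lerDr.
  by apply: sumr_ge0.
have XW : modulus (\prod_(0 <= i < d N) frob_factor (a N i) (b N i) y -
    Q N * cexp (of_real (s N) * y)) <= eps / 3.
  rewrite prodD -mulrBr modulusM sE rmorph_sum mulr_suml cexp_sum.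
  apply: le_trans (_ : (\prod_(0 <= i < n) m i) * ((\prod_(n <= i < D) m i) * (eta * B)) <= _).
    apply: ler_pM; rewrite ?modulus_ge0 //.
    rewrite /Q modulus_prod; apply: ler_prod => i _; rewrite modulus_ge0.
    by apply: frob_factor_le_exp; rewrite ?a_ge0 ?b_ge0.
  rewrite mulrA -(big_cat_nat (n := n)) ?leq_addr //= -expR_sum -mulr_sumr.
  apply: le_trans (_ : expR (2 * Y * B) * (eta * B) <= _).
    rewrite ler_wpM2r ?(mulr_ge0 (ltW eta0)) // ler_expR ler_wpM2l ?mulr_ge0 //.
  rewrite mulrCA (_ : eps / 3 = eta * K); last by rewrite /eta divfK // gt_eqF.
  by rewrite ler_wpM2l ?(ltW eta0) // lerDl.
set X := \prod_(0 <= i < d N) _ in XW *; set W := Q N * _ in XW.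
have -> : X - P * cexp (of_real ga * y) =
  (X - W) + ((W - V n) + (V n - P * cexp (of_real ga * y))) by ring.
apply: le_trans (modulusD _ _) _.
apply: le_trans (lerD XW (le_trans (modulusD _ _) (lerD (hN2 N N2N) n2))) _.
by rewrite le_eqVlt; apply/orP; left; apply/eqP; field.
Qed.

End HalfProduct.
End InfiniteProduct.

(** * Limit of the product attached to one diagram *)

Section FrobeniusLimit.
Context {R : realType}.
Local Notation C := (Cplx R).

Lemma le_modulus_affine (r t : R) (x : C) : 0 <= t -> modulus x < 1 + r -> t * r <= 1 / 2 ->
  1 / 2 <= modulus (1 - of_real t * (x - 1)).
Proof.
move=> t0 xr tr.
have -> : 1 - of_real t * (x - 1) = of_real (1 + t) - of_real t * x.
  by rewrite rmorphD rmorph1 /=; ring.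
apply: le_trans (modulus_dist_le _ _).
rewrite modulusM !modulus_of_real_ge0 ?addr_ge0 //.
have : t * modulus x <= t * (1 + r) by rewrite ler_wpM2l // ltW.
by rewrite mulrDr mulr1; lra.
Qed.

Lemma le_modulus_affine_inv (r t : R) (x : C) : 0 <= t -> 0 < r -> r <= 1 / 2 ->
  1 - r < modulus x -> t * r <= 1 / 4 -> 1 / 2 <= modulus (1 - of_real t * (x^-1 - 1)).
Proof.
move=> t0 r0 r2 xr tr; apply: (@le_modulus_affine (2 * r)) => //; last by lra.
rewrite modulusV; have x0 : 0 < modulus x by apply: lt_trans xr; lra.
rewrite invf_plt ?posrE ?addr_gt0 ?mulr_gt0 //; apply: le_lt_trans xr.
rewrite -[leLHS]mul1r ler_pdivrMr ?addr_gt0 ?mulr_gt0 //.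
nra.
Qed.

(** Absorbs the shifts by 1/2, divided by N, between [frob_a], [frob_b] and the Frobenius
    coordinates; in the sums a + b these shifts cancel exactly ([sumE]). *)
Lemma cvg_of_close (u v : nat -> R) (l : R) : (forall N, (0 < N)%N -> `|u N - v N| <= N%:R^-1) ->
  v @ \oo --> l -> u @ \oo --> l.
Proof.
move=> uv /cvg_realP vl; apply/cvg_realP => e e0.
have e20 : 0 < e / 2 by rewrite divr_gt0.
have [N1 h1] := vl _ e20.
have [N2 h2] := (cvg_realP _ _).1 (@cvgn_invn R) _ e20.
exists (maxn 1 (maxn N1 N2)) => N; rewrite !geq_max => /and3P[N0 N1N N2N].
have := h2 _ N2N; rewrite subr0 ger0_norm ?invr_ge0 // => h.
rewrite -(subrK (v N) (u N)) -addrA [e]splitr; apply: le_trans (ler_normD _ _) _.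
by apply: lerD; [apply: le_trans (uv _ N0) h | apply: h1].
Qed.

Variables (s : nat) (mu : nat -> seq nat) (al be : nat -> R) (ga : R).
Hypotheses (s1 : (s <= 1)%N) (mu_sorted : forall N, sorted geq (mu N))
  (mu_size : forall N, (size (mu N) <= N)%N)
  (al_ge0 : forall i, 0 <= al i) (be_ge0 : forall i, 0 <= be i)
  (cvg_albe : cvgn (series (fun i => al i + be i)))
  (p_cvg : forall i, frob_p R (mu N) i / N%:R @[N --> \oo] --> al i)
  (q_cvg : forall i, frob_q R (mu N) i / N%:R @[N --> \oo] --> be i)
  (frob_sum_cvg : frob_sum R (mu N) / N%:R @[N --> \oo] -->
     limn (series (fun i => al i + be i)) + ga).

Let d N := diag_length (mu N).
Let a N i : R := if (i < d N)%N then frob_a s N (mu N) i else 0.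
Let b N i : R := if (i < d N)%N then frob_b s N (mu N) i else 0.

Let row_gt N i : (i < d N)%N -> (i < row_length (mu N) i)%N.
Proof. by rewrite ltn_diag_length. Qed.

Let col_gt N i : (i < d N)%N -> (i < col_length (mu N) i)%N.
Proof. by move=> id; rewrite ltn_col_length // row_gt. Qed.

Let frob_a_ge0 N i : (i < d N)%N -> 0 <= (frob_a s N (mu N) i : R).
Proof.
move=> id; rewrite divr_ge0 // addr_ge0 // subr_ge0 ler_nat; exact: row_gt.
Qed.

Let frob_b_ge0 N i : (i < d N)%N -> 0 <= frob_b s N (mu N) i :> R.
Proof.
move=> id; rewrite divr_ge0 // -addrA -opprD subr_ge0 -natrD ler_nat.
have := col_gt id; lia.
Qed.

Let frob_b_le1 N i : (0 < N)%N -> frob_b s N (mu N) i <= 1 :> R.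
Proof.
move=> N0; rewrite ler_pdivrMr ?ltr0n // mul1r -addrA -opprD lerBlDr.
apply: le_trans (_ : N%:R <= _); last by rewrite lerDl addr_ge0.
by rewrite ler_nat; apply: leq_trans (col_length_le_size _ _) (mu_size N).
Qed.

Let a_ge0 N i : 0 <= a N i.
Proof. by rewrite /a; case: ifP => // /frob_a_ge0. Qed.

Let b_ge0 N i : 0 <= b N i.
Proof. by rewrite /b; case: ifP => // /frob_b_ge0. Qed.

Let a_decr N i : a N i.+1 <= a N i.
Proof.
rewrite {1}/a; case: ifP => [id|_]; last exact: a_ge0.
rewrite /a (ltnW id) /frob_a ler_wpM2r ?invr_ge0 // lerD2r lerB ?ler_nat //.
exact: row_length_decr.
Qed.

Let b_decr N i : b N i.+1 <= b N i.
Proof.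
rewrite {1}/b; case: ifP => [id|_]; last exact: b_ge0.
rewrite /b (ltnW id) /frob_b ler_wpM2r ?invr_ge0 // lerD2r lerB ?ler_nat //.
by rewrite /col_length; apply: sub_count => r /= /ltnW.
Qed.

Let s_half : `|(1 / 2 : R) - s%:R| <= 1.
Proof. by case: s s1 => [|[|//]] _; rewrite ler_norml; lra. Qed.

Let a_cvg i : a ^~ i @ \oo --> al i.
Proof.
move: (@p_cvg i); apply: cvg_of_close => N N0; rewrite /a /frob_p -/(d N).
case: ifP => _; last by rewrite mul0r subrr normr0.
rewrite /frob_a -mulrBl normrM normfV normr_nat -[leRHS]mul1r ler_wpM2r //.
rewrite -normrN; apply: le_trans s_half; rewrite le_eqVlt; apply/orP; left; apply/eqP.
congr (`|_|); ring.
Qed.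

Let b_cvg i : b ^~ i @ \oo --> be i.
Proof.
move: (@q_cvg i); apply: cvg_of_close => N N0; rewrite /b /frob_q -/(d N).
case: ifP => _; last by rewrite mul0r subrr normr0.
rewrite /frob_b -mulrBl normrM normfV normr_nat -[leRHS]mul1r ler_wpM2r //.
apply: le_trans s_half; rewrite le_eqVlt; apply/orP; left; apply/eqP.
by rewrite -natr1; congr (`|_|); field.
Qed.

Let sumE N : \sum_(0 <= i < d N) (a N i + b N i) = frob_sum R (mu N) / N%:R.
Proof.
rewrite /frob_sum mulr_suml big_nat_cond [RHS]big_nat_cond.
apply: eq_bigr => i /andP[/andP[_ id] _]; rewrite /a /b /frob_p /frob_q -/(d N) id.
rewrite /frob_a /frob_b -mulrDl -natr1; by congr (_ / _); field.
Qed.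

Let frob_funE N y : frob_fun s N (mu N) y = \prod_(0 <= i < d N) frob_factor (a N i) (b N i) y.
Proof.
by rewrite /frob_fun big_mkord; apply: eq_bigr => i _; rewrite /a /b ltn_ord.
Qed.

Lemma frob_fun_limit : exists (N0 : nat) (B : R), (0 < N0)%N /\
  (forall N, (N0 <= N)%N ->
    \sum_(i < diag_length (mu N)) (frob_a s N (mu N) i + frob_b s N (mu N) i : R) <= B /\
    forall i, (i < diag_length (mu N))%N ->
      0 <= (frob_a s N (mu N) i : R) <= al 0%N + 1 /\ 0 <= (frob_b s N (mu N) i : R) <= 1) /\
  forall y : C, (forall t : R, 0 <= t <= al 0%N + 1 -> 1 / 2 <= modulus (1 - of_real t * y)) ->
    exists P : C, partial_product al be y @ \oo --> P /\
      (fun N => frob_fun s N (mu N) y) @ \oo --> cexp (of_real ga * y) * P.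
Proof.
have [N1 h1] := (cvg_realP _ _).1 (@a_cvg 0%N) 1 ltr01.
have [N2 h2] := (cvg_realP _ _).1 (@frob_sum_cvg) 1 ltr01.
pose N0 := maxn 1 (maxn N1 N2).
have a_leA N i : (N0 <= N)%N -> a N i <= al 0%N + 1.
  rewrite !geq_max => /and3P[N0N N1N N2N].
  apply: (@le_trans _ _ (a N 0)); last first.
    by have := h1 _ N1N; rewrite ler_distl => /andP[].
  by elim: i => // i; apply: le_trans; apply: a_decr.
exists N0, (limn (series (fun i => al i + be i)) + ga + 1); split; first by rewrite leq_maxl.
split=> [N N0N|y yA].
  have := N0N; rewrite !geq_max => /and3P[Npos N1N N2N]; split.
    have := h2 _ N2N; rewrite -sumE ler_distl => /andP[_]; apply: le_trans.
    rewrite big_mkord le_eqVlt; apply/orP; left; apply/eqP.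
    by apply: eq_bigr => i _; rewrite /a /b ltn_ord.
  move=> i id; rewrite frob_a_ge0 // frob_b_ge0 // frob_b_le1 //=; split=> //.
  by have := a_leA N i N0N; rewrite /a id.
have supp N i : (N0 <= N)%N -> (d N <= i)%N -> a N i = 0 /\ b N i = 0.
  by move=> _; rewrite /a /b ltnNge => ->.
have sum_cvg : (fun N => \sum_(0 <= i < d N) (a N i + b N i)) @ \oo -->
    limn (series (fun i => al i + be i)) + ga.
  by under eq_fun do rewrite sumE.
have [P [PP XP]] := @half_product_cvg R al be ga a b d (al 0%N + 1) N0 y al_ge0 be_ge0
  cvg_albe (fun N i _ => a_ge0 N i) (fun N i _ => b_ge0 N i) supp
  (fun N i _ => a_decr N i) (fun N i _ => b_decr N i) a_leA (@a_cvg) (@b_cvg) (@sum_cvg) yA.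
by exists P; split; [exact: PP | under eq_fun do rewrite frob_funE].
Qed.

End FrobeniusLimit.

(** * Averages over Gelfand-Tsetlin patterns *)

Section PatternAverages.
Context {C : numFieldType}.

Lemma vandermonde_col_perm N (s : 'S_N) (u : 'rV[C]_N) :
  \prod_(i < N) \prod_(j < N | (i < j)%N) (col_perm s u 0 i - col_perm s u 0 j) =
  (-1) ^+ s * \prod_(i < N) \prod_(j < N | (i < j)%N) (u 0 i - u 0 j).
Proof.
have E (v : 'rV[C]_N) : \prod_(i < N) \prod_(j < N | (i < j)%N) (v 0 i - v 0 j) =
    (\prod_(i < N) \prod_(j < N | (i < j)%N) (-1)) * \det (Vandermonde N v).
  rewrite det_Vandermonde -big_split; apply: eq_bigr => i _ /=.
  by rewrite -big_split; apply: eq_bigr => j _ /=; rewrite mulN1r opprB.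
rewrite !E [RHS]mulrCA; congr (_ * _).
have -> : Vandermonde N (col_perm s u) = col_perm s (Vandermonde N u).
  by apply/matrixP => i j; rewrite !mxE.
by rewrite col_permE det_mulmx det_perm odd_permV mulrC.
Qed.

(** Symmetry is invisible in the branching definition; it holds because a permutation of the
    variables multiplies the alternant and the Vandermonde product by the same sign. *)
Lemma gt_sum_col_perm N (l : signature N) (s : 'S_N) (u : 'rV[C]_N) :
  (forall i, u 0 i != 0) ->
  gt_sum N (shifted_parts l) (coords (col_perm s u)) =
  gt_sum N (shifted_parts l) (coords u).
Proof.
pose f (v : 'rV[C]_N) := gt_sum N (shifted_parts l) (coords v).
move=> u0; have [_ fE] := is_schur_gt (C := C) l.
apply: (@is_schur_unique C N l (fun v => f (col_perm s v)) f) => //; last exact: is_schur_gt.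
split=> [|v v0 vi].
  exists [seq (1, \row_(i < N) t`_(s^-1 i)%g) | t <- gt_weights N (shifted_parts l)].
  move=> v; rewrite big_map; apply: eq_bigr => t _; rewrite mul1r.
  rewrite [RHS](reindex_inj (@perm_inj _ s)); apply: eq_bigr => i _.
  by rewrite coordsE !mxE permK.
rewrite [LHS]fE; first last.
- by move=> i j; rewrite !mxE => /vi/perm_inj.
- by move=> i; rewrite mxE.
rewrite vandermonde_col_perm invfM mulrA; congr (_ / _).
have -> : \matrix_(i < N, j < N) col_perm s v 0 i ^ (tnth (val l) j + N%:Z - j.+1%:Z) =
    row_perm s (\matrix_(i < N, j < N) v 0 i ^ (tnth (val l) j + N%:Z - j.+1%:Z)).
  by apply/matrixP => i j; rewrite !mxE.
by rewrite row_permE det_mulmx det_perm mulrAC divff ?signr_eq0 // mul1r.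
Qed.

Lemma gt_sum1 n (L : seq int) : gt_sum n L (fun=> 1) = (size (gt_weights n L))%:R :> C.
Proof.
rewrite /gt_sum (eq_bigr (fun=> 1)) => [|t _]; last first.
  by rewrite big1 // => i _; rewrite exp1rz.
by rewrite big_const_seq count_predT iter_addr_0.
Qed.

Lemma gt_sum_pad1E n k (L : seq int) (x : nat -> C) : (k <= n)%N ->
  gt_sum n L (pad1 k x) = \sum_(t <- gt_weights n L) \prod_(i < k) x i ^ t`_i.
Proof.
move=> kn; apply: eq_bigr => t _.
rewrite (big_ord_widen n (fun i => x i ^ t`_i) kn) [RHS]big_mkcond; apply: eq_bigr => i _.
by rewrite /pad1; case: ifP => // _; rewrite exp1rz.
Qed.

(** By symmetry all coordinates of a random pattern weight have the same distribution, so
    one-variable information controls each of them. *)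
Lemma sum_gt_weights N (l : signature N) (i : nat) (q : C) : (i < N)%N -> q != 0 ->
  \sum_(t <- gt_weights N (shifted_parts l)) q ^ t`_i =
  gt_sum N (shifted_parts l) (pad1 1 (fun=> q)).
Proof.
case: N l => // N l iN q0.
pose u : 'rV[C]_N.+1 := \row_j if j == ord0 then q else 1.
pose s := tperm ord0 (Ordinal iN).
have u0 j : u 0 j != 0 by rewrite mxE; case: ifP => // _; apply: oner_neq0.
rewrite -[RHS](eq_gt_sum _ (u := coords u)); last first.
  by move=> j jN; rewrite coords_ord mxE /pad1; case: j jN.
rewrite -(gt_sum_col_perm l s u0); apply: eq_bigr => t _.
rewrite (bigD1 (Ordinal iN)) // [coords _ _]coordsE !mxE tpermR eqxx big1 => [|j ji]; first by rewrite /= mulr1.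
rewrite coordsE !mxE; case: ifP => [/eqP sj|_]; last exact: exp1rz.
by case/eqP: ji; apply: (@perm_inj _ s); rewrite sj tpermR.
Qed.

End PatternAverages.

Section AverageBounds.
Context {R : realType}.
Local Notation C := (Cplx R).

Lemma gt_weights_size_gt0 N (L : seq int) : sorted >%R L -> size L = N ->
  (0 < size (gt_weights N L))%N.
Proof.
move=> sL szL; have := gt_sum1_neq0 (C := C) sL szL.
by rewrite gt_sum1 pnatr_eq0 lt0n.
Qed.

Definition gt_avg N (L : seq int) (F : seq int -> R) : R :=
  (\sum_(t <- gt_weights N L) F t) / (size (gt_weights N L))%:R.

Lemma gt_avg_le N (L : seq int) (F G : seq int -> R) : (forall t, F t <= G t) ->
  gt_avg N L F <= gt_avg N L G.
Proof. by move=> FG; rewrite ler_wpM2r ?invr_ge0 // ler_sum. Qed.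

Lemma gt_avgZ N (L : seq int) c (F : seq int -> R) :
  gt_avg N L (fun t => c * F t) = c * gt_avg N L F.
Proof. by rewrite /gt_avg -mulr_sumr mulrA. Qed.

Lemma gt_avg_sum N (L : seq int) k (F : nat -> seq int -> R) :
  gt_avg N L (fun t => \sum_(i < k) F i t) = \sum_(i < k) gt_avg N L (F i).
Proof. by rewrite /gt_avg exchange_big mulr_suml. Qed.

Lemma gt_avg_cst N (L : seq int) c : sorted >%R L -> size L = N -> gt_avg N L (fun=> c) = c.
Proof.
move=> sL szL; have := gt_weights_size_gt0 sL szL => s0.
rewrite /gt_avg big_const_seq count_predT iter_addr_0 -[c *+ _]mulr_natr mulfK //.
by rewrite pnatr_eq0 -lt0n.
Qed.

Lemma normalized_gtE N k (L : seq int) (x : nat -> C) : (k <= N)%N ->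
  normalized_gt N L (pad1 k x) = \sum_(t <- gt_weights N L)
    (size (gt_weights N L))%:R^-1 * \prod_(i < k) x i ^ t`_i.
Proof. by move=> kN; rewrite /normalized_gt gt_sum_pad1E // gt_sum1 -mulr_sumr mulrC. Qed.

Lemma modulus_normalized_gt_sub N k (L : seq int) (x y : nat -> C) : (k <= N)%N ->
  modulus (normalized_gt N L (pad1 k x) - normalized_gt N L (pad1 k y)) <=
  gt_avg N L (fun t => modulus (\prod_(i < k) x i ^ t`_i - \prod_(i < k) y i ^ t`_i)).
Proof.
move=> kN; rewrite !normalized_gtE // -sumrB /gt_avg mulr_suml.
apply: le_trans (modulus_sum _ _ _) _; apply: ler_sum => t _.
by rewrite -mulrBr modulusM modulusV modulus_nat mulrC.
Qed.

(** Since rho^|m| <= rho^m + rho^(-m), the exponential moment is at most the sum of the values at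
    rho and 1/rho, which are averages of positive numbers. *)
Lemma gt_avg_pow_le N (l : signature N) (rho B : R) i : (i < N)%N -> 1 <= rho ->
  modulus (normalized_gt N (shifted_parts l) (pad1 1 (fun=> of_real rho))) <= B ->
  modulus (normalized_gt N (shifted_parts l) (pad1 1 (fun=> of_real rho^-1))) <= B ->
  gt_avg N (shifted_parts l) (fun t => rho ^+ `|t`_i|) <= 2 * B.
Proof.
move=> iN rho1 B1 B2; have rho0 : 0 < rho by apply: lt_le_trans rho1.
set W := gt_weights N (shifted_parts l).
have avgE (q : R) : 0 < q ->
    modulus (normalized_gt N (shifted_parts l) (pad1 1 (fun=> of_real q))) =
    (\sum_(t <- W) q ^ t`_i) / (size W)%:R.
  move=> q0; rewrite /normalized_gt -(sum_gt_weights _ iN) ?of_real_eq0 ?gt_eqF //.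
  rewrite gt_sum1 modulusM modulusV modulus_nat; congr (_ / _).
  rewrite -[RHS]modulus_of_real_ge0; last by apply: sumr_ge0 => t _; apply: exprz_ge0; apply: ltW.
  rewrite rmorph_sum; congr modulus; apply: eq_bigr => t _.
  by rewrite -rmorphXz // unitfE gt_eqF.
rewrite avgE // in B1; rewrite avgE ?invr_gt0 // in B2.
apply: le_trans (_ : (\sum_(t <- W) rho ^ t`_i) / (size W)%:R +
  (\sum_(t <- W) rho^-1 ^ t`_i) / (size W)%:R <= _); last first.
  by rewrite mulrDl mul1r lerD.
rewrite -mulrDl /gt_avg ler_wpM2r ?invr_ge0 // -big_split; apply: ler_sum => t _ /=.
have pge0 (z : int) (q : R) : 0 < q -> 0 <= q ^ z by move=> q0; apply: exprz_ge0; apply: ltW.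
case: (t`_i) => n /=; first by rewrite -exprnP lerDl pge0 ?invr_gt0.
by rewrite NegzE exprz_inv opprK -exprnP lerDr pge0.
Qed.

End AverageBounds.

(** * Consequences of bounded exponential moments *)

Section ExponentialMoments.
Context {R : realType}.
Local Notation C := (Cplx R).

(** With e^(a (j+1)) = q/p and c = min(1, a), one has c (1 + n) <= 1 + a n <= e^(a n); take j-th
    powers. *)
Lemma poly_exp_bound (p q : R) j : 0 < p -> p < q ->
  exists K, 0 <= K /\ forall n : nat, (1 + n%:R) ^+ j * p ^+ n <= K * q ^+ n.
Proof.
move=> p0 pq; have q0 : 0 < q by apply: lt_trans pq.
pose a := ln (q / p) / j.+1%:R.
have qp1 : 1 < q / p by rewrite ltr_pdivlMr // mul1r.
have a0 : 0 < a by rewrite divr_gt0 // ln_gt0.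
have eq : expR (a * j.+1%:R) = q / p by rewrite /a divfK // lnK // posrE divr_gt0.
clearbody a.
pose c := Num.min 1 a; have c0 : 0 < c by rewrite lt_min ltr01.
exists (c^-1 ^+ j); split=> [|n]; first by rewrite exprn_ge0 // invr_ge0 ltW.
have -> : q = (q / p) * p by rewrite divfK // gt_eqF.
rewrite [(q / p * p) ^+ n]exprMn mulrA; apply: ler_wpM2r; first by rewrite exprn_ge0 // ltW.
rewrite -eq exprVn mulrC ler_pdivlMr ?exprn_gt0 // -exprMn.
apply: (@le_trans _ _ (expR (a * n%:R) ^+ j)).
  apply: lerXn2r; rewrite ?nnegrE ?expR_ge0 ?mulr_ge0 ?addr_ge0 ?(ltW c0) //.
  apply: le_trans (expR_ge1Dx _); rewrite mulrDl mul1r; apply: lerD; first by rewrite ge_min lexx.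
  by rewrite mulrC ler_wpM2r // ge_min lexx orbT.
rewrite -!expRM_natr ler_expR -!mulrA ler_wpM2l ?(ltW a0) // -!natrM ler_nat.
by rewrite mulnC leq_mul.
Qed.

Lemma le_prod_one (k : nat) (f : nat -> R) i : (i < k)%N -> (forall j, 1 <= f j) ->
  f i <= \prod_(j < k) f j.
Proof.
move=> ik f1; rewrite (bigD1 (Ordinal ik)) //= ler_peMr ?(le_trans ler01) //.
by apply: (big_ind (fun x => 1 <= x)) => // x y x1 y1; rewrite -[1]mulr1 ler_pM.
Qed.

(** The largest factor to the power k dominates the product. This reduces a joint exponential moment
    of k coordinates to moments of single ones. *)
Lemma prod_le_sum_pow (k : nat) (f : nat -> R) : (forall j, 0 <= f j) ->
  \prod_(j < k) f j <= 1 + \sum_(j < k) f j ^+ k.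
Proof.
move=> f0; case: k => [|k]; first by rewrite !big_ord0 addr0.
pose i := [arg max_(i > (ord0 : 'I_k.+1)) f i]%O.
have fi (j : 'I_k.+1) : f j <= f i by rewrite /i; case: arg_maxP => // i' _ /(_ j isT).
apply: (@le_trans _ _ (f i ^+ k.+1)).
  have -> : f i ^+ k.+1 = \prod_(j < k.+1) f i by rewrite prodr_const card_ord.
  by apply: ler_prod => j _; rewrite f0 fi.
rewrite [X in _ <= _ + X](bigD1 i) //= addrCA lerDl addr_ge0 // sumr_ge0 // => j _.
by rewrite exprn_ge0.
Qed.

Lemma taylor_sum_seq (I : eqType) (s : seq I) (z : C) r (F : I -> C -> C) (M : I -> R) :
  0 < r -> (forall i, i \in s -> exists c, taylor z r (F i) c (M i)) ->
  exists c, taylor z r (fun x => \sum_(i <- s) F i x) c (\sum_(i <- s) M i).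
Proof.
move=> r0; elim: s => [|i s IHs] Fs.
  exists (fun j => if j == 0%N then 0 else 0); rewrite big_nil -[X in taylor _ _ _ _ X]modulus0.
  by apply: eq_taylor (taylor_cst z 0 r0) => h _; rewrite big_nil.
have [|c tc] := IHs; first by move=> j js; apply: Fs; rewrite inE js orbT.
have [|d td] := Fs i; first exact: mem_head.
exists (fun j => d j + c j); rewrite big_cons.
by apply: eq_taylor (taylorD r0 td tc) => h _; rewrite big_cons.
Qed.

Lemma taylor_expz_unit (z : C) (r rho : R) (m : int) : modulus z = 1 -> 0 < r -> r < 1 ->
  1 + r <= rho -> (1 - r)^-1 <= rho -> exists c, taylor z r (fun x => x ^ m) c (rho ^+ `|m|).
Proof.
move=> z1 r0 r1 rho1 rho2.
have pow (n : nat) (y : C -> C) : (exists c, taylor z r y c rho) ->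
    exists c, taylor z r (fun x => y x ^+ n) c (rho ^+ n).
  move=> ty; have [//|c] := @taylor_prod R _ (index_enum 'I_n) z r (fun=> y) (fun=> rho) r0.
  rewrite prodr_const card_ord => tc; exists c; apply: eq_taylor tc => h _.
  by rewrite prodr_const card_ord.
case: m => n.
  apply: pow; exists (fun j => if j == 0%N then 0 + 1 * z else if j == 1%N then 1 else 0).
  have := taylor_affine z 0 1 r0.
  rewrite add0r mul1r z1 modulus1 mul1r => /(taylor_le rho1).
  by apply: eq_taylor => h _; rewrite add0r mul1r.
have r1' : modulus (1 : C) * r < modulus (0 + 1 * z) by rewrite add0r !mul1r modulus1 mul1r z1.
have := taylor_inv r0 r1'; rewrite add0r mul1r z1 modulus1 mul1r => /(taylor_le rho2) t.
have [|c tc] := pow n.+1 (fun x => x^-1).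
  by eexists; apply: eq_taylor t => h _; rewrite add0r mul1r.
exists c; apply: eq_taylor tc => h _.
by rewrite NegzE -exprnN exprVn.
Qed.

Lemma modulus_expn_sub (rho : R) n (x y : C) : 1 <= rho ->
  modulus x <= rho -> modulus y <= rho ->
  modulus (x ^+ n - y ^+ n) <= n%:R * rho ^+ n * modulus (x - y).
Proof.
move=> rho1 xr yr; have rho0 : 0 <= rho by apply: le_trans rho1.
elim: n => [|n IHn]; first by rewrite !expr0 subrr modulus0 !mul0r.
have -> : x ^+ n.+1 - y ^+ n.+1 = x * (x ^+ n - y ^+ n) + (x - y) * y ^+ n.
  by rewrite !exprS; ring.
apply: le_trans (modulusD _ _) _; rewrite !modulusM modulusX.
have -> : n.+1%:R * rho ^+ n.+1 * modulus (x - y) =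
    rho * (n%:R * rho ^+ n * modulus (x - y)) + rho ^+ n.+1 * modulus (x - y).
  by rewrite -natr1 exprS; ring.
apply: lerD.
  by apply: ler_pM; rewrite ?modulus_ge0.
rewrite mulrC ler_wpM2r ?modulus_ge0 //.
apply: (@le_trans _ _ (rho ^+ n)); first by apply: lerXn2r; rewrite ?nnegrE ?modulus_ge0.
by rewrite exprS ler_peMl ?exprn_ge0.
Qed.

Lemma modulus_expz_sub (rho : R) (m : int) (x y : C) : 1 <= rho ->
  rho^-1 <= modulus x <= rho -> rho^-1 <= modulus y <= rho ->
  modulus (x ^ m - y ^ m) <= `|m|%:R * rho ^+ `|m| * (rho ^+ 2 * modulus (x - y)).
Proof.
move=> rho1 /andP[xl xr] /andP[yl yr].
have rho0 : 0 < rho by apply: lt_le_trans rho1.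
have rho_inv (w : C) : rho^-1 <= modulus w -> w != 0 /\ modulus w^-1 <= rho.
  move=> wl; have w0 : 0 < modulus w by apply: lt_le_trans wl; rewrite invr_gt0.
  by rewrite -modulus_gt0 w0 modulusV -[leRHS]invrK lef_pV2 ?posrE ?invr_gt0.
case: m => n /=.
  apply: le_trans (modulus_expn_sub n rho1 xr yr) _; apply: ler_wpM2l.
    by rewrite mulr_ge0 ?exprn_ge0 ?(ltW rho0).
  by rewrite ler_peMl ?modulus_ge0 // exprn_ege1.
have [x0 xi] := rho_inv _ xl; have [y0 yi] := rho_inv _ yl.
rewrite NegzE -!exprnN -!exprVn; apply: le_trans (modulus_expn_sub _ rho1 xi yi) _.
apply: ler_wpM2l; first by rewrite mulr_ge0 ?exprn_ge0 ?(ltW rho0).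
have -> : x^-1 - y^-1 = (y - x) * (x^-1 * y^-1) by field; rewrite x0 y0.
rewrite modulusM modulusB mulrC ler_wpM2r ?modulus_ge0 // modulusM expr2.
by apply: ler_pM; rewrite ?modulus_ge0.
Qed.

Section Moments.
Variables (lambda : forall N : nat, signature N) (rho B : R) (N0 : nat).
Hypotheses (N00 : (0 < N0)%N) (rho1 : 1 < rho)
  (avgB : forall N i, (N0 <= N)%N -> (i < N)%N ->
    gt_avg N (shifted_parts (lambda N)) (fun t => rho ^+ `|t`_i|) <= B).

Let L N := shifted_parts (lambda N).
Let S N (x : C) : C := normalized_gt N (L N) (pad1 1 (fun=> x)).
Let rho0 : 0 < rho. Proof. by apply: lt_trans rho1. Qed.

(** S_N is an average of powers x^m, each of Taylor norm at most rho^|m| at any point of the unit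
    circle; the moment bound thus carries information obtained near 1 to the whole circle. *)
Lemma taylor_normalized_gt (z : C) r N : (N0 <= N)%N -> modulus z = 1 ->
  0 < r -> r < 1 -> 1 + r <= rho -> (1 - r)^-1 <= rho -> exists c, taylor z r (S N) c B.
Proof.
move=> N0N z1 r0 r1 rho2 rho3; have Npos : (0 < N)%N by apply: leq_trans N0N.
have [|c tc] := @taylor_sum_seq _ (gt_weights N (L N)) z r
   (fun t x => (size (gt_weights N (L N)))%:R^-1 * x ^ t`_0)
   (fun t => (size (gt_weights N (L N)))%:R^-1 * rho ^+ `|t`_0|) r0.
  move=> t _; have [c tc] := taylor_expz_unit t`_0 z1 r0 r1 rho2 rho3.
  have := taylorZ (size (gt_weights N (L N)))%:R^-1 tc.
  by rewrite modulusV modulus_nat => tc'; eexists; apply: tc'.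
exists c; apply: (@taylor_le _ _ _ _ _ _ _ (avgB N0N Npos)).
rewrite /gt_avg mulrC mulr_sumr; apply: eq_taylor tc => h _.
by rewrite /S normalized_gtE //; apply: eq_bigr => t _; rewrite big_ord1.
Qed.

Definition gt_laurent N : seq (C * int) :=
  [seq ((size (gt_weights N (L N)))%:R^-1, t`_0) | t <- gt_weights N (L N)].

Lemma leval_gt_laurent N x : (N0 <= N)%N -> leval (gt_laurent N) x = S N x.
Proof.
move=> N0N; rewrite /S normalized_gtE; last by apply: leq_trans N0N.
by rewrite /leval big_map; apply: eq_bigr => t _; rewrite big_ord1.
Qed.

Lemma lbounded_gt_laurent p : 1 <= p -> p < rho -> lbounded p N0 gt_laurent.
Proof.
move=> p1 pr j; have p0 : 0 < p by apply: lt_le_trans p1.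
have [K [K0 hK]] := poly_exp_bound j p0 pr.
exists (K * B) => N N0N; have Npos : (0 < N)%N by apply: leq_trans N0N.
apply: le_trans (ler_wpM2l K0 (avgB N0N Npos)).
rewrite -gt_avgZ /gt_avg mulr_suml /lnorm big_map; apply: ler_sum => t _ /=.
by rewrite modulusV modulus_nat mulrC ler_wpM2r.
Qed.

(** Two monomials of exponent t differ by at most p^2 times the sum of |x_i - y_i| times the product
    of (1 + |t_j|) p^(2|t_j|): one p^|t_j| bounds the unchanged factors, the rest the difference of
    powers. That product is at most K^k times the product of theta^|t_j|, hence K^k (1 + sum of
    rho^|t_j|), whose average is bounded. *)
Lemma normalized_gt_lipschitz (k : nat) (p theta : R) : 1 <= p -> p ^+ 2 < theta ->
  theta ^+ k <= rho -> exists K, 0 <= K /\ forall N (x y : nat -> C),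
    (N0 <= N)%N -> (k <= N)%N ->
    (forall i, (i < k)%N -> p^-1 <= modulus (x i) <= p) ->
    (forall i, (i < k)%N -> p^-1 <= modulus (y i) <= p) ->
    modulus (normalized_gt N (L N) (pad1 k x) - normalized_gt N (L N) (pad1 k y)) <=
    K * \sum_(i < k) modulus (x i - y i).
Proof.
move=> p1 pt tr; have p0 : 0 < p by apply: lt_le_trans p1.
have p20 : 0 < p ^+ 2 by rewrite exprn_gt0.
have [K [K0 hK]] := poly_exp_bound 1 p20 pt.
have theta0 : 0 <= theta by apply: ltW; apply: lt_trans pt.
have B0 : 0 <= B.
  apply: le_trans (avgB (leqnn N0) N00); rewrite divr_ge0 // sumr_ge0 // => t _.
  by rewrite exprn_ge0 // ltW.
exists (K ^+ k * (1 + k%:R * B) * p ^+ 2); split.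
  by rewrite !mulr_ge0 ?exprn_ge0 ?addr_ge0 ?mulr_ge0 ?(ltW p0).
move=> N x y N0N kN xp yp; apply: le_trans (modulus_normalized_gt_sub _ _ _ kN) _.
set D := \sum_(i < k) _.
have D0 : 0 <= D by apply: sumr_ge0 => i _; apply: modulus_ge0.
have expz_le (w : C) (m : int) : p^-1 <= modulus w <= p -> modulus (w ^ m) <= p ^+ `|m|.
  move=> /andP[wl wu]; rewrite modulusXz; case: m => n /=.
    by apply: lerXn2r; rewrite ?nnegrE ?modulus_ge0 ?(ltW p0).
  rewrite NegzE -exprnN -exprVn; apply: lerXn2r; rewrite ?nnegrE ?invr_ge0 ?modulus_ge0 ?(ltW p0) //.
  by rewrite -[leRHS]invrK lef_pV2 ?posrE ?invr_gt0 // (lt_le_trans _ wl) ?invr_gt0.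
have bound t : modulus (\prod_(i < k) x i ^ t`_i - \prod_(i < k) y i ^ t`_i) <=
    (K ^+ k * p ^+ 2 * D) * (1 + \sum_(i < k) rho ^+ `|t`_i|).
  pose m i := p ^+ `|t`_i|; pose g i := (1 + `|t`_i|%:R) * m i.
  have m1 i : 1 <= m i by rewrite exprn_ege1.
  have g1 i : 1 <= g i by rewrite -[1]mulr1 ler_pM // lerDl.
  have := @modulus_prod_sub R (index_iota 0 k) (fun i => x i ^ t`_i) (fun i => y i ^ t`_i) m.
  rewrite !big_mkord => h; apply: le_trans (h _ _ _) _.
  - by move=> i _; apply: m1.
  - by move=> i; rewrite mem_index_iota => /andP[_ /xp]; apply: expz_le.
  - by move=> i; rewrite mem_index_iota => /andP[_ /yp]; apply: expz_le.
  rewrite mulr_sumr; apply: (@le_trans _ _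
    (\sum_(i < k) (\prod_(j < k) m j * \prod_(j < k) g j) * (p ^+ 2 * modulus (x i - y i)))).
    apply: ler_sum => i _; rewrite -mulrA ler_wpM2l ?prodr_ge0 //.
      by move=> j _; apply: le_trans (m1 j).
    apply: le_trans (modulus_expz_sub _ p1 (xp i (ltn_ord i)) (yp i (ltn_ord i))) _.
    apply: ler_wpM2r; first by rewrite mulr_ge0 ?exprn_ge0 ?modulus_ge0 ?(ltW p0).
    apply: le_trans (le_prod_one (ltn_ord i) g1).
    by rewrite /g ler_wpM2r ?lerDr // (le_trans _ (m1 i)).
  rewrite -mulr_sumr -mulr_sumr -/D -big_split /=.
  rewrite [leRHS](_ : _ = K ^+ k * (1 + \sum_(i < k) rho ^+ `|t`_i|) * (p ^+ 2 * D)); last by ring.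
  apply: ler_wpM2r.
    by rewrite mulr_ge0 ?exprn_ge0 ?(ltW p0).
  apply: (@le_trans _ _ (\prod_(i < k) (K * theta ^+ `|t`_i|))).
    apply: ler_prod => i _; apply/andP; split.
      by rewrite mulr_ge0 // (le_trans ler01).
    have := hK (absz t`_i); rewrite expr1 -exprM mulnC exprM; apply: le_trans.
    by rewrite /g /m le_eqVlt; apply/orP; left; apply/eqP; rewrite expr2; ring.
  rewrite big_split prodr_const card_ord /=; apply: ler_wpM2l; first by rewrite exprn_ge0.
  apply: le_trans (@prod_le_sum_pow k (fun i => theta ^+ `|t`_i|) _) _.
    by move=> j; rewrite exprn_ge0.
  rewrite lerD2l; apply: ler_sum => i _; rewrite -exprM mulnC exprM.
  by apply: lerXn2r; rewrite ?nnegrE ?exprn_ge0 ?(ltW rho0).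
apply: le_trans (gt_avg_le _ _ bound) _.
rewrite gt_avgZ.
have -> : K ^+ k * (1 + k%:R * B) * p ^+ 2 * D = (K ^+ k * p ^+ 2 * D) * (1 + k%:R * B) by ring.
apply: ler_wpM2l; first by rewrite !mulr_ge0 ?exprn_ge0 ?(ltW p0).
have -> : gt_avg N (shifted_parts (lambda N)) (fun t => 1 + \sum_(i < k) rho ^+ `|t`_i|) =
    1 + \sum_(i < k) gt_avg N (L N) (fun t => rho ^+ `|t`_i|).
  rewrite -(gt_avg_sum _ _ _ (fun i t => rho ^+ `|t`_i|)).
  rewrite -[X in _ = X + _](@gt_avg_cst R N (L N) 1) ?sorted_shifted_parts ?size_shifted_parts //.
  by rewrite /gt_avg -mulrDl -big_split.
rewrite lerD2l -[k in k%:R]card_ord -sumr_const mulr_suml; apply: ler_sum => i _.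
by rewrite mul1r avgB // (leq_trans (ltn_ord i)).
Qed.

End Moments.
End ExponentialMoments.

(** * Convergence of the one-variable function on an annulus *)

Section OneVariableLimit.
Context {R : realType}.
Local Notation C := (Cplx R).

Section HalfTaylor.
Variables (d : nat) (a b : nat -> R) (z : C) (r A B : R).
Hypotheses (z1 : modulus z = 1) (r0 : 0 < r) (r2 : r <= 1 / 2) (Ar : (1 + A) * r <= 1 / 2)
  (ab_bounds : forall i, (i < d)%N -> 0 <= a i <= A /\ 0 <= b i <= 1)
  (sumB : \sum_(i < d) (a i + b i) <= B).

Let half_taylor (y : C -> C) :
  (forall a b : R, 0 <= a -> (1 + a) * r <= 1 / 2 -> 0 <= b <= 1 ->
     exists c, taylor z r (fun x => frob_factor a b (y x)) c (expR (2 * (a + b)))) ->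
  exists c, taylor z r (fun x => \prod_(i < d) frob_factor (a i) (b i) (y x)) c (expR (2 * B)).
Proof.
move=> yab; have [|c tc] := @taylor_prod R _ (index_enum 'I_d) z r
    (fun i x => frob_factor (a i) (b i) (y x)) (fun i => expR (2 * (a i + b i))) r0.
  move=> i _; have [/andP[a0 aA] bi] := ab_bounds (ltn_ord i).
  apply: yab => //; apply: le_trans Ar; rewrite ler_wpM2r ?(ltW r0) //.
  by rewrite lerD2l.
exists c; apply: taylor_le tc; rewrite -expR_sum ler_expR -mulr_sumr.
by rewrite ler_wpM2l.
Qed.

Lemma taylor_half_pos : exists c,
  taylor z r (fun x => \prod_(i < d) frob_factor (a i) (b i) (x - 1)) c (expR (2 * B)).
Proof. by apply: half_taylor => a' b' *; apply: taylor_factor_pos. Qed.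

Lemma taylor_half_neg : exists c,
  taylor z r (fun x => \prod_(i < d) frob_factor (a i) (b i) (x^-1 - 1)) c (expR (2 * B)).
Proof. by apply: half_taylor => a' b' *; apply: taylor_factor_neg. Qed.

End HalfTaylor.

Lemma neg_factorE (a b : R) (x : C) : x != 0 -> frob_factor a b (x^-1 - 1) =
  (1 + (1 - of_real b) * (x - 1)) / (1 + (1 + of_real a) * (x - 1)).
Proof.
move=> x0; have xx : x * x^-1 = 1 by rewrite divff.
have -> : 1 + (1 - of_real b) * (x - 1) = (1 + of_real b * (x^-1 - 1)) * x.
  by rewrite -{1}xx; field.
have -> : 1 + (1 + of_real a) * (x - 1) = (1 - of_real a * (x^-1 - 1)) * x.
  by rewrite -{1}xx; field.
by rewrite -mulf_div divff // mulr1.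
Qed.

Variables (alphap betap alpham betam : nat -> R) (gammap gammam : R).
Variable lambda : forall N : nat, signature N.
Hypotheses (alphap_ge0 : forall i, 0 <= alphap i) (betap_ge0 : forall i, 0 <= betap i)
  (alpham_ge0 : forall i, 0 <= alpham i) (betam_ge0 : forall i, 0 <= betam i)
  (sump_cvg : cvgn (series (fun i => alphap i + betap i)))
  (summ_cvg : cvgn (series (fun i => alpham i + betam i)))
  (pp_cvg : forall i,
    frob_p R (pos_diagram (lambda N)) i / N%:R @[N --> \oo] --> alphap i)
  (qp_cvg : forall i,
    frob_q R (pos_diagram (lambda N)) i / N%:R @[N --> \oo] --> betap i)
  (pm_cvg : forall i,
    frob_p R (neg_diagram (lambda N)) i / N%:R @[N --> \oo] --> alpham i)
  (qm_cvg : forall i,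
    frob_q R (neg_diagram (lambda N)) i / N%:R @[N --> \oo] --> betam i)
  (frob_sump_cvg :
    frob_sum R (pos_diagram (lambda N)) / N%:R @[N --> \oo] -->
      limn (series (fun i => alphap i + betap i)) + gammap)
  (frob_summ_cvg :
    frob_sum R (neg_diagram (lambda N)) / N%:R @[N --> \oo] -->
      limn (series (fun i => alpham i + betam i)) + gammam).

Local Notation Phi := (@Phi_infty R alphap betap alpham betam gammap gammam).

Definition frob_product N (x : C) : C :=
  frob_fun 0 N (pos_diagram (lambda N)) (x - 1) *
  frob_fun 1 N (neg_diagram (lambda N)) (x^-1 - 1).

Lemma Phi_inftyE (x P Q : C) : x != 0 ->
  partial_product alphap betap (x - 1) @ \oo --> P ->
  partial_product alpham betam (x^-1 - 1) @ \oo --> Q ->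
  Phi x = (cexp (of_real gammap * (x - 1)) * P) * (cexp (of_real gammam * (x^-1 - 1)) * Q).
Proof.
move=> x0 hP hQ; rewrite /Phi_infty cexpD.
have -> : limn (fun n => \prod_(0 <= i < n)
    ((1 + of_real (betap i) * (x - 1)) / (1 - of_real (alphap i) * (x - 1)) *
     ((1 + (1 - of_real (betam i)) * (x - 1)) /
      (1 + (1 + of_real (alpham i)) * (x - 1))))) = P * Q.
  apply: cvg_lim; first exact: norm_hausdorff.
  have -> : (fun n => \prod_(0 <= i < n)
    ((1 + of_real (betap i) * (x - 1)) / (1 - of_real (alphap i) * (x - 1)) *
     ((1 + (1 - of_real (betam i)) * (x - 1)) /
      (1 + (1 + of_real (alpham i)) * (x - 1))))) =
     (fun n => partial_product alphap betap (x - 1) n *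
               partial_product alpham betam (x^-1 - 1) n).
    apply/funext => n; rewrite /partial_product -big_split; apply: eq_bigr => i _ /=.
    by rewrite neg_factorE.
  by apply: cvgnM; [exact: hP | exact: hQ].
ring.
Qed.

Lemma frob_product_limit : exists (r M : R) (N0 : nat), [/\ 0 < r < 1 / 2, (0 < N0)%N,
  forall N z, (N0 <= N)%N -> modulus z = 1 -> exists c, taylor z r (frob_product N) c M &
  forall x, 1 - r < modulus x < 1 + r -> (frob_product ^~ x) @ \oo --> Phi x].
Proof.
have [N1 [B1 [N10 [bd1 lim1]]]] := @frob_fun_limit R 0 (fun N => pos_diagram (lambda N))
  alphap betap gammap isT (fun N => sorted_pos_diagram (lambda N))
  (fun N => size_pos_diagram (lambda N)) alphap_ge0 betap_ge0 sump_cvg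
  (@pp_cvg) (@qp_cvg) (@frob_sump_cvg).
have [N2 [B2 [N20 [bd2 lim2]]]] := @frob_fun_limit R 1 (fun N => neg_diagram (lambda N))
  alpham betam gammam isT (fun N => sorted_neg_diagram (lambda N))
  (fun N => size_neg_diagram (lambda N)) alpham_ge0 betam_ge0 summ_cvg
  (@pm_cvg) (@qm_cvg) (@frob_summ_cvg).
pose A := (alphap 0%N + 1) + (alpham 0%N + 1).
have A1 : alphap 0%N + 1 <= A by rewrite lerDl addr_ge0.
have A2 : alpham 0%N + 1 <= A by rewrite lerDr addr_ge0.
have A0 : 0 <= A by rewrite !addr_ge0.
have A10 : 0 < 1 + A by rewrite ltr_pwDl.
(* Then (1 + A) r = 1/4, which serves both the Taylor bounds (at most 1/2 needed) and the annulus
   bound for 1/x (at most 1/4 needed). *)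
pose r := (4 * (1 + A))^-1.
have r0 : 0 < r by rewrite invr_gt0 mulr_gt0.
have Ar : (1 + A) * r = 1 / 4 by rewrite /r invfM mulrCA divff ?gt_eqF // mulr1 div1r.
have rA : A * r <= 1 / 4 by rewrite -Ar ler_wpM2r ?(ltW r0) // lerDr.
have r4 : r <= 1 / 4 by rewrite -Ar -[leLHS]mul1r ler_wpM2r ?(ltW r0) // lerDl.
have r2 : r <= 1 / 2 by lra.
have Ar2 : (1 + A) * r <= 1 / 2 by rewrite Ar; lra.
have le_trans_bounds (a A' : R) (Q : Prop) : A' <= A -> 0 <= a <= A' /\ Q -> 0 <= a <= A /\ Q.
  by move=> A'A [/andP[-> aA'] HQ]; rewrite (le_trans aA').
exists r, (expR (2 * B1) * expR (2 * B2)), (maxn N1 N2); split.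
- by rewrite r0; lra.
- by rewrite leq_max N10.
- move=> N z; rewrite geq_max => /andP[N1N N2N] z1.
  have [s1 b1] := bd1 _ N1N; have [s2 b2] := bd2 _ N2N.
  have [c1 t1] := taylor_half_pos z1 r0 r2 Ar2 (fun i id => le_trans_bounds _ _ _ A1 (b1 i id)) s1.
  have [c2 t2] := taylor_half_neg z1 r0 r2 Ar2 (fun i id => le_trans_bounds _ _ _ A2 (b2 i id)) s2.
  have := taylorM r0 t1 t2.
  by set c := (X in taylor _ _ _ X _) => tc; exists c.
move=> x /andP[xl xu].
have x0 : x != 0 by rewrite -modulus_gt0; apply: lt_trans xl; lra.
have [|P [hP XP]] := lim1 (x - 1).
  move=> t /andP[t0 tA]; apply: (le_modulus_affine t0 xu).
  apply: le_trans (_ : A * r <= _); last by lra.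
  by rewrite ler_wpM2r ?(ltW r0) // (le_trans tA).
have [|Q [hQ XQ]] := lim2 (x^-1 - 1).
  move=> t /andP[t0 tA]; apply: (le_modulus_affine_inv t0 r0 r2 xl).
  apply: le_trans rA.
  by rewrite ler_wpM2r ?(ltW r0) // (le_trans tA).
rewrite (Phi_inftyE x0 hP hQ); apply: cvgnM; [exact: XP | exact: XQ].
Qed.

Let L N := shifted_parts (lambda N).
Let S N (x : C) : C := normalized_gt N (L N) (pad1 1 (fun=> x)).

Lemma schur_one_variable_limit : exists (rho B r : R) (N0 : nat), [/\ 1 < rho, 0 < r < 1,
  (0 < N0)%N,
  forall N i, (N0 <= N)%N -> (i < N)%N -> gt_avg N (L N) (fun t => rho ^+ `|t`_i|) <= B &
  forall x, 1 - r < modulus x < 1 + r -> (S ^~ x) @ \oo --> Phi x].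
Proof.
have [r [M [N0 [/andP[r0 r2] N00 tG limG]]]] := frob_product_limit.
have r01 : 0 < r < 1 by rewrite r0; lra.
have sL N : sorted >%R (L N) by apply: sorted_shifted_parts.
have szL N : size (L N) = N by apply: size_shifted_parts.
have tG1 N : (N0 <= N)%N -> exists g, taylor 1 r (frob_product N) g M.
  by move=> N0N; apply: tG => //; apply: modulus1.
have GE N : (N0 <= N)%N -> exists delta : R, 0 < delta /\
    forall h, modulus h < delta -> frob_product N (1 + h) = pf_sum N (L N) (h / N%:R).
  move=> N0N; have [d [d0 dE]] := @frob_fun_near1 R _ (lambda N) (leq_trans N00 N0N).
  by exists d; split=> // h /dE <-; rewrite /frob_product addrAC subrr add0r.
have tS := taylor_schur N00 sL szL r01 tG1 GE.
(* Both rho and 1/rho lie within r/2 of 1, where [taylor_schur] bounds S_N. The radius r1 = 1 -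
   1/rho satisfies 1 + r1 <= rho and 1/(1 - r1) = rho, as [taylor_normalized_gt] demands. *)
pose rho : R := 1 + r / 4; have r40 : 0 < r / 4 by rewrite divr_gt0.
have rho1 : 1 < rho by rewrite ltrDl.
have rho0 : 0 < rho by apply: lt_trans rho1.
pose r1 := 1 - rho^-1.
have rhoV : rho^-1 < 1 by rewrite invf_lt1.
have r10 : 0 < r1 by rewrite subr_gt0.
have r11 : r1 < 1 by rewrite ltrBlDr ltrDl invr_gt0.
have r1E : r1 = (rho - 1) * rho^-1 by rewrite mulrBl divff ?gt_eqF // mul1r.
have r14 : r1 <= r / 4.
  by rewrite r1E /rho [1 + _ - 1]addrAC subrr add0r ler_piMr ?(ltW r40) // ltW.
have avgB N i : (N0 <= N)%N -> (i < N)%N ->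
    gt_avg N (L N) (fun t => rho ^+ `|t`_i|) <= 2 * (2 * M).
  move=> N0N iN; apply: gt_avg_pow_le => //; first exact: ltW.
    have -> : of_real rho = 1 + of_real (r / 4) by rewrite rmorphD rmorph1.
    apply: (@taylor_bound _ _ _ _ _ _ (of_real (r / 4)) _ (tS N N0N)).
      by rewrite divr_gt0.
    by rewrite modulus_of_real_ge0 ?(ltW r40) //; lra.
  have -> : of_real rho^-1 = 1 + of_real (- r1).
    by rewrite rmorphN rmorphB rmorph1 opprB addrCA subrr addr0.
  apply: (@taylor_bound _ _ _ _ _ _ (of_real (- r1)) _ (tS N N0N)).
    by rewrite divr_gt0.
  by rewrite rmorphN modulusN modulus_of_real_ge0 ?(ltW r10) //; lra.
exists rho, (2 * (2 * M)), r1, N0; split=> //; first by rewrite r10.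
have rho2 : 1 + r1 <= rho by rewrite /rho lerD2l.
have rho3 : (1 - r1)^-1 <= rho by rewrite /r1 subKr invrK.
have vanish := schur_minus_product_vanishing N00 sL szL r01 tG1 GE.
have tD N z : (N0 <= N)%N -> modulus z = 1 ->
    exists c, taylor z r1 (fun x => S N x - frob_product N x) c
      (2 * (2 * M) + modulus (-1 : C) * M).
  move=> N0N z1; have [g tg] := tG N z N0N z1.
  have [c tc] := taylor_normalized_gt N00 avgB N0N z1 r10 r11 rho2 rho3.
  have r1r : r1 <= r by lra.
  have := taylorD r10 tc (taylorZ (-1) (taylor_shrink r10 r1r tg)).
  set e := (X in taylor _ _ _ X _) => te; exists e.
  by apply: eq_taylor te => h _; rewrite mulN1r.
move=> x xr; have [xl xu] := andP xr.
have x0 : x != 0 by rewrite -modulus_gt0; apply: lt_trans xl; rewrite subr_gt0.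
have D0 := locally_vanishing_annulus r10 tD vanish xr x0.
have Gx : frob_product ^~ x @ \oo --> Phi x.
  by apply: limG; apply/andP; split; [apply: le_lt_trans xl | apply: lt_le_trans xu _]; lra.
have -> : S ^~ x = fun N => (S N x - frob_product N x) + frob_product N x.
  by apply/funext => N; rewrite subrK.
by rewrite -[Phi x]add0r; apply: cvgD; [exact: D0 | exact: Gx].
Qed.

End OneVariableLimit.

(** * Uniform convergence *)

Section Nets.
Context {R : realType}.
Local Notation C := (Cplx R).

(* The real parts of the points grid k n i a b lie in a coset of Z / n which  *)
(* depends on i and does not contain 1.                                       *)
Definition grid (k n i a b : nat) : C :=
  (((k.+1 * a + i.+1)%:R / (k.+1 * n)%:R - 2 : R) +i* (b%:R / n%:R - 2 : R))%C.

Lemma grid_neq (k n i j a b a' b' : nat) : (0 < n)%N -> (i < k)%N -> (j < k)%N ->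
  grid k n i a b = grid k n j a' b' -> i = j.
Proof.
move=> n0 ik jk [/addIr E _].
have kn0 : (k.+1 * n)%:R != 0 :> R by rewrite pnatr_eq0 muln_eq0 -!lt0n.
move: E => /(mulIf (invr_neq0 kn0))/eqP; rewrite eqr_nat => /eqP E.
have := congr1 (modn^~ k.+1) E; rewrite !(mulnC k.+1) !modnMDl !modn_small ?ltnS //.
by case.
Qed.

Lemma grid_neq1 (k n i a b : nat) : (0 < n)%N -> (i < k)%N -> grid k n i a b != 1.
Proof.
move=> n0 ik; apply/eqP => -[E _].
have kn0 : (k.+1 * n)%:R != 0 :> R by rewrite pnatr_eq0 muln_eq0 -!lt0n.
have /eqP : (k.+1 * a + i.+1)%:R = (3 * (k.+1 * n))%:R :> R.
  rewrite natrM; apply: (canRL (mulfVK kn0)).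
  by rewrite -(subrK 2 (_ / _)) E; ring.
rewrite eqr_nat => /eqP E'; have := congr1 (modn^~ k.+1) E'.
rewrite mulnCA (mulnC k.+1 a) modnMDl modn_small ?ltnS // (mulnC k.+1) modnMl //.
Qed.

(** Take a to be the integer part of n (s + 2), which is at most 4 n; the offset (i+1)/(k+1) lies
    between 0 and 1, so the shifted point is still within one mesh. *)
Lemma near_coset (n k i : nat) (s : R) : (0 < n)%N -> (i < k)%N -> `|s| <= 2 ->
  exists a, (a < (4 * n).+1)%N /\
    `|s - ((k.+1 * a + i.+1)%:R / (k.+1 * n)%:R - 2)| <= n%:R^-1 /\
    `|s - (a%:R / n%:R - 2)| <= n%:R^-1.
Proof.
move=> n0 ik; rewrite ler_norml => /andP[s1 s2].
have nR : 0 < n%:R :> R by rewrite ltr0n.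
have kR : 0 < k.+1%:R :> R by rewrite ltr0n.
pose v := n%:R * (s + 2); have v0 : 0 <= v by rewrite mulr_ge0 //; lra.
have /andP[a1 a2] := truncn_itv v0; set a := Num.truncn v in a1 a2.
have sE : s = v / n%:R - 2 by rewrite /v mulrC mulKf ?gt_eqF // addrK.
exists a; split.
  rewrite ltnS -(ler_nat R); apply: le_trans a1 _; rewrite natrM mulrC ler_wpM2l //; lra.
have close t : a%:R <= t <= a%:R + 1 -> `|s - (t / n%:R - 2)| <= n%:R^-1.
  move=> /andP[t1 t2]; rewrite sE opprB addrA subrK -mulrBl normrM normfV normr_nat.
  rewrite -[leRHS]mul1r ler_wpM2r ?invr_ge0 // ler_norml.
  rewrite -natr1 in a2; lra.
split; last by apply: close; lra.
have -> : (k.+1 * a + i.+1)%:R / (k.+1 * n)%:R = (a%:R + i.+1%:R / k.+1%:R) / n%:R :> R.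
  by rewrite natrD !natrM; field; rewrite !gt_eqF.
apply: close; rewrite lerDl divr_ge0 //= lerD2l ler_pdivrMr // mul1r ler_nat.
exact: ltnW.
Qed.

Lemma near_grid (n k i : nat) (x : C) : (0 < n)%N -> (i < k)%N -> modulus x <= 2 ->
  exists a b : 'I_(4 * n).+1, modulus (x - grid k n i a b) <= 2 / n%:R.
Proof.
move=> n0 ik x2.
have [a [an [ha _]]] := near_coset n0 ik (le_trans (normRe_le_modulus x) x2).
have [b [bn [_ hb]]] := near_coset n0 ik (le_trans (normIm_le_modulus x) x2).
exists (Ordinal an), (Ordinal bn); apply: le_trans (modulus_le_ReIm _) _.
rewrite mulrDl mul1r; move: ha hb; case: x x2 => xr xi x2 /= ha hb.
exact: lerD.
Qed.

Lemma cvg_modulus_le (u : nat -> C) (l : C) (c : R) N0 : u @ \oo --> l ->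
  (forall N, (N0 <= N)%N -> modulus (u N) <= c) -> modulus l <= c.
Proof.
move=> /cvg_CplxP ul uc; apply/ler_addgt0Pr => e e0; have [N1 h] := ul e e0.
rewrite -(subrK (u (maxn N0 N1)) l) addrC; apply: le_trans (modulusD _ _) _.
by apply: lerD; [apply: uc; apply: leq_maxl | rewrite modulusB; apply: h; apply: leq_maxr].
Qed.

(* The tuples of points of the grids are finite nets on which Ff applies.     *)
Lemma uniform_of_lipschitz (k : nat) (p K K' eps : R) (N0 : nat)
    (F : nat -> (nat -> C) -> C) (f : (nat -> C) -> C) :
  let D x := forall i, (i < k)%N -> p^-1 <= modulus (x i) <= p in
  0 <= K -> 0 <= K' -> 1 < p <= 2 -> 0 < eps -> eps <= (1 - p^-1) / 2 ->
  (forall N x y, (N0 <= N)%N -> D x -> D y ->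
     modulus (F N x - F N y) <= K * \sum_(i < k) modulus (x i - y i)) ->
  (forall x y, D x -> D y -> modulus (f x - f y) <= K' * \sum_(i < k) modulus (x i - y i)) ->
  (forall x, D x -> (forall i, (i < k)%N -> x i != 1) ->
     (forall i j, (i < k)%N -> (j < k)%N -> x i = x j -> i = j) ->
     (F ^~ x) @ \oo --> f x) ->
  forall e, 0 < e -> exists N1, forall N x, (N1 <= N)%N ->
    (forall i, (i < k)%N -> 1 - eps < modulus (x i) < 1 + eps) -> modulus (F N x - f x) <= e.
Proof.
move=> D K0 K'0 /andP[p1 p2] eps0 epsp FK fK Ff e e0.
have p0 : 0 < p by apply: lt_trans p1.
have pV : 2 - p <= p^-1 by rewrite -[leRHS]mul1r ler_pdivlMr //; nra.
pose T := (K + K' + 1) * k.+1%:R.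
have T0 : 0 < T by rewrite mulr_gt0 ?ltr0n // ltr_wpDl ?addr_ge0.
pose eta := Num.min eps (e / 2 / T).
have eta0 : 0 < eta by rewrite lt_min eps0 !divr_gt0.
pose n := (Num.truncn (2 / eta)).+1.
have n0 : (0 < n)%N by [].
have neta : 2 / n%:R <= eta.
  rewrite ler_pdivrMr ?ltr0n // mulrC -ler_pdivrMr //; apply: ltW.
  by rewrite truncnS_gt.
pose Z (t : {ffun 'I_k -> 'I_(4 * n).+1 * 'I_(4 * n).+1}) (i : nat) : C :=
  if insub i is Some j then grid k n i (t j).1 (t j).2 else 1.
have ZE t (i : 'I_k) : Z t i = grid k n i (t i).1 (t i).2 by rewrite /Z valK.
have ZE' t i (ik : (i < k)%N) :
    Z t i = grid k n i (t (Ordinal ik)).1 (t (Ordinal ik)).2.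
  exact: (ZE t (Ordinal ik)).
have e20 : 0 < e / 2 by rewrite divr_gt0.
have Zcvg t : exists N1, D (Z t) -> forall N, (N1 <= N)%N -> modulus (F N (Z t) - f (Z t)) <= e / 2.
  have [DZ|nDZ] := pselect (D (Z t)); last by exists 0%N.
  have /cvg_CplxP/(_ _ e20)[N1 h] : (F ^~ (Z t)) @ \oo --> f (Z t).
    apply: Ff => // [i ik|i j ik jk]; first by rewrite ZE' grid_neq1.
    by rewrite !ZE'; apply: grid_neq.
  by exists N1.
pose N1 t := projT1 (cid (Zcvg t)).
exists (maxn N0 (\max_t N1 t)) => N x; rewrite geq_max => /andP[N0N N1N] xeps.
have xnear i : (i < k)%N -> exists ab : 'I_(4 * n).+1 * 'I_(4 * n).+1,
    modulus (x i - grid k n i ab.1 ab.2) <= eta.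
  move=> ik; have /andP[_ xu] := xeps i ik.
  have [|a [b h]] := @near_grid n k i (x i) n0 ik; first by lra.
  by exists (a, b); apply: le_trans neta.
pose t : {ffun 'I_k -> 'I_(4 * n).+1 * 'I_(4 * n).+1} :=
  [ffun i : 'I_k => projT1 (cid (xnear i (ltn_ord i)))].
have xt i : (i < k)%N -> modulus (x i - Z t i) <= eta.
  move=> ik; rewrite ZE' ffunE.
  exact: projT2 (cid (xnear (Ordinal ik) (ltn_ord (Ordinal ik)))).
have eta_eps : eta <= eps by rewrite ge_min lexx.
have Dx : D x.
  by move=> i /xeps/andP[h1 h2]; apply/andP; split; lra.
have DZ : D (Z t).
  move=> i ik; have /andP[h1 h2] := xeps i ik; have h3 := xt i ik.
  have h4 := modulus_dist_le (x i) (Z t i); have h5 := modulus_dist_le (Z t i) (x i).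
  by rewrite modulusB in h5; apply/andP; split; lra.
have ZN : modulus (F N (Z t) - f (Z t)) <= e / 2.
  apply: (projT2 (cid (Zcvg t))) => //; apply: leq_trans N1N.
  exact: (leq_bigmax (F := N1)).
have sum_eta : \sum_(i < k) modulus (x i - Z t i) <= k.+1%:R * eta.
  apply: (@le_trans _ _ (\sum_(i < k) eta)); first by apply: ler_sum => i _; apply: xt.
  by rewrite sumr_const card_ord -[eta *+ _]mulr_natl ler_wpM2r ?(ltW eta0) // ler_nat.
have -> : F N x - f x = (F N x - F N (Z t)) + ((F N (Z t) - f (Z t)) + (f (Z t) - f x)) by ring.
have b1 := FK N x (Z t) N0N Dx DZ; have b2 := fK x (Z t) Dx DZ.
rewrite modulusB in b2.
have bT : (K + K') * (\sum_(i < k) modulus (x i - Z t i)) <= e / 2.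
  apply: (@le_trans _ _ (T * eta)).
    rewrite /T -mulrA; apply: ler_pM => //; first by rewrite addr_ge0.
      by apply: sumr_ge0 => i _; apply: modulus_ge0.
    by rewrite lerDl.
  by rewrite mulrC -ler_pdivlMr // ge_min lexx orbT.
rewrite mulrDl in bT.
apply: le_trans (modulusD _ _) _.
have := modulusD (F N (Z t) - f (Z t)) (f (Z t) - f x).
lra.
Qed.

End Nets.

(** * Choice of radii and conclusion *)

Section UniformLimit.
Context {R : realType}.
Local Notation C := (Cplx R).

(** With theta = e^a and a (k+1) = ln rho, the number m = min(theta, rho, 1 + r) lies in (1, 2], and
    p = 1 + (m - 1)/4 then satisfies p^2 < m. *)
Lemma small_radius (rho r : R) (k : nat) : 1 < rho -> 0 < r < 1 ->
  exists p theta : R, [/\ 1 < p <= 2, p < 1 + r, p ^+ 2 < rho, p ^+ 2 < theta &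
    theta ^+ k <= rho].
Proof.
move=> rho1 /andP[r0 r1]; have rho0 : 0 < rho by apply: lt_trans rho1.
pose a := ln rho / k.+1%:R; have a0 : 0 < a by rewrite divr_gt0 // ln_gt0.
pose m := Num.min (expR a) (Num.min rho (1 + r)).
have m1 : 1 < m by rewrite !lt_min expR_gt1 a0 rho1 ltrDl.
have mr : m <= 1 + r by rewrite !ge_min lexx !orbT.
have m_rho : m <= rho by rewrite !ge_min lexx orbT.
have m_a : m <= expR a by rewrite ge_min lexx.
have p2m : (1 + (m - 1) / 4) ^+ 2 < m by rewrite expr2; nra.
exists (1 + (m - 1) / 4), (expR a); split; try lra.
rewrite -expRM_natr -[leRHS]lnK ?posrE // ler_expR /a -mulrA ler_piMr ?ln_ge0 ?(ltW rho1) //.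
by rewrite mulrC ler_pdivrMr // mul1r ler_nat.
Qed.

Lemma normalized_schurE (N k : nat) (l : signature N) (x : 'rV[C]_k) :
  (forall i, x 0 i != 0) ->
  normalized_schur l x = normalized_gt N (shifted_parts l) (pad1 k (coords x)).
Proof.
move=> x0; rewrite /normalized_schur !schur_gt; first last.
- by move=> i; rewrite mxE; case: insubP => // *; apply: oner_neq0.
- by move=> i; rewrite mxE oner_neq0.
have -> : gt_sum N (shifted_parts l) (coords (pad_ones N x)) =
    gt_sum N (shifted_parts l) (pad1 k (coords x)).
  apply: eq_gt_sum => i iN; rewrite (coords_ord _ iN) mxE /pad1 /coords; case: ifP => // ik.
  by rewrite insubF.
have -> // : gt_sum N (shifted_parts l) (coords (const_mx 1 : 'rV[C]_N)) =
    gt_sum N (shifted_parts l) (fun=> 1) :> C.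
by apply: eq_gt_sum => i iN; rewrite (coords_ord _ iN) mxE.
Qed.

Lemma uniform_cvg_rowP (k : nat) (A : set 'rV[C]_k) (F : nat -> 'rV[C]_k -> C)
    (f : 'rV[C]_k -> C) :
  (forall e : R, 0 < e -> exists N0, forall N x, (N0 <= N)%N -> A x ->
     modulus (F N x - f x) <= e) ->
  {uniform A, F @ \oo --> f}.
Proof.
move=> h P /uniform_nbhs[E [entE EP]]; apply: filterS EP _.
move: entE; rewrite -entourage_from_ballE => -[e /= e0 eE].
have eR : e = of_real (complex.Re e).
  by case: e e0 {eE} => a b; rewrite ltcE /= => /andP[/eqP -> _].
have e0' : 0 < complex.Re e by rewrite -of_real_lt -eR rmorph0.
have e20 : 0 < complex.Re e / 2 by rewrite divr_gt0.
have [N0 hN] := h _ e20; exists N0 => // N /= N0N y Ay; apply: eE => /=.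
rewrite -ball_normE /= -of_real_modulus eR of_real_lt modulusB.
apply: le_lt_trans (hN N y N0N Ay) _.
by rewrite ltr_pdivrMr // ltr_pMr // ltr1n.
Qed.

End UniformLimit.

Theorem theorem6p2 (R : realType)
  (alphap betap alpham betam : nat -> R) (gammap gammam : R)
  (alphap_decr : nonincreasing_seq alphap) (alphap_ge0 : forall i, 0 <= alphap i)
  (betap_decr : nonincreasing_seq betap) (betap_ge0 : forall i, 0 <= betap i)
  (alpham_decr : nonincreasing_seq alpham) (alpham_ge0 : forall i, 0 <= alpham i)
  (betam_decr : nonincreasing_seq betam) (betam_ge0 : forall i, 0 <= betam i)
  (sump_cvg : cvgn (series (fun i => alphap i + betap i)))
  (summ_cvg : cvgn (series (fun i => alpham i + betam i)))
  (gammap_ge0 : 0 <= gammap) (gammam_ge0 : 0 <= gammam)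
  (lambda : forall N : nat, signature N)
  (pp_cvg : forall i,
    frob_p R (pos_diagram (lambda N)) i / N%:R @[N --> \oo] --> alphap i)
  (qp_cvg : forall i,
    frob_q R (pos_diagram (lambda N)) i / N%:R @[N --> \oo] --> betap i)
  (pm_cvg : forall i,
    frob_p R (neg_diagram (lambda N)) i / N%:R @[N --> \oo] --> alpham i)
  (qm_cvg : forall i,
    frob_q R (neg_diagram (lambda N)) i / N%:R @[N --> \oo] --> betam i)
  (frob_sump_cvg :
    frob_sum R (pos_diagram (lambda N)) / N%:R @[N --> \oo] -->
      limn (series (fun i => alphap i + betap i)) + gammap)
  (frob_summ_cvg :
    frob_sum R (neg_diagram (lambda N)) / N%:R @[N --> \oo] -->
      limn (series (fun i => alpham i + betam i)) + gammam)
  (k : nat) :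
  exists2 eps : R, 0 < eps &
    {uniform [set x : 'rV[Cplx R]_k |
        forall l : 'I_k, of_real (1 - eps) < `|x 0 l| < of_real (1 + eps)],
      (fun (N : nat) (x : 'rV[Cplx R]_k) => normalized_schur (lambda N) x) @ \oo -->
      (fun x : 'rV[Cplx R]_k => \prod_(l < k)
        Phi_infty alphap betap alpham betam gammap gammam (x 0 l))}.
Proof.
have [rho [B [r [N0 [rho1 r01 N00 avgB lim1]]]]] := @schur_one_variable_limit R
  alphap betap alpham betam gammap gammam lambda alphap_ge0 betap_ge0 alpham_ge0 betam_ge0
  sump_cvg summ_cvg (@pp_cvg) (@qp_cvg) (@pm_cvg) (@qm_cvg) (@frob_sump_cvg) (@frob_summ_cvg).
set Phi := @Phi_infty R alphap betap alpham betam gammap gammam in lim1 *.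
have [p [theta [/andP[p1 p2] pr prho ptheta thetak]]] := small_radius k rho1 r01.
have /andP[r0 r1] := r01.
have p0 : 0 < p by apply: lt_trans p1.
have p_rho : p < rho by apply: le_lt_trans prho; rewrite expr2 ler_peMl // ltW.
have pV1 : p^-1 < 1 by rewrite invf_lt1.
have pVr : 1 - r < p^-1 by rewrite -[ltRHS]mul1r ltr_pdivlMr //; nra.
(* The case of one variable, with theta = rho: the Lipschitz bound passes to the limit, so [Phi] is
   Lipschitz and bounded on the annulus without any direct estimate of the infinite product. *)
have [K1 [K10 lip1]] := @normalized_gt_lipschitz R lambda rho B N0 N00 rho1 avgB 1 p rho
  (ltW p1) prho (lexx _).
have [K [K0 lipk]] := normalized_gt_lipschitz N00 rho1 avgB (ltW p1) ptheta thetak.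
have limPhi (x : Cplx R) : p^-1 <= modulus x <= p ->
    (fun N => normalized_gt N (shifted_parts (lambda N)) (pad1 1 (fun=> x))) @ \oo --> Phi x.
  move=> /andP[xl xu]; apply: lim1; apply/andP; split.
    exact: lt_le_trans xl.
  exact: le_lt_trans xu pr.
have PhiL (x y : Cplx R) : p^-1 <= modulus x <= p -> p^-1 <= modulus y <= p ->
    modulus (Phi x - Phi y) <= K1 * modulus (x - y).
  move=> xp yp; apply: (@cvg_modulus_le R _ _ _ N0 (cvgB (limPhi x xp) (limPhi y yp))).
  move=> N N0N /=; have := lip1 N (fun=> x) (fun=> y) N0N (leq_trans N00 N0N).
  by rewrite big_ord1; apply.
have one_p : p^-1 <= modulus (1 : Cplx R) <= p by rewrite modulus1 !ltW.
(* On the annulus |x - 1| <= p + 1 <= 3; the summand 1 ensures M >= 1, as [modulus_prod_sub]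
   requires. *)
pose M := 1 + modulus (Phi 1) + K1 * 3.
have PhiM (x : Cplx R) : p^-1 <= modulus x <= p -> modulus (Phi x) <= M.
  move=> xp; rewrite -(subrK (Phi 1) (Phi x)); apply: le_trans (modulusD _ _) _.
  have h : K1 * modulus (x - 1) <= K1 * 3.
    rewrite ler_wpM2l //; apply: le_trans (modulus_sub_le _ _) _; rewrite modulus1.
    by case/andP: xp => _ xp; lra.
  by have := PhiL x 1 xp one_p; rewrite /M; lra.
have M1 : 1 <= M by rewrite /M -addrA lerDl addr_ge0 ?modulus_ge0 ?mulr_ge0.
have M0 : 0 <= M by apply: le_trans M1.
(* Half of the available width: a net point within eps of x still satisfies p^-1 <= |z| <= p,
   because 1 - 2 eps = p^-1 and 1 + 2 eps <= p. *)
pose eps := (1 - p^-1) / 2; have eps0 : 0 < eps by rewrite divr_gt0 // subr_gt0.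
exists eps => //; apply: uniform_cvg_rowP => e e0.
pose F N (x : nat -> Cplx R) := normalized_gt N (shifted_parts (lambda N)) (pad1 k x).
pose f (x : nat -> Cplx R) := \prod_(i < k) Phi (x i).
have fL (x y : nat -> Cplx R) : (forall i, (i < k)%N -> p^-1 <= modulus (x i) <= p) ->
    (forall i, (i < k)%N -> p^-1 <= modulus (y i) <= p) ->
    modulus (f x - f y) <= M ^+ k * K1 * \sum_(i < k) modulus (x i - y i).
  move=> xp yp; have := @modulus_prod_sub R (index_iota 0 k) (fun i => Phi (x i))
    (fun i => Phi (y i)) (fun=> M).
  rewrite !big_mkord prodr_const card_ord => h; apply: le_trans (h _ _ _) _ => //.
  - by move=> i; rewrite mem_index_iota => /andP[_ /xp/PhiM].
  - by move=> i; rewrite mem_index_iota => /andP[_ /yp/PhiM].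
  rewrite -mulrA ler_wpM2l ?exprn_ge0 // mulr_sumr; apply: ler_sum => i _.
  by apply: PhiL; [apply: xp | apply: yp].
have fFk N x y : (maxn N0 k <= N)%N ->
    (forall i, (i < k)%N -> p^-1 <= modulus (x i) <= p) ->
    (forall i, (i < k)%N -> p^-1 <= modulus (y i) <= p) ->
    modulus (F N x - F N y) <= K * \sum_(i < k) modulus (x i - y i).
  by rewrite geq_max => /andP[N0N kN] xp yp; apply: lipk.
have Ff (x : nat -> Cplx R) : (forall i, (i < k)%N -> p^-1 <= modulus (x i) <= p) ->
    (forall i, (i < k)%N -> x i != 1) ->
    (forall i j, (i < k)%N -> (j < k)%N -> x i = x j -> i = j) -> F ^~ x @ \oo --> f x.
  move=> xp x1 xi.
  have evalS N (z : Cplx R) : (N0 <= N)%N -> z != 0 -> leval (gt_laurent lambda N) z =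
      normalized_gt N (shifted_parts (lambda N)) (pad1 1 (fun=> z)).
    by move=> N0N _; apply: leval_gt_laurent N0N.
  have lb := lbounded_gt_laurent N00 avgB (ltW p1) p_rho.
  have limS i : (i < k)%N -> (fun N => leval (gt_laurent lambda N) (x i)) @ \oo --> Phi (x i).
    move=> ik; have := limPhi (x i) (xp i ik); apply: (cvgn_eq_near (N0 := N0)) => N N0N.
    by rewrite (leval_gt_laurent lambda N00 _ N0N).
  exact: (@normalized_gt_cvg R p N0 (fun N => shifted_parts (lambda N)) (gt_laurent lambda)
    (ltW p1) (fun N => sorted_shifted_parts (lambda N))
    (fun N => size_shifted_parts (lambda N)) evalS lb k x (fun i => Phi (x i)) x1 xp xi limS).
have MK : 0 <= M ^+ k * K1 by rewrite mulr_ge0 ?exprn_ge0.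
have p12 : 1 < p <= 2 by rewrite p1.
have [N1 hN1] := uniform_of_lipschitz K0 MK p12 eps0 (lexx _) fFk fL Ff e0.
exists N1 => N x N1N Ax.
have xA (l : 'I_k) : 1 - eps < modulus (x 0 l) < 1 + eps.
  by have := Ax l; rewrite -of_real_modulus !of_real_lt.
rewrite normalized_schurE => [|l]; last first.
  rewrite -modulus_gt0; have /andP[h _] := xA l; apply: lt_trans h.
  have : 0 < p^-1 by rewrite invr_gt0.
  by rewrite /eps; lra.
have -> : \prod_(l < k) Phi (x 0 l) = f (coords x).
  by apply: eq_bigr => l _; rewrite coordsE.
apply: hN1 => // i ik; rewrite (coords_ord x ik); exact: xA.
Qed.
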